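(* Suppose that the binomial system $p_i(c;x)=x_i^{r_i}-c_ix^{\beta_i}$, $i=1,\dots,n$, is in normal form and in triangular form relative to blocks $I_1,\dots,I_s$, with associated directed acyclic graph $G$ and weights $\delta_a,\rho_a,\mu_a$, $a\in[s]$. For generic parameters $c\in(k^* )^n$, the total number of solutions in $\bar k^n$ of the system $p_1(c;x)=\cdots=p_n(c;x)=0$, counted without multiplicity, equals $$D=\sum_{H\in\mathcal{F}(G)}\Big(\prod_{a\notin H}\delta_a\Big),$$ and the total number of solutions counted with multiplicity equals $$d=\sum_{H\in\mathcal{F}(G)}\Big(\prod_{a\notin H}\delta_a\Big)\Big(\prod_{b\in H\setminus S(H)}\rho_b\Big)\Big(\prod_{e\in S(H)}\mu_e\Big).$$
   Context: $k$ is a field of characteristic zero with algebraic closure $\bar k$; $\mathbb{N}$ includes $0$; $[n]=\{1,\dots,n\}$; empty products are $1$. A system of $n$ binomials $p_j=x^{\alpha_j}-c_jx^{\beta_j}$ in $x_1,\dots,x_n$ ($\alpha_j\neq\beta_j$ in $\mathbb{N}^n$) is in normal form if $p_i=x_i^{r_i}-c_ix^{\beta_i}$, $r_i>0$, $\beta_i\ne0$, for all $i\in[n]$. Its matrix $B$ has $i$-th row $r_ie_i-\beta_i$. A system is irreducible if it is in normal form and there is no proper non-empty subset $I$ of its indices such that for every $i\in I$, $p_i$ depends only on the variables $x_j$, $j\in I$. ''Generic $c$'' means all $c$ in a non-empty Zariski open subset of $(k^* )^n$. The multiplicity of a solution is the dimension over $\bar k$ of the local ring at that point of the quotient of $\bar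 k[x]$ by the ideal generated by the binomials. Triangular form: there are $0=\nu_0<\nu_1<\dots<\nu_s=n$ such that, with $I_a=\{\nu_{a-1}+1,\dots,\nu_a\}$, for $i\in I_a$ the binomial $p_i$ depends only on $x_j$ with $j\in I_1\cup\dots\cup I_a$, and the system $\hat p^a$ in the variables $x_j,\ j\in I_a$, obtained from $p_i$, $i\in I_a$, by setting $x_j=1$ for $j\le\nu_{a-1}$, is irreducible (in particular in normal form). Then $B$ is block lower triangular with diagonal blocks $B_a$ (the matrix of $\hat p^a$) and blocks $C_{ba}$ (rows $I_b$, columns $I_a$), $b>a$. Put $\delta_a=|\det B_a|$, $\rho_a=\prod_{j\in I_a}r_j$, and let $\mu_a$ be the multiplicity of the origin as a solution of $\hat p^a$ for generic coefficients. $G$ is the directed graph with vertex set $[s]$ and an arrow from $a$ to $b$ if and only if $C_{ba}$ is not identically zero. A subgraph $H$ of $G$ is full if for each of its vertices $j$, all descendants of $j$ (vertices reachable by a directed path from $j$) and all directed paths starting from $j$ belong to $H$; the empty subgraph is full. $\mathcal{F}(G)$ is the collection of full subgraphs of $G$. $S(H)$ is the set of sources of $H$, i.e. vertices of $H$ that are not the head of any arrow of $H$. *)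

(* Defs.v *)
From HB Require Import structures.
From mathcomp Require Import all_boot all_order all_algebra.
From mathcomp Require Import mpoly.

Set Implicit Arguments.
Unset Strict Implicit.
Unset Printing Implicit Defensive.

Import Order.TTheory GRing.Theory Num.Theory.
Local Open Scope ring_scope.

Definition lead_exp n (r : 'I_n -> nat) (i : 'I_n) : 'X_{1..n} :=
  (U_(i) *+ r i)%MM.

Definition binomial_system (R : comNzRingType) n (r : 'I_n -> nat)
    (beta : 'I_n -> 'X_{1..n}) (c : 'I_n -> R) (i : 'I_n) : {mpoly R[n]} :=
  'X_[lead_exp r i] - c i *: 'X_[beta i].

(* The last clause is the requirement that the two exponent vectors of a      *)
(* binomial be different.                                                     *)
Definition normal_form n (r : 'I_n -> nat) (beta : 'I_n -> 'X_{1..n}) : Prop :=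
  forall i, [/\ (0 < r i)%N, beta i != 0%MM & lead_exp r i != beta i].

(* x_j occurs in p_i; as the coefficients are nonzero and the two monomials   *)
(* differ, this can be read off the exponents.                                *)
Definition occurs n (r : 'I_n -> nat) (beta : 'I_n -> 'X_{1..n})
    (i j : 'I_n) : bool :=
  (lead_exp r i j != 0%N) || (beta i j != 0%N).

Definition irreducible_system n (r : 'I_n -> nat)
    (beta : 'I_n -> 'X_{1..n}) : Prop :=
  normal_form r beta /\
  ~ (exists I : {set 'I_n}, [/\ I \proper [set: 'I_n], I != set0 &
       forall i, i \in I -> forall j, occurs r beta i j -> j \in I]).

Definition system_matrix n (r : 'I_n -> nat)
    (beta : 'I_n -> 'X_{1..n}) : 'M[int]_n :=
  \matrix_(i, j) ((lead_exp r i j)%:Z - (beta i j)%:Z).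

(* Indices start at 0: block n nu a is {i | nu a <= i < nu (a+1)}.            *)
Definition block n (nu : nat -> nat) (a : nat) : {set 'I_n} :=
  [set i : 'I_n | (nu a <= i < nu a.+1)%N].

(* sub_r and sub_beta are the exponents of the system in the variables x_j,   *)
(* j in A, obtained from the p_i, i in A, by setting all the other variables  *)
(* to 1; enum_val enumerates A increasingly.                                  *)
Definition sub_r n (A : {set 'I_n}) (r : 'I_n -> nat) (i : 'I_#|A|) : nat :=
  r (enum_val i).

Definition sub_beta n (A : {set 'I_n}) (beta : 'I_n -> 'X_{1..n})
    (i : 'I_#|A|) : 'X_{1..#|A|} :=
  [multinom beta (enum_val i) (enum_val j) | j < #|A|].

Definition triangular_form n (r : 'I_n -> nat) (beta : 'I_n -> 'X_{1..n})
    (s : nat) (nu : nat -> nat) : Prop :=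
  [/\ nu 0%N = 0%N, nu s = n,
      forall a, (a < s)%N -> (nu a < nu a.+1)%N,
      forall a i, (a < s)%N -> i \in block n nu a ->
        forall j, occurs r beta i j -> (j < nu a.+1)%N
    & forall a, (a < s)%N ->
        irreducible_system (@sub_r n (block n nu a) r)
                           (@sub_beta n (block n nu a) beta)].

Definition delta n (r : 'I_n -> nat) (beta : 'I_n -> 'X_{1..n})
    (nu : nat -> nat) (a : nat) : nat :=
  `|\det (system_matrix (@sub_r n (block n nu a) r)
                        (@sub_beta n (block n nu a) beta))|%N.

Definition rho n (r : 'I_n -> nat) (nu : nat -> nat) (a : nat) : nat :=
  (\prod_(j in block n nu a) r j)%N.

Definition arrow n (r : 'I_n -> nat) (beta : 'I_n -> 'X_{1..n})
    (s : nat) (nu : nat -> nat) : rel 'I_s :=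
  fun a b => (a < b)%N &&
    [exists i in block n nu b, exists j in block n nu a,
       system_matrix r beta i j != 0].

(* A subgraph is a pair (vertices, arrows). *)
Definition is_subgraph (V : finType) (e : rel V)
    (H : {set V} * {set V * V}) : bool :=
  [forall ab in H.2, [&& e ab.1 ab.2, ab.1 \in H.1 & ab.2 \in H.1]].

(* The arrows lying on some directed path from j are the arrows l -> m with l *)
(* reachable from j (connect is the reflexive transitive closure).            *)
Definition is_full (V : finType) (e : rel V)
    (H : {set V} * {set V * V}) : bool :=
  [forall j in H.1,
     [forall l, connect e j l ==> (l \in H.1)] &&
     [forall l, forall m, (connect e j l && e l m) ==> ((l, m) \in H.2)]].

Definition full_subgraphs (V : finType) (e : rel V) :
    {set {set V} * {set V * V}} :=
  [set H | is_subgraph e H && is_full e H].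

Definition sources (V : finType) (H : {set V} * {set V * V}) : {set V} :=
  [set b in H.1 | ~~ [exists a, (a, b) \in H.2]].

Definition torus_zariski_open (k : fieldType) n
    (U : {ffun 'I_n -> k} -> Prop) : Prop :=
  exists F : {mpoly k[n]} -> Prop, forall c : {ffun 'I_n -> k},
    U c <-> (forall i, c i != 0) /\ (exists2 f, F f & f.@[c] != 0).

Definition generic (k : fieldType) n (P : {ffun 'I_n -> k} -> Prop) : Prop :=
  exists U : {ffun 'I_n -> k} -> Prop,
    [/\ torus_zariski_open U, (exists c, U c) & forall c, U c -> P c].

Definition in_ideal (K : fieldType) n (p : 'I_n -> {mpoly K[n]})
    (f : {mpoly K[n]}) : Prop :=
  exists q : 'I_n -> {mpoly K[n]}, f = \sum_i q i * p i.

(* The local ring at x of K[X] / (p_1, ..., p_n) is the localization of this  *)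
(* quotient at the maximal ideal of x. Its elements are represented by pairs  *)
(* (f, g), standing for f / g, of polynomials with g(x) != 0, and two pairs   *)
(* (f, g), (f', g') represent the same element iff h (f g' - f' g) = 0 in the *)
(* quotient for some h with h(x) != 0.                                        *)
Definition frac (K : fieldType) n : Type := ({mpoly K[n]} * {mpoly K[n]})%type.

Definition frac_at (K : fieldType) n (x : {ffun 'I_n -> K})
    (u : frac K n) : Prop :=
  u.2.@[x] != 0.

Definition local_eq (K : fieldType) n (p : 'I_n -> {mpoly K[n]})
    (x : {ffun 'I_n -> K}) (u v : frac K n) : Prop :=
  exists2 h : {mpoly K[n]}, h.@[x] != 0 &
    in_ideal p (h * (u.1 * v.2 - v.1 * u.2)).

Definition frac_add (K : fieldType) n (u v : frac K n) : frac K n :=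
  (u.1 * v.2 + v.1 * u.2, u.2 * v.2).

Definition frac_zero (K : fieldType) n : frac K n := (0, 1).

Definition frac_scale (K : fieldType) n (a : K) (u : frac K n) : frac K n :=
  (a *: u.1, u.2).

(* The local ring has a K-basis with m elements. *)
Definition is_multiplicity (K : fieldType) n (p : 'I_n -> {mpoly K[n]})
    (x : {ffun 'I_n -> K}) (m : nat) : Prop :=
  exists e : 'I_m -> frac K n,
    (forall j, frac_at x (e j)) /\
    (forall u, frac_at x u ->
       exists! a : {ffun 'I_m -> K},
         local_eq p x u
           (\big[@frac_add K n/@frac_zero K n]_(j < m) frac_scale (a j) (e j))).

Definition is_generic_origin_multiplicity (k K : fieldType)
    (iota : {rmorphism k -> K}) n (r : 'I_n -> nat)
    (beta : 'I_n -> 'X_{1..n}) (m : nat) : Prop :=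
  generic (fun c : {ffun 'I_n -> k} =>
    is_multiplicity (binomial_system r beta (fun i => iota (c i)))
                    [ffun=> 0] m).

Definition is_solution (K : fieldType) n (p : 'I_n -> {mpoly K[n]})
    (x : {ffun 'I_n -> K}) : Prop :=
  forall i, (p i).@[x] = 0.

Definition enumerates_solutions (K : fieldType) n (p : 'I_n -> {mpoly K[n]})
    (sol : seq {ffun 'I_n -> K}) : Prop :=
  uniq sol /\ (forall x, x \in sol <-> is_solution p x).

Definition number_of_solutions (K : fieldType) n (p : 'I_n -> {mpoly K[n]})
    (N : nat) : Prop :=
  exists2 sol, enumerates_solutions p sol & size sol = N.

Definition number_of_solutions_with_multiplicity (K : fieldType) n
    (p : 'I_n -> {mpoly K[n]}) (N : nat) : Prop :=
  exists sol, exists mult : {ffun 'I_n -> K} -> nat,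
    [/\ enumerates_solutions p sol,
        forall x, x \in sol -> is_multiplicity p x (mult x)
      & (\sum_(x <- sol) mult x)%N = N].

(* Main.v *)
(* The coordinates of a solution vanish exactly on the blocks belonging to a  *)
(* set Z of vertices closed under descendants, and these sets are the full    *)
(* subgraphs. Outside Z the solution is a torus solution of a binomial system *)
(* whose matrix has determinant +- prod_(a notin Z) delta_a, so the Smith     *)
(* normal form counts them; if the determinant is 0 there are none for        *)
(* generic c.                                                                 *)
(*                                                                            *)
(* At such a solution x the Jacobian criterion (with Nakayama's lemma) shows  *)
(* that the local ring is that of the origin for the equations of the blocks  *)
(* in Z, with the nonzero coordinates replaced by their values. Every         *)
(* variable of a block that is not a source of Z depends, through a chain of  *)
(* equations, on the vanishing variables of the sources. Hence there are      *)
(* weights for which x_i^r_i is the term of lowest weight of p_i for all i in *)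
(* these blocks, and p_i may be replaced by x_i^r_i without changing the      *)
(* multiplicity. The remaining system is a product over the sources and over  *)
(* these variables.                                                           *)
(*                                                                            *)
(* The coefficients of the systems of the sources are those of p multiplied   *)
(* by monomials in the torus coordinates of x. They are generic because some  *)
(* power of them is a monomial map of c.                                      *)

Require Import Defs.
From mathcomp Require Import all_boot all_order all_algebra all_solvable all_field.
From mathcomp Require Import ssrcomplements mpoly ring zify.
From Stdlib Require Import ClassicalEpsilon FunctionalExtensionality.

Set Implicit Arguments.
Unset Strict Implicit.
Unset Printing Implicit Defensive.

Import Order.TTheory GRing.Theory Num.Theory.
Local Open Scope ring_scope.

(** * Local rings and codimension *)

(** Counting. If a variable of [beta i] vanishes at a solution, so does [x_i], and irreducibility
    spreads a zero over its whole block. Hence the zero blocks of a solution form a set [Z] closed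
    under arrows ([solution_pattern]), and these sets are the vertex sets of the full subgraphs
    ([sum_full_subgraphs]). Writing coefficients into the zero coordinates identifies the solutions
    with zero blocks [Z] with the torus points sent to [c] by a square monomial map
    ([pattern_solutions]). The Smith normal form counts them by the absolute value of the
    determinant ([torus_count]), which factors over the blocks ([det_block_triangular]). If it is
    zero, the image of the map satisfies a nontrivial equation, which generic [c] violates
    ([mpow_dependent]).

    Multiplicities. A local ring enters only through the kernel [in_loc] of the map from polynomials
    to it, and its dimension is the codimension of this kernel ([is_multiplicityP]). At a solution
    the nonzero coordinates may be frozen at their values ([has_codim_fibre]). The variables then
    separate, and codimensions multiply ([has_codim_product]): each source gives its [mu], every
    other block of [Z] its [rho].

    Genericity. The numbers [mu] are known for generic coefficients in [k], but the source systems
    at a solution have coefficients in [K] that depend on the solution. Multiplicity [mu] is the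
    corank of a finite matrix ([mult_trunc], [trunc_mult]), so it holds off the zeros of a
    polynomial over [K] ([generic_multiplicity_extend]). That polynomial becomes a condition on the
    torus point, then on [c] ([mpow_push]), and finally one with coefficients in [k] ([descend]). *)

Section Ideals.
Variables (K : fieldType) (n : nat).
Implicit Types (p q : 'I_n -> {mpoly K[n]}) (f g h : {mpoly K[n]}).
Implicit Types (x : {ffun 'I_n -> K}).

(* The kernel of the map from K[X] to the local ring at x of K[X] / (p). *)
Definition in_loc p x f : Prop :=
  exists2 h, h.@[x] != 0 & in_ideal p (h * f).

Lemma in_ideal0 p : in_ideal p 0.
Proof. by exists (fun=> 0); rewrite big1 // => i _; rewrite mul0r. Qed.

Lemma in_idealD p f g : in_ideal p f -> in_ideal p g -> in_ideal p (f + g).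
Proof.
case=> a -> [b ->]; exists (fun i => a i + b i).
by rewrite -big_split; apply: eq_bigr => i _; rewrite mulrDl.
Qed.

Lemma in_idealM p f g : in_ideal p f -> in_ideal p (g * f).
Proof.
case=> a ->; exists (fun i => g * a i).
by rewrite mulr_sumr; apply: eq_bigr => i _; rewrite mulrA.
Qed.

Lemma in_ideal_gen p i : in_ideal p (p i).
Proof.
exists (fun j => (i == j)%:R).
rewrite (bigD1 i) //= eqxx mul1r big1 ?addr0 // => j.
by rewrite eq_sym => /negbTE ->; rewrite mul0r.
Qed.

Lemma in_ideal_loc p x f : in_ideal p f -> in_loc p x f.
Proof. by exists 1; rewrite ?meval1 ?oner_eq0 ?mul1r. Qed.

Lemma in_loc_gen p x i : in_loc p x (p i).
Proof. exact/in_ideal_loc/in_ideal_gen. Qed.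

Lemma in_loc0 p x : in_loc p x 0.
Proof. exact/in_ideal_loc/in_ideal0. Qed.

Lemma in_locD p x f g : in_loc p x f -> in_loc p x g -> in_loc p x (f + g).
Proof.
case=> a a0 af [b b0 bg]; exists (a * b); first by rewrite mevalM mulf_neq0.
have -> : a * b * (f + g) = b * (a * f) + a * (b * g) by ring.
by apply: in_idealD; apply: in_idealM.
Qed.

Lemma in_locM p x f g : in_loc p x f -> in_loc p x (g * f).
Proof. by case=> a a0 af; exists a; rewrite // mulrCA; apply: in_idealM. Qed.

Lemma in_locN p x f : in_loc p x f -> in_loc p x (- f).
Proof. by move/(in_locM (-1)); rewrite mulN1r. Qed.

Lemma in_locB p x f g : in_loc p x f -> in_loc p x g -> in_loc p x (f - g).
Proof. by move=> ? /in_locN; apply: in_locD. Qed.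

Lemma in_locZ p x c f : in_loc p x f -> in_loc p x (c *: f).
Proof. by rewrite -mul_mpolyC; apply: in_locM. Qed.

Lemma in_loc_sum p x (I : Type) (s : seq I) (P : pred I)
    (F : I -> {mpoly K[n]}) :
  (forall i, P i -> in_loc p x (F i)) -> in_loc p x (\sum_(i <- s | P i) F i).
Proof.
by move=> H; elim/big_ind: _ => //; [exact: in_loc0 | move=> *; exact: in_locD].
Qed.

Lemma in_loc_cancel p x g f : g.@[x] != 0 -> in_loc p x (g * f) -> in_loc p x f.
Proof.
move=> g0 [h h0 H]; exists (h * g); first by rewrite mevalM mulf_neq0.
by rewrite -mulrA.
Qed.

Lemma in_loc_trans p q x f :
  (forall i, in_loc q x (p i)) -> in_loc p x f -> in_loc q x f.
Proof.
move=> H [h h0 [a Ea]]; apply: (in_loc_cancel h0).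
by rewrite Ea; apply: in_loc_sum => i _; apply: in_locM.
Qed.

(** An explicit surjection onto row vectors stands for the quotient by [I], so that no quotient type
    has to be built from a mere predicate. *)
Definition has_codim (I : {mpoly K[n]} -> Prop) (m : nat) : Prop :=
  exists phi : {mpoly K[n]} -> 'rV[K]_m,
    [/\ linear phi, forall v, exists f, phi f = v & forall f, phi f = 0 <-> I f].

Lemma linear0E (M : lmodType K) (phi : {mpoly K[n]} -> M) : linear phi -> phi 0 = 0.
Proof.
by move=> lin; have := lin (-1) 0 0; rewrite scaler0 addr0 scaleN1r addrC subrr.
Qed.

Lemma linear_sumE m (phi : {mpoly K[n]} -> 'rV[K]_m) (lin : linear phi)
    (I : Type) (s : seq I) (a : I -> K) (F : I -> {mpoly K[n]}) :
  phi (\sum_(i <- s) a i *: F i) = \sum_(i <- s) a i *: phi (F i).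
Proof.
elim: s => [|i s IH]; first by rewrite !big_nil linear0E.
by rewrite !big_cons lin IH.
Qed.

Lemma linearBE m (phi : {mpoly K[n]} -> 'rV[K]_m) (lin : linear phi) f g :
  phi (f - g) = phi f - phi g.
Proof. by rewrite addrC -scaleN1r lin scaleN1r addrC. Qed.

Lemma linear_kereq m (phi : {mpoly K[n]} -> 'rV[K]_m) (lin : linear phi)
   (I : {mpoly K[n]} -> Prop) f g :
  (forall f, phi f = 0 <-> I f) -> phi f = phi g <-> I (f - g).
Proof.
move=> ker; rewrite -ker linearBE //; split=> [->|]; first by rewrite subrr.
by move/eqP; rewrite subr_eq0 => /eqP.
Qed.

(* The images of f, g f, ..., g^m f are linearly dependent. *)
Lemma power_dependence m (phi : {mpoly K[n]} -> 'rV[K]_m) (lin : linear phi) g f :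
  exists t s, (t <= m)%N /\ phi (g ^+ t * (1 + g * s) * f) = 0.
Proof.
pose A := \matrix_(t < m.+1) phi (g ^+ t * f).
have : kermx A != 0.
  rewrite -mxrank_eq0 mxrank_ker subn_eq0 -ltnNge ltnS; exact: rank_leq_col.
case/rowV0Pn => v /sub_kermxP vA v0.
have {v0} /ex_minnP[t0 /existsP[t /andP[/eqP tt0 vt]] tmin] :
    exists t, [exists i : 'I_m.+1, (i == t :> nat) && (v 0 i != 0)].
  have /rV0Pn[i vi] := v0; exists (i : nat).
  by apply/existsP; exists i; rewrite eqxx.
exists t, (\sum_(i < m.+1 | (t < i)%N) ((v 0 t)^-1 * v 0 i) *: g ^+ (i - t.+1)).
split; first by rewrite -ltnS.
have : phi (\sum_i v 0 i *: (g ^+ i * f)) = 0.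
  rewrite linear_sumE // -[RHS]vA; apply/rowP => j; rewrite mxE summxE.
  by apply: eq_bigr => i _; rewrite !mxE.
set S := \sum_i _; set S' := _ * _ * f.
suff -> : S' = (v 0 t)^-1 *: S.
  move=> S0; have := lin (v 0 t)^-1 S 0.
  by rewrite !addr0 S0 scaler0 linear0E // addr0.
rewrite /S /S' [in RHS](bigID (fun i : 'I__ => (t < i)%N)) /= addrC.
rewrite [in RHS](bigD1 t) ?ltnn //=.
rewrite [X in _ + X + _]big1 ?addr0; last first.
  move=> i /andP[]; rewrite -leqNgt => le_it ne_it.
  have lti : (i < t)%N by rewrite ltn_neqAle ne_it.
  case: (eqVneq (v 0 i) 0) => [->|vi]; first by rewrite scale0r.
  have := tmin i; rewrite -tt0 ; rewrite leqNgt lti => /(_ _)/negP[] //.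
  by apply/existsP; exists i; rewrite eqxx.
rewrite scalerDr scalerA mulVf // scale1r mulrDr mulr1 mulrDl; congr (_ + _).
rewrite !mulr_sumr mulr_suml scaler_sumr; apply: eq_bigr => i lti.
rewrite scalerA -!scalerAr -scalerAl; congr (_ *: (_ * _)).
by rewrite -exprS -exprD -addSnnS addnC addnS -addnS subnK.
Qed.

(** In the relation of [power_dependence] the factor [g ^+ t] cancels because [g] does not vanish at
    [x], which leaves [f] congruent to [g * (- s * f)]. *)
Lemma loc_unit_surjective m (phi : {mpoly K[n]} -> 'rV[K]_m) (lin : linear phi) p x :
  (forall f, phi f = 0 <-> in_loc p x f) ->
  forall g f, g.@[x] != 0 -> exists f', phi (g * f') = phi f.
Proof.
move=> ker g f g0; have [t [s [_ H]]] := power_dependence lin g f.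
exists (- s * f); apply/(linear_kereq lin _ _ ker).
have -> : g * (- s * f) - f = - ((1 + g * s) * f) by ring.
apply: in_locN; apply: (@in_loc_cancel p x (g ^+ t)).
  by rewrite rmorphXn /= expf_neq0.
by rewrite mulrA; apply/ker.
Qed.

Lemma frac_sum_denom m (e : 'I_m -> Defs.frac K n) (a : 'I_m -> K) (s : seq 'I_m)
    (F : 'I_m -> {mpoly K[n]}) D : (forall j, D = (e j).2 * F j) ->
  let u := \big[@frac_add K n/@frac_zero K n]_(j <- s) frac_scale (a j) (e j) in
  u.1 * D = u.2 * \sum_(j <- s) a j *: ((e j).1 * F j).
Proof.
move=> DE /=; elim: s => [|i s IH]; first by rewrite !big_nil /= mul0r mulr0.
rewrite !big_cons /=; set u := \big[_/_]_(_ <- s) _ in IH *.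
set S := \sum_(_ <- s) _ in IH *.
rewrite mulrDl -mulrA [_.2 * D]mulrC mulrA {1}(DE i) mulrAC.
have -> : u.1 * (e i).2 * D = (e i).2 * (u.1 * D) by ring.
by rewrite IH -!mul_mpolyC; ring.
Qed.

Lemma frac_sum_at m x (e : 'I_m -> Defs.frac K n) (a : 'I_m -> K) (s : seq 'I_m) :
  (forall j, frac_at x (e j)) ->
  frac_at x (\big[@frac_add K n/@frac_zero K n]_(j <- s) frac_scale (a j) (e j)).
Proof.
move=> H; elim: s => [|i s IH]; first by rewrite big_nil /frac_at meval1 oner_eq0.
by rewrite big_cons /frac_at mevalM mulf_neq0 //; apply: H.
Qed.

(** Over the common denominator [D], an equality of fractions becomes the membership of one
    polynomial in [in_loc], where linear algebra applies. *)
Lemma local_eq_sum p x m (e : 'I_m -> Defs.frac K n) (a : 'I_m -> K)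
    (F : 'I_m -> {mpoly K[n]}) D u :
  (forall j, frac_at x (e j)) -> D.@[x] != 0 -> (forall j, D = (e j).2 * F j) ->
  local_eq p x u (\big[@frac_add K n/@frac_zero K n]_(j < m) frac_scale (a j) (e j))
  <-> in_loc p x (u.1 * D - u.2 * \sum_j a j *: ((e j).1 * F j)).
Proof.
move=> He D0 DE; have := frac_sum_denom a (index_enum _) DE => /=.
have := frac_sum_at a (index_enum _) He; rewrite /frac_at.
set v := \big[_/_]_j _; set S := \sum_j _ => v0 E.
rewrite /local_eq -/(in_loc p x _).
have E' : D * (u.1 * v.2 - v.1 * u.2) = v.2 * (u.1 * D - u.2 * S).
  have -> : D * (u.1 * v.2 - v.1 * u.2) = u.1 * v.2 * D - u.2 * (v.1 * D) by ring.
  by rewrite E; ring.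
split=> H.
  by apply: (in_loc_cancel v0); rewrite -E'; apply: in_locM.
by apply: (in_loc_cancel D0); rewrite E'; apply: in_locM.
Qed.

Arguments local_eq_sum {p x m e} a {F D} u.

(* Multiplication by g with g(x) != 0 is injective on the finite dimensional  *)
(* space K[X] / in_loc p x, hence surjective: every fraction is the class of  *)
(* a polynomial.                                                              *)
Lemma is_multiplicityP p x m :
  is_multiplicity p x m <-> has_codim (in_loc p x) m.
Proof.
split=> [[e [He Hu]]|[phi [lin surj ker]]].
  pose D := \prod_j (e j).2; pose F j := \prod_(i | i != j) (e i).2.
  have DE j : D = (e j).2 * F j by rewrite /D (bigD1 j).
  have D0 : D.@[x] != 0.
    by rewrite /D rmorph_prod /=; apply/prodf_neq0 => j _; apply: He.
  pose e' j := (e j).1 * F j.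
  have Hex f : exists a : 'rV[K]_m,
      in_loc p x (f * D - \sum_j a 0 j *: e' j).
    have [|a [Ha _]] := Hu (f, 1); first by rewrite /frac_at meval1 oner_eq0.
    exists (\row_j a j); move/(local_eq_sum a (f, 1) He D0 DE): Ha => /=.
    by rewrite mul1r; under [X in _ -> in_loc _ _ (_ - X)]eq_bigr do rewrite mxE.
  have Hun (a b : 'rV[K]_m) : in_loc p x (\sum_j a 0 j *: e' j - \sum_j b 0 j *: e' j) -> a = b.
    move=> H; have [|c [_ Hc]] := Hu (\sum_j a 0 j *: e' j, D); first by [].
    have toE (d : 'rV[K]_m) : in_loc p x (\sum_j a 0 j *: e' j - \sum_j d 0 j *: e' j) ->
        c = [ffun j => d 0 j].
      move=> Hd; apply: Hc; apply/(local_eq_sum _ _ He D0 DE) => /=.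
      under [X in _ - _ * X]eq_bigr do rewrite ffunE.
      by rewrite mulrC -mulrBr; apply: in_locM.
    have ca := toE a; have cb := toE b H; rewrite ca in cb; last first.
      by rewrite subrr; apply: in_loc0.
    by apply/rowP => j; have := congr1 (fun f : {ffun _ -> _} => f j) cb; rewrite !ffunE.
  (* The coordinates of [f] in the basis [e]; by [Hun] they are unique, hence linear in [f]. *)
  pose phi f := proj1_sig (constructive_indefinite_description _ (Hex f)).
  have phiP f : in_loc p x (f * D - \sum_j phi f 0 j *: e' j).
    by rewrite /phi; case: (constructive_indefinite_description _ _).
  have phiE f (a : 'rV[K]_m) : in_loc p x (f * D - \sum_j a 0 j *: e' j) -> phi f = a.
    move=> H; apply: Hun; have := in_locB H (phiP f).
    by congr (in_loc _ _ _); ring.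
  have lin : linear phi.
    move=> c f g; apply: phiE.
    rewrite (_ : \sum_j _ = c *: (\sum_j phi f 0 j *: e' j) + \sum_j phi g 0 j *: e' j).
      have := in_locD (in_locZ c (phiP f)) (phiP g).
      by congr (in_loc _ _ _); rewrite -!mul_mpolyC; ring.
    rewrite scaler_sumr -big_split; apply: eq_bigr => j _ /=.
    by rewrite !mxE scalerDl scalerA.
  have ker f : phi f = 0 <-> in_loc p x f.
    have E0 : \sum_j (0 : 'rV[K]_m) 0 j *: e' j = 0.
      by rewrite big1 // => j _; rewrite mxE scale0r.
    split=> [f0|Hf]; last by apply: phiE; rewrite E0 subr0 mulrC; apply: in_locM.
    by have := phiP f; rewrite f0 E0 subr0 mulrC; apply: in_loc_cancel.
  exists phi; split=> // v.
  have [f' Hf'] := loc_unit_surjective lin ker (\sum_j v 0 j *: e' j) D0.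
  exists f'; apply: phiE; rewrite mulrC.
  exact/(linear_kereq lin _ _ ker).
have /fin_all_exists[e He] : forall j : 'I_m, exists f, phi f = delta_mx 0 j.
  by move=> j; apply: surj.
have phiS (a : 'I_m -> K) : phi (\sum_j a j *: e j) = \row_j a j.
  rewrite linear_sumE // [RHS]row_sum_delta.
  by apply: eq_bigr => j _; rewrite He mxE.
exists (fun j => (e j, 1)); split=> [j|u u0].
  by rewrite /frac_at meval1 oner_eq0.
have at1 j : frac_at x (e j, 1) by rewrite /frac_at meval1 oner_eq0.
have D1 : (1 : {mpoly K[n]}).@[x] != 0 by rewrite meval1 oner_eq0.
have DE (j : 'I_m) : 1 = (e j, 1).2 * 1 :> {mpoly K[n]} by rewrite mulr1.
have [f' Hf'] := loc_unit_surjective lin ker u.1 u0.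
exists [ffun j => phi f' 0 j]; split=> [|a].
  apply/(local_eq_sum _ _ at1 D1 DE); rewrite mulr1.
  apply/(linear_kereq lin _ _ ker); rewrite -Hf'; apply/(linear_kereq lin _ _ ker).
  rewrite -mulrBr; apply: in_locM; apply/(linear_kereq lin _ _ ker).
  under eq_bigr => j _ do rewrite ffunE mulr1.
  by rewrite phiS; apply/rowP => j; rewrite mxE.
move/(local_eq_sum _ _ at1 D1 DE); rewrite mulr1 => /(linear_kereq lin _ _ ker).
rewrite -Hf' => /(linear_kereq lin _ _ ker); rewrite -mulrBr => /(in_loc_cancel u0).
move=> /(linear_kereq lin _ _ ker) ->.
under eq_bigr => j _ do rewrite mulr1.
by rewrite phiS; apply/ffunP => j; rewrite !ffunE mxE.
Qed.

End Ideals.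

(** * Weight filtrations and truncation *)

Section Weights.
Variables (K : fieldType) (n : nat) (w : 'I_n -> nat).
Implicit Types (p q : 'I_n -> {mpoly K[n]}) (f g h : {mpoly K[n]}).

Definition wt (m : 'X_{1..n}) : nat := (\sum_i w i * m i)%N.

Lemma wtD m1 m2 : wt (m1 + m2) = (wt m1 + wt m2)%N.
Proof. by rewrite -big_split; apply: eq_bigr => i _; rewrite mnmDE mulnDr. Qed.

Definition wt_ge (W : nat) (f : {mpoly K[n]}) : Prop :=
  forall m, (wt m < W)%N -> f@_m = 0.

Lemma wt_ge0 W : wt_ge W 0. Proof. by move=> m _; rewrite mcoeff0. Qed.

Lemma wt_geD W f g : wt_ge W f -> wt_ge W g -> wt_ge W (f + g).
Proof. by move=> hf hg m lt_m; rewrite mcoeffD hf // hg // addr0. Qed.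

Lemma wt_geN W f : wt_ge W f -> wt_ge W (- f).
Proof. by move=> hf m lt_m; rewrite mcoeffN hf // oppr0. Qed.

Lemma wt_geB W f g : wt_ge W f -> wt_ge W g -> wt_ge W (f - g).
Proof. by move=> hf /wt_geN; apply: wt_geD. Qed.

Lemma wt_geZ W c f : wt_ge W f -> wt_ge W (c *: f).
Proof. by move=> hf m lt_m; rewrite mcoeffZ hf // mulr0. Qed.

Lemma wt_ge_sum W (I : Type) (s : seq I) (P : pred I) (F : I -> {mpoly K[n]}) :
  (forall i, P i -> wt_ge W (F i)) -> wt_ge W (\sum_(i <- s | P i) F i).
Proof.
by move=> H; elim/big_ind: _ => //; [exact: wt_ge0 | move=> *; exact: wt_geD].
Qed.

Lemma wt_ge_mono W1 W2 f : (W2 <= W1)%N -> wt_ge W1 f -> wt_ge W2 f.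
Proof. by move=> le_W hf m lt_m; apply: hf; apply: leq_trans le_W. Qed.

Lemma wt_geX W m : (W <= wt m)%N -> wt_ge W 'X_[m].
Proof.
move=> le_W m' lt_m'; rewrite mcoeffX; case: eqVneq => // E.
by move: lt_m'; rewrite -E ltnNge le_W.
Qed.

Lemma wt_geM W1 W2 f g : wt_ge W1 f -> wt_ge W2 g -> wt_ge (W1 + W2) (f * g).
Proof.
move=> hf hg m lt_m; rewrite mcoeffM big1 // => -[/= k1 k2] /eqP Em.
have [lt1|le1] := ltnP (wt k1) W1; first by rewrite hf // mul0r.
have Ew : wt m = (wt k1 + wt k2)%N by rewrite -wtD -Em.
rewrite [g@__]hg ?mulr0 //; move: lt_m; rewrite Ew => lt_m.
by rewrite -(ltn_add2l (wt k1)) (leq_trans lt_m) // leq_add2r.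
Qed.

Lemma wt_geMl W f g : wt_ge W g -> wt_ge W (f * g).
Proof. by move=> hg; rewrite -[W]add0n; apply: wt_geM. Qed.

Lemma wt_ge_ind W (P : {mpoly K[n]} -> Prop) :
  P 0 -> (forall f g, P f -> P g -> P (f + g)) -> (forall c f, P f -> P (c *: f)) ->
  (forall m, (W <= wt m)%N -> P 'X_[m]) -> forall f, wt_ge W f -> P f.
Proof.
move=> P0 PD PZ PX f hf; rewrite [f]mpolyE big_seq; elim/big_ind: _ => // m.
rewrite mcoeff_msupp => fm; apply: PZ; apply: PX.
by rewrite leqNgt; apply: contra fm => /hf ->.
Qed.

Hypothesis w_gt0 : forall i, (0 < w i)%N.

Lemma mdeg_le_wt m : (mdeg m <= wt m)%N.
Proof. by rewrite mdegE; apply: leq_sum => i _; rewrite leq_pmull. Qed.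

Lemma wt_eq0 m : wt m = 0%N -> m = 0%MM.
Proof. by move=> E; apply/eqP; rewrite -mdeg_eq0 -leqn0 -E mdeg_le_wt. Qed.

(** Newton iteration, started at the inverse of the constant term. Each step doubles the order of
    the error; the induction uses only that it grows by one. *)
Lemma wt_ge_inv h : h@_0%MM != 0 -> forall W, exists h', wt_ge W (h * h' - 1).
Proof.
move=> h0; elim=> [|[|W] [h' Hh']]; first by exists 0.
  exists ((h@_0%MM)^-1)%:MP => m; rewrite ltnS leqn0 => /eqP/wt_eq0 ->.
  by rewrite mulrC mcoeffB mcoeffCM mcoeff1 eqxx mulVf // subrr.
exists (h' * (2%:R - h * h')).
have -> : h * (h' * (2%:R - h * h')) - 1 = - ((h * h' - 1) * (h * h' - 1)) by ring.
by apply: wt_geN; apply: wt_ge_mono (wt_geM Hh' Hh'); rewrite addSn ltnS addnS ltnS leq_addr.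
Qed.

Definition in_trunc p W f : Prop := exists2 g, in_ideal p g & wt_ge W (f - g).

Lemma in_trunc_wt_ge p W f : wt_ge W f -> in_trunc p W f.
Proof. by exists 0; rewrite ?subr0 //; apply: in_ideal0. Qed.

Lemma in_trunc_ideal p W f : in_ideal p f -> in_trunc p W f.
Proof. by exists f => //; rewrite subrr; apply: wt_ge0. Qed.

Lemma in_truncD p W f g : in_trunc p W f -> in_trunc p W g -> in_trunc p W (f + g).
Proof.
case=> a Ha fa [b Hb gb]; exists (a + b); first exact: in_idealD.
by rewrite opprD addrACA; apply: wt_geD.
Qed.

Lemma in_truncM p W f g : in_trunc p W f -> in_trunc p W (g * f).
Proof.
case=> a Ha fa; exists (g * a); first exact: in_idealM.
by rewrite -mulrBr; apply: wt_geMl.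
Qed.

Lemma in_trunc_cancel p W h f : h@_0%MM != 0 ->
  in_trunc p W (h * f) -> in_trunc p W f.
Proof.
move=> h0 H; have [h' Hh'] := wt_ge_inv h0 W.
have -> : f = h' * (h * f) - f * (h * h' - 1) by ring.
apply: in_truncD; first exact: in_truncM.
by apply: in_trunc_wt_ge; apply: wt_geN; apply: wt_geMl.
Qed.

Lemma meval0E f : f.@[[ffun=> 0]] = f@_0%MM.
Proof.
rewrite [f in LHS]mpolyE [f in RHS]mpolyE !raddf_sum /=; apply: eq_bigr => m _.
rewrite mevalZ mcoeffZ mevalX mcoeffX; congr (_ * _).
case: eqVneq => [->|/eqP m0].
  by rewrite big1 // => i _; rewrite mnm0E expr0.
have [i mi] : exists i, m i != 0%N.
  apply/existsP; apply: contra_notT m0; rewrite negb_exists => /forallP H.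
  by apply/mnmP => i; rewrite mnm0E; apply/eqP; move: (H i); rewrite negbK.
by rewrite (bigD1 i) //= ffunE expr0n (negbTE mi) mul0r.
Qed.

(** A polynomial that is nonzero at the origin is invertible modulo weight [W], so localization is
    invisible after truncation. *)
Lemma in_loc_trunc p W f : in_loc p [ffun=> 0] f -> in_trunc p W f.
Proof.
case=> h; rewrite meval0E => h0 Hh; apply: (in_trunc_cancel h0).
exact: in_trunc_ideal.
Qed.

Lemma in_trunc_loc p W f :
  (forall m, (W <= wt m)%N -> in_loc p [ffun=> 0] 'X_[m]) ->
  in_trunc p W f -> in_loc p [ffun=> 0] f.
Proof.
move=> H [g Hg]; rewrite -{2}(subrK g f); set u := f - g => Hu.
apply: in_locD; last exact: in_ideal_loc.
elim/wt_ge_ind: Hu; [exact: in_loc0|exact: in_locD|by move=> *; apply: in_locZ|exact: H].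
Qed.

Lemma wt_large a m : (a * (\sum_i w i) < wt m)%N -> exists i, (a <= m i)%N.
Proof.
move=> lt_m; apply/existsP; apply: contraTT lt_m; rewrite negb_exists => /forallP H.
rewrite -leqNgt mulnC big_distrl; apply: leq_sum => i _ /=.
by rewrite leq_mul2l ltnW ?orbT // ltnNge H.
Qed.

Lemma nilp_wt_ge p x a W : (forall i, in_loc p x ('X_i ^+ a)) ->
  (a * (\sum_i w i) < W)%N ->
  forall m, (W <= wt m)%N -> in_loc p x 'X_[m].
Proof.
move=> Ha lt_W m le_m; have [i le_i] := wt_large (leq_trans lt_W le_m).
have -> : m = (m - U_(i) *+ a + U_(i) *+ a)%MM.
  rewrite submK //; apply/mnm_lepP => j; rewrite mulmnE mnm1E.
  by case: eqVneq => [<-|_]; rewrite ?mul1n ?mul0n.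
by rewrite mpolyXD -mpolyXn; apply: in_locM.
Qed.

End Weights.

Local Notation w1 := (fun=> 1%N).

(** * Codimension and truncated ideals as linear algebra *)

Section Codim.
Variables (K : fieldType) (n : nat).
Implicit Types (p q : 'I_n -> {mpoly K[n]}) (f g h : {mpoly K[n]}).

Lemma has_codim_ext (I J : {mpoly K[n]} -> Prop) m :
  (forall f, I f <-> J f) -> has_codim I m -> has_codim J m.
Proof.
by move=> IJ [phi [lin surj ker]]; exists phi; split=> // f; rewrite -IJ.
Qed.

(** Representatives of a basis of the quotient by [I] remain independent modulo the smaller [J],
    since a relation modulo [J] is also one modulo [I]. *)
Lemma has_codim_le (I J : {mpoly K[n]} -> Prop) a b :
  (forall f, J f -> I f) -> has_codim I a -> has_codim J b -> (a <= b)%N.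
Proof.
move=> JI [phi [lin surj ker]] [psi [lin' _ ker']].
have /fin_all_exists[e He] : forall j : 'I_a, exists f, phi f = delta_mx 0 j.
  by move=> j; apply: surj.
pose A := \matrix_j psi (e j).
suff /eqP <- : row_free A by apply: rank_leq_col.
rewrite -kermx_eq0; apply: contraT => /rowV0Pn[v /sub_kermxP vA /eqP[]].
have : psi (\sum_j v 0 j *: e j) = 0.
  rewrite linear_sumE // -[RHS]vA; apply/rowP => j; rewrite [RHS]mxE summxE.
  by apply: eq_bigr => i _; rewrite !mxE.
move/ker'/JI/ker; rewrite linear_sumE // => <-; rewrite [LHS]row_sum_delta.
by apply: eq_bigr => j _; rewrite He.
Qed.

Lemma has_codim_uniq (I : {mpoly K[n]} -> Prop) a b :
  has_codim I a -> has_codim I b -> a = b.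
Proof.
by move=> Ha Hb; apply/eqP; rewrite eqn_leq !(has_codim_le _ Ha Hb, has_codim_le _ Hb Ha).
Qed.

(** Multiplying by the adjugate puts [\det J * v j] into the kernel, and [\det J] is a unit at
    [x]. *)
Lemma in_loc_nakayama p x (J : 'M[{mpoly K[n]}]_n) (v : 'I_n -> {mpoly K[n]}) :
  (forall i, in_loc p x (\sum_j J i j * v j)) -> (\det J).@[x] != 0 ->
  forall j, in_loc p x (v j).
Proof.
move=> H J0 j; apply: (in_loc_cancel J0).
suff -> : \det J * v j = \sum_i (\adj J) j i * (\sum_k J i k * v k).
  by apply: in_loc_sum => i _; apply: in_locM.
have /(congr1 (fun A : 'M_n => (A *m \col_k v k) j 0)) := mul_adj_mx J.
rewrite -mulmxA mul_scalar_mx !mxE => <-.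
apply: eq_bigr => i _; congr (_ * _); rewrite mxE.
by apply: eq_bigr => k _; rewrite mxE.
Qed.

Variable L : nat.
Let B : finType := 'X_{1..n < L}.

Lemma wt1E (m : 'X_{1..n}) : wt w1 m = mdeg m.
Proof. by rewrite mdegE; apply: eq_bigr => i _; rewrite mul1n. Qed.

Definition trunc_vec f : 'rV[K]_#|B| := \row_j f@_(bmnm (enum_val j)).

(** A Macaulay matrix: its rows are the monomial multiples of the [p i], cut off at degree [L]. *)
Definition trunc_mx p : 'M[K]_(#|{: B * 'I_n}|, #|B|) :=
  \matrix_(a, j) ('X_[bmnm (enum_val a).1] * p (enum_val a).2)@_(bmnm (enum_val j)).

Lemma trunc_vec_linear : linear trunc_vec.
Proof. by move=> c f g; apply/rowP => j; rewrite !mxE mcoeffD mcoeffZ. Qed.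

Lemma trunc_vec0P f : trunc_vec f = 0 <-> wt_ge w1 L f.
Proof.
split=> [H m|H]; last by apply/rowP => j; rewrite !mxE H // wt1E bmdeg.
rewrite wt1E => lt_m; have /rowP/(_ (enum_rank (BMultinom lt_m : B))) := H.
by rewrite !mxE enum_rankK.
Qed.

Lemma trunc_vec_surj v : exists f, trunc_vec f = v.
Proof.
exists (\sum_j v 0 j *: 'X_[bmnm (enum_val j)]).
apply/rowP => j; rewrite mxE raddf_sum (bigD1 j) //= mcoeffZ mcoeffX eqxx mulr1.
rewrite big1 ?addr0 // => i ij; rewrite mcoeffZ mcoeffX.
case: eqP => [/val_inj/enum_val_inj E|]; last by rewrite mulr0.
by rewrite E eqxx in ij.
Qed.

(** Multiples by monomials of degree at least [L] are cut off to zero, so these finitely many rows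
    span the truncated ideal. *)
Lemma trunc_vecP p f : in_trunc w1 p L f <-> (trunc_vec f <= trunc_mx p)%MS.
Proof.
split=> [[g [a ->] hf]|/submxP[D E]].
  rewrite (_ : trunc_vec f = trunc_vec (\sum_i a i * p i)); last first.
    apply/eqP; rewrite -subr_eq0 -linearBE; last exact: trunc_vec_linear.
    exact/eqP/trunc_vec0P.
  pose P f := (trunc_vec f <= trunc_mx p)%MS.
  have PD f1 f2 : P f1 -> P f2 -> P (f1 + f2).
    by rewrite /P -[f1 in trunc_vec (f1 + _)]scale1r trunc_vec_linear scale1r; apply: addmx_sub.
  have PZ c f1 : P f1 -> P (c *: f1).
    rewrite /P -[c *: f1]addr0 trunc_vec_linear (linear0E trunc_vec_linear) addr0.
    exact: scalemx_sub.
  have P0 : P 0 by rewrite /P (linear0E trunc_vec_linear) sub0mx.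
  rewrite -/(P _); elim/big_ind: _ => // i _; rewrite [a i]mpolyE mulr_suml.
  elim/big_ind: _ => // m _; rewrite -scalerAl; apply: PZ.
  have [lt_m|le_m] := ltnP (mdeg m) L; last first.
    rewrite /P; have/trunc_vec0P -> : wt_ge w1 L ('X_[m] * p i); last exact: sub0mx.
    by rewrite mulrC; apply: wt_geMl; apply: wt_geX; rewrite wt1E.
  rewrite /P; pose a0 := enum_rank ((BMultinom lt_m, i) : B * 'I_n).
  have -> : trunc_vec ('X_[m] * p i) = row a0 (trunc_mx p).
    by apply/rowP => j; rewrite !mxE enum_rankK.
  exact: row_sub.
exists (\sum_i (\sum_(a | (enum_val a).2 == i) D 0 a *: 'X_[bmnm (enum_val a).1]) * p i).
  by eexists; reflexivity.
apply/trunc_vec0P; rewrite linearBE; last exact: trunc_vec_linear.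
rewrite E; apply/eqP; rewrite subr_eq0; apply/eqP.
rewrite (_ : \sum_i _ = \sum_a D 0 a *: ('X_[bmnm (enum_val a).1] * p (enum_val a).2)).
  rewrite (linear_sumE trunc_vec_linear); apply/rowP => j; rewrite mxE summxE.
  by apply: eq_bigr => a _; rewrite !mxE.
rewrite [RHS](partition_big (fun a => (enum_val a).2) xpredT) //=.
apply: eq_bigr => i _; rewrite mulr_suml; apply: eq_bigr => a /eqP ->.
by rewrite scalerAl.
Qed.

Lemma has_codim_trunc p : has_codim (in_trunc w1 p L) (#|B| - \rank (trunc_mx p)).
Proof.
pose C := cokermx (trunc_mx p); rewrite -mxrank_coker -/C.
(* [col_base] keeps as many columns of the cokernel matrix as its rank, which makes the map onto. *)
exists (fun f => trunc_vec f *m col_base C); split=> [c f g|v|f].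
- by rewrite trunc_vec_linear mulmxDl scalemxAl.
- have /row_fullP[Q QC] := col_base_full C.
  have [f Hf] := trunc_vec_surj (v *m Q); exists f.
  by rewrite Hf -mulmxA QC mulmx1.
rewrite trunc_vecP submxE -/C; split=> [H|/eqP H].
  by rewrite -(mulmx_base C) mulmxA H mul0mx.
apply: (row_free_inj (row_base_free C)).
by rewrite mul0mx -mulmxA mulmx_base.
Qed.

End Codim.

(** * Generic points *)

Lemma digits_inj N n (a b : nat -> nat) :
  (forall i, i < n -> a i < N)%N -> (forall i, i < n -> b i < N)%N ->
  (\sum_(i < n) a i * N ^ i = \sum_(i < n) b i * N ^ i)%N ->
  forall i, (i < n)%N -> a i = b i.
Proof.
have bound m (c : nat -> nat) : (forall i, i < m -> c i < N)%N ->
    (\sum_(i < m) c i * N ^ i < N ^ m)%N.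
  elim: m => [|m IH] Hc; first by rewrite big_ord0.
  rewrite big_ord_recr /=.
  apply: (@leq_trans (N ^ m + c m * N ^ m)).
    by rewrite ltn_add2r IH // => i lt_i; rewrite Hc // ltnW.
  by rewrite -mulSn expnS leq_mul2r Hc ?orbT.
elim: n => // n IH Ha Hb; rewrite !big_ord_recr /= => E.
have la : (\sum_(i < n) a i * N ^ i < N ^ n)%N by apply: bound => i lt_i; rewrite Ha // ltnW.
have lb : (\sum_(i < n) b i * N ^ i < N ^ n)%N by apply: bound => i lt_i; rewrite Hb // ltnW.
have Nn_gt0 : (0 < N ^ n)%N by apply: leq_ltn_trans la.
have Eab : a n = b n.
  move/(congr1 (fun m => m %/ N ^ n)%N): E.
  by rewrite !(addnC _ (_ * N ^ n)%N) !divnMDl // !divn_small // !addn0.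
move=> i; rewrite ltnS leq_eqVlt => /orP[/eqP -> //|].
by apply: IH => [j lt_j|j lt_j|];
  [rewrite Ha // ltnW|rewrite Hb // ltnW|move: E; rewrite Eab => /addIn].
Qed.

(* Kronecker substitution: 'X_i is specialized to t ^ (N ^ i). *)
Lemma mpoly_neq0_eval (F : fieldType) n (f : {mpoly F[n]}) :
  [pchar F] =i pred0 -> f != 0 -> exists c : {ffun 'I_n -> F}, f.@[c] != 0.
Proof.
move=> char0 f0; pose N := msize f.
pose e (m : 'X_{1..n}) := (\sum_(i < n) m i * N ^ i)%N.
pose g : {poly F} := \sum_(m <- msupp f) f@_m *: 'X^(e m).
(* All exponents occurring in [f] are below [N], so they are the base [N] digits of [e m]. *)
have einj m m' : m \in msupp f -> m' \in msupp f -> e m = e m' -> m = m'.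
  move=> /msize_mdeg_lt lt_m /msize_mdeg_lt lt_m' E; apply/mnmP => i.
  have lt_i (m1 : 'X_{1..n}) : (mdeg m1 < N)%N -> forall j, (m1 j < N)%N.
    by move=> lt1 j; apply: leq_ltn_trans lt1; rewrite mdegE (bigD1 j) //= leq_addr.
  pose x (m1 : 'X_{1..n}) j := if insub j is Some j' then m1 (j' : 'I_n) else 0%N.
  have xE (m1 : 'X_{1..n}) (j : 'I_n) : x m1 j = m1 j by rewrite /x valK.
  rewrite -!xE; apply: (@digits_inj N n) => // [j lt_j|j lt_j|].
  - by rewrite (xE m (Ordinal lt_j)) lt_i.
  - by rewrite (xE m' (Ordinal lt_j)) lt_i.
  by under eq_bigr do rewrite xE; under [RHS]eq_bigr do rewrite xE.
have g0 : g != 0.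
  have [m fm] : exists m, m \in msupp f.
    case E : (msupp f) => [|m s]; first by move: f0; rewrite -msupp_eq0 E.
    by exists m; rewrite inE eqxx.
  apply/eqP => /(congr1 (fun h : {poly F} => h`_(e m))).
  rewrite coef0 coef_sum (bigD1_seq m) ?msupp_uniq //=.
  rewrite coefZ coefXn eqxx mulr1 big_seq_cond big1 ?addr0; last first.
    move=> m' /andP[fm' ne_m']; rewrite coefZ coefXn; case: eqP; last by rewrite mulr0.
    by move/(einj _ _ fm fm') => E; rewrite E eqxx in ne_m'.
  by apply/eqP; rewrite -mcoeff_msupp.
have [t gt] : exists t, ~~ root g t.
  (* More points than [g] can have roots; they are distinct in characteristic zero. *)
  pose s := [seq (i%:R : F) | i <- iota 0 (size g)].
  have s_uniq : uniq s.
    rewrite map_inj_in_uniq ?iota_uniq // => i j _ _ /eqP E.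
    have nat0 m : (m%:R == 0 :> F) = (m == 0%N) by have/pcharf0P := char0.
    wlog le_ij : i j E / (i <= j)%N.
      by move=> H; case: (leqP i j) => [|/ltnW] /H; [|rewrite eq_sym => /(_ E) ->]; auto.
    move: E; rewrite eq_sym -subr_eq0 -natrB // nat0 subn_eq0 => le_ji.
    by apply/eqP; rewrite eqn_leq le_ij.
  case: (boolP (all (root g) s)) => [H|/allPn[t _ Ht]]; last by exists t.
  by have := max_poly_roots g0 H s_uniq; rewrite size_map size_iota ltnn.
exists [ffun i : 'I_n => t ^+ (N ^ i)].
suff -> : f.@[[ffun i : 'I_n => t ^+ (N ^ i)]] = g.[t] by [].
rewrite mevalE horner_sum; apply: eq_bigr => m _; rewrite hornerZ hornerXn.
congr (_ * _); rewrite /e expr_sum; apply: eq_bigr => i _.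
by rewrite ffunE -exprM mulnC.
Qed.

Lemma mpoly_prodX_neq0 (F : fieldType) n : \prod_(i < n) 'X_i != 0 :> {mpoly F[n]}.
Proof.
by apply/prodf_neq0 => i _; rewrite -msupp_eq0 msuppX.
Qed.

Section Descent.
Variables (k : fieldType) (K : fieldType) (iota : {rmorphism k -> K}) (n : nat).

Lemma meval_map_mpoly (f : {mpoly k[n]}) (c : 'I_n -> K) :
  (map_mpoly iota f).@[c] = mmap iota c f.
Proof.
rewrite [f]mpolyE [map_mpoly _ _]raddf_sum ![in LHS]raddf_sum [in RHS]raddf_sum /=.
apply: eq_bigr => m _.
by rewrite map_mpolyZ map_mpolyX mevalZ mmapZ mevalX mmapX.
Qed.

Lemma mmap_point (f : {mpoly k[n]}) (c : 'I_n -> k) :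
  mmap iota (fun i => iota (c i)) f = iota f.@[c].
Proof.
rewrite [f]mpolyE [in LHS]raddf_sum [(\sum_(_ <- _) _).@[_]]raddf_sum [in RHS]raddf_sum /=.
apply: eq_bigr => m _.
rewrite mmapZ mmapX mevalZ mevalX rmorphM rmorph_prod /=; congr (_ * _).
by apply: eq_bigr => i _; rewrite rmorphXn.
Qed.

(* Either F_0 vanishes wherever F does, or a zero c of F with F_0(c) != 0      *)
(* expresses b_0 through the other b_j, which makes the sum shorter.          *)
Lemma descend (F : {mpoly K[n]}) : F != 0 ->
  exists2 G : {mpoly k[n]}, G != 0 &
    forall c : {ffun 'I_n -> k}, G.@[c] != 0 -> F.@[fun i => iota (c i)] != 0.
Proof.
have main (s : seq (K * {mpoly k[n]})) :
  \sum_(b <- s) b.1 *: map_mpoly iota b.2 != 0 ->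
  exists2 G : {mpoly k[n]}, G != 0 & forall c : {ffun 'I_n -> k}, G.@[c] != 0 ->
    (\sum_(b <- s) b.1 *: map_mpoly iota b.2).@[fun i => iota (c i)] != 0.
  move: {2}(size s) (leqnn (size s)) => q; elim: q s => [|q IH] [|[b F0] s] //=;
    rewrite ?big_nil ?eqxx // ltnS => le_s; rewrite big_cons /=.
  set S := \sum_(_ <- s) _ => nz.
  have [F00|F0_neq0] := eqVneq F0 0.
    rewrite F00 rmorph0 scaler0 add0r; apply: IH le_s _.
    by move: nz; rewrite F00 rmorph0 scaler0 add0r.
  case: (classic (exists2 c : {ffun 'I_n -> k}, F0.@[c] != 0 &
      (b *: map_mpoly iota F0 + S).@[fun i => iota (c i)] = 0)) => [|H]; last first.
    by exists F0 => // c Fc; apply/eqP => E; apply: H; exists c.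
  case=> c Fc E0.
  pose s' := [seq (a.1, a.2 - (a.2.@[c] / F0.@[c]) *: F0) | a <- s].
  have E : b *: map_mpoly iota F0 + S = \sum_(a <- s') a.1 *: map_mpoly iota a.2.
    have Fc' : iota F0.@[c] != 0 by rewrite fmorph_eq0.
    have bE : b = - (\sum_(a <- s) a.1 * iota a.2.@[c]) / iota F0.@[c].
      move: E0; rewrite mevalD mevalZ meval_map_mpoly mmap_point /S.
      rewrite [(\sum_(_ <- _) _).@[_]]raddf_sum /=.
      under eq_bigr do rewrite mevalZ meval_map_mpoly mmap_point.
      by move/eqP; rewrite addr_eq0 => /eqP <-; rewrite mulfK.
    rewrite big_map /= bE mulNr scaleNr mulr_suml scaler_suml -sumrN /S -big_split /=.
    apply: eq_bigr => a _.
    rewrite rmorphB /= map_mpolyZ rmorphM fmorphV scalerBr scalerA addrC mulrA.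
    by [].
  by rewrite E; apply: IH; [rewrite size_map|rewrite -E].
move=> F0; pose s := [seq (F@_m, 'X_[m] : {mpoly k[n]}) | m <- msupp F].
have E : F = \sum_(b <- s) b.1 *: map_mpoly iota b.2.
  by rewrite big_map {1}[F]mpolyE; apply: eq_bigr => m _; rewrite /= map_mpolyX.
by rewrite {1}E; apply: main; rewrite -E.
Qed.

(** The conditions to be avoided arise with coefficients in [K]; they are combined in this form, and
    only [genericK_generic] passes to [k], by [descend]. *)
Definition genericK (P : {ffun 'I_n -> k} -> Prop) : Prop :=
  exists2 F : {mpoly K[n]}, F != 0 &
    forall c : {ffun 'I_n -> k}, (forall i, c i != 0) ->
      F.@[fun i => iota (c i)] != 0 -> P c.

Lemma genericK_generic P : [pchar k] =i pred0 -> genericK P -> generic P.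
Proof.
move=> char0 [F F0 HF]; have [G G0 HG] := descend F0.
exists (fun c => (forall i, c i != 0) /\ G.@[c] != 0); split.
- exists (eq G) => c; split=> [[c0 Gc]|[c0 [f <- fc]]]; last by [].
  by split=> //; exists G.
(* The product of the variables keeps the point in the torus, which shows that the open set is not
   empty. *)
- have [|c] := @mpoly_neq0_eval k n (G * \prod_i 'X_i) char0.
    by rewrite mulf_neq0 // mpoly_prodX_neq0.
  rewrite mevalM mulf_eq0 negb_or => /andP[Gc]; rewrite rmorph_prod /= => /prodf_neq0 H.
  by exists c; split=> // i; have := H i isT; rewrite mevalXU.
by move=> c [c0 Gc]; apply: HF => //; apply: HG.
Qed.

Lemma genericK_sub (P Q : {ffun 'I_n -> k} -> Prop) :
  (forall c : {ffun _ -> _}, (forall i, c i != 0) -> P c -> Q c) -> genericK P -> genericK Q.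
Proof. by move=> PQ [F F0 HF]; exists F => // c c0 Fc; apply: PQ => //; apply: HF. Qed.

Lemma genericK_and (P Q : {ffun 'I_n -> k} -> Prop) :
  genericK P -> genericK Q -> genericK (fun c => P c /\ Q c).
Proof.
case=> F F0 HF [F' F'0 HF']; exists (F * F'); first by rewrite mulf_neq0.
by move=> c c0; rewrite mevalM mulf_eq0 negb_or => /andP[/(HF _ c0) ? /(HF' _ c0)].
Qed.

Lemma genericK_true (P : {ffun 'I_n -> k} -> Prop) :
  (forall c, P c) -> genericK P.
Proof. by move=> H; exists 1; rewrite ?oner_neq0. Qed.

Lemma genericK_all (I : finType) (P : I -> {ffun 'I_n -> k} -> Prop) :
  (forall i, genericK (P i)) -> genericK (fun c => forall i, P i c).
Proof.
move=> H; have /fin_all_exists2[F F0 HF] := H.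
exists (\prod_i F i); first by apply/prodf_neq0 => i _; apply: F0.
move=> c c0; rewrite rmorph_prod /= => /prodf_neq0 Fc i.
by apply: HF => //; apply: Fc.
Qed.

End Descent.

(** Together with [minor_rank], this makes a lower bound on the rank the nonvanishing of a minor, an
    open condition on the entries. *)
Lemma max_minor (F : fieldType) m n (A : 'M[F]_(m, n)) :
  exists f : 'I_(\rank A) -> 'I_m, exists g : 'I_(\rank A) -> 'I_n,
    \det (mxsub f g A) != 0.
Proof.
pose A1 := rowsub (maxrankfun A) A.
have A1full : row_full A1^T.
  by rewrite /row_full mxrank_tr; rewrite (eq_maxrowsub A).
pose g := fullrankfun A1full; exists (maxrankfun A), g.
have : row_full (rowsub g A1^T) := fullrowsub_full A1full.
rewrite row_full_unit unitmxE unitfE -det_tr.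
suff -> : (rowsub g A1^T)^T = mxsub (maxrankfun A) g A by [].
by apply/matrixP => i j; rewrite !mxE.
Qed.

Lemma minor_rank (F : fieldType) m n q (A : 'M[F]_(m, n)) f g :
  \det (mxsub f g A : 'M_q) != 0 -> (q <= \rank A)%N.
Proof.
rewrite -unitfE -unitmxE => /mxrank_unit <-.
have -> : mxsub f g A = rowsub f 1%:M *m A *m colsub g 1%:M.
  apply/matrixP => i j; rewrite -mulmxA mul_rowsub_mx mul1mx !mxE (bigD1 (g j)) //=.
  rewrite !mxE eqxx mulr1 big1 ?addr0 // => l /negbTE ne_l.
  by rewrite !mxE ne_l mulr0.
by apply: leq_trans (mxrankM_maxl _ _) _; apply: mxrankM_maxr.
Qed.

(** * Generic multiplicity of the origin *)

Section TruncMult.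
Variables (K : fieldType) (n : nat).
Implicit Types (p q : 'I_n -> {mpoly K[n]}) (f g h : {mpoly K[n]}).

(** [power_dependence] gives a relation [X_i^t (1 + X_i s) = 0] with [t <= mu], whose second factor
    is a unit at the origin. *)
Lemma codim_nilpotent p mu : has_codim (in_loc p [ffun=> 0]) mu ->
  forall i, in_loc p [ffun=> 0] ('X_i ^+ mu).
Proof.
case=> phi [lin _ ker] i.
have [t [s [le_t /ker]]] := power_dependence lin 'X_i 1.
rewrite mulr1 mulrC => /in_loc_cancel; rewrite -(subnK le_t) exprD => H.
apply: in_locM; apply: H.
by rewrite meval0E // mcoeffD mcoeff1 eqxx -meval0E mevalM mevalXU ffunE mul0r addr0 oner_eq0.
Qed.

Lemma sum_w1 : (\sum_(i < n) 1 = n)%N.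
Proof. by rewrite sum1_card card_ord. Qed.

Lemma in_loc_truncE p mu L : (forall i, in_loc p [ffun=> 0] ('X_i ^+ mu)) ->
  (mu * n < L)%N ->
  forall f, in_loc p [ffun=> 0] f <-> in_trunc w1 p L f.
Proof.
move=> nilp lt_L f; split; first exact: in_loc_trunc.
by apply: in_trunc_loc; apply: (nilp_wt_ge nilp); rewrite sum_w1.
Qed.

(** Every [X_i ^ mu] is zero in the local ring, so all monomials of degree above [mu * n] are, and
    truncation at that degree loses nothing. *)
Lemma mult_trunc p mu : has_codim (in_loc p [ffun=> 0]) mu ->
  (#|{: 'X_{1..n < (mu * n).+1}}| - \rank (trunc_mx (mu * n).+1 p) = mu)%N.
Proof.
move=> H; apply: (has_codim_uniq (has_codim_trunc _ _)).
apply: has_codim_ext (H); apply: in_loc_truncE (codim_nilpotent H) _.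
exact: ltnSn.
Qed.

(** A monomial of degree above [mu * n] is divisible by some [X_j ^ mu], and as its degree also
    exceeds [mu], the cofactor vanishes at the origin. *)
Lemma wt_ge_decomp mu u : wt_ge w1 (mu * n).+1 u ->
  exists2 v : 'I_n -> {mpoly K[n]}, u = \sum_j v j * 'X_j ^+ mu & forall j, (v j)@_0%MM = 0.
Proof.
elim/wt_ge_ind=> [|f g [a -> Ha] [b -> Hb]|c f [a -> Ha]|m le_m].
- exists (fun=> 0); last by move=> j; rewrite mcoeff0.
  by rewrite big1 // => j _; rewrite mul0r.
- exists (fun j => a j + b j); last by move=> j; rewrite mcoeffD Ha Hb addr0.
  by rewrite -big_split; apply: eq_bigr => j _; rewrite mulrDl.
- exists (fun j => c *: a j); last by move=> j; rewrite mcoeffZ Ha mulr0.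
  by rewrite scaler_sumr; apply: eq_bigr => j _; rewrite scalerAl.
have [i le_i] : exists i, (mu <= m i)%N by apply: (@wt_large n w1); rewrite sum_w1.
have le_Um : (U_(i) *+ mu <= m)%MM.
  apply/mnm_lepP => j; rewrite mulmnE mnm1E.
  by case: eqVneq => [<-|_]; rewrite ?mul1n ?mul0n.
exists (fun j => if j == i then 'X_[m - U_(i) *+ mu] else 0) => [|j].
  rewrite (bigD1 i) //= eqxx big1 ?addr0 => [|j /negbTE ->]; last by rewrite mul0r.
  by rewrite mpolyXn -mpolyXD submK.
case: ifP => _; last by rewrite mcoeff0.
rewrite mcoeffX; case: eqP => // E.
have : mdeg m = mu by rewrite -(submK le_Um) E add0m mdegMn mdeg1 mul1n.
move: le_m; rewrite wt1E => lt_m Em; move: lt_m; rewrite Em.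
have n_gt0 : (0 < n)%N := leq_ltn_trans (leq0n _) (ltn_ord i).
by rewrite ltnNge leq_pmulr.
Qed.

(** The truncated ideal contains each [X_i ^ mu], so modulo the ideal itself [X_i ^ mu] is a
    combination of the [X_j ^ mu] with coefficients vanishing at the origin. By Nakayama's lemma all
    [X_i ^ mu] are zero in the local ring, and the truncation is exact. *)
Lemma trunc_mult p mu :
  (#|{: 'X_{1..n < (mu * n).+1}}| - \rank (trunc_mx (mu * n).+1 p) = mu)%N ->
  has_codim (in_loc p [ffun=> 0]) mu.
Proof.
set L := (mu * n).+1 => E; have := has_codim_trunc L p; rewrite E => H.
have [phi [lin _ ker]] := H.
have Xmu i : in_trunc w1 p L ('X_i ^+ mu).
  have [t [s [le_t /ker]]] := power_dependence lin 'X_i 1.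
  rewrite mulr1 mulrC => /(in_trunc_cancel _); rewrite -(subnK le_t) exprD => H1.
  apply: in_truncM; apply: H1 => //.
  rewrite mcoeffD mcoeff1 eqxx.
  by rewrite -meval0E mevalM mevalXU ffunE mul0r addr0 oner_eq0.
have /fin_all_exists[v Hv] : forall i, exists v : 'I_n -> {mpoly K[n]},
    in_ideal p ('X_i ^+ mu - \sum_j v j * 'X_j ^+ mu) /\ forall j, (v j)@_0%MM = 0.
  move=> i; have [g Hg /wt_ge_decomp[v Ev v0]] := Xmu i.
  by exists v; split=> //; rewrite -Ev opprB addrCA subrr addr0.
have nilp : forall i, in_loc p [ffun=> 0] ('X_i ^+ mu).
  pose J : 'M[{mpoly K[n]}]_n := 1%:M - \matrix_(i, j) v i j.
  apply: (@in_loc_nakayama _ _ _ _ J) => [i|].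
    have [H1 _] := Hv i; apply: in_ideal_loc.
    rewrite (_ : \sum_j _ = 'X_i ^+ mu - \sum_j v i j * 'X_j ^+ mu) //.
    rewrite (bigD1 i) //= [in RHS](bigD1 i) //= !mxE eqxx.
    rewrite mulrBl mul1r opprD addrA; congr (_ + _); rewrite -sumrN.
    apply: eq_bigr => j ne_ji; rewrite !mxE eq_sym (negbTE ne_ji).
    by rewrite sub0r mulNr.
  rewrite -det_map_mx (_ : map_mx _ J = 1%:M) ?det1 ?oner_eq0 //.
  apply/matrixP => i j; rewrite !mxE /= mevalB [(v i j).@[_]]meval0E //; have [_ ->] := Hv i.
  by rewrite subr0; case: eqP => _; rewrite ?meval1 ?meval0.
apply: has_codim_ext H => f; apply: iff_sym; exact: in_loc_truncE nilp _ f.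
Qed.

End TruncMult.

Section GenericMult.
Variables (k : fieldType) (K : fieldType) (iota : {rmorphism k -> K}).
Hypothesis k_char0 : [pchar k] =i pred0.
Variables (n : nat) (r : 'I_n -> nat) (beta : 'I_n -> 'X_{1..n}).

Lemma binomial_system_map (R S : comNzRingType) (phi : {rmorphism R -> S}) c i :
  map_mpoly phi (binomial_system r beta c i) = binomial_system r beta (fun i => phi (c i)) i.
Proof. by rewrite /binomial_system rmorphB /= map_mpolyZ !map_mpolyX. Qed.

Definition generic_trunc_mx L :
  'M[{mpoly k[n]}]_(#|{: 'X_{1..n < L} * 'I_n}|, #|{: 'X_{1..n < L}}|) :=
  \matrix_(a, j) ('X_[bmnm (enum_val a).1] *
    binomial_system r beta (fun i => 'X_i : {mpoly k[n]}) (enum_val a).2)@_(bmnm (enum_val j)).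

Lemma generic_trunc_mx_eval L (c : 'I_n -> K) :
  trunc_mx L (binomial_system r beta c) = map_mx (mmap iota c) (generic_trunc_mx L).
Proof.
apply/matrixP => a j; rewrite !mxE -mcoeff_map_mpoly rmorphM /= map_mpolyX.
congr ((_ * _)@__); rewrite binomial_system_map /binomial_system.
by rewrite /= mmapX mmap1U.
Qed.

Lemma generic_trunc_mx_minor L q f g (c : 'I_n -> K) :
  \det (mxsub f g (trunc_mx L (binomial_system r beta c)) : 'M_q) =
  mmap iota c (\det (mxsub f g (generic_trunc_mx L))).
Proof. by rewrite -det_map_mx generic_trunc_mx_eval map_mxsub. Qed.

(* The hypothesis concerns coefficients in k only, but is needed for           *)
(* coefficients in K: the multiplicity is mu as soon as the matrix of the      *)
(* truncated system has its maximal rank, which is a condition on minors that  *)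
(* are polynomials over the infinite field k in the coefficients.              *)
Lemma generic_multiplicity_extend mu :
  is_generic_origin_multiplicity iota r beta mu ->
  exists2 D : {mpoly K[n]}, D != 0 & forall c : 'I_n -> K, D.@[c] != 0 ->
    has_codim (in_loc (binomial_system r beta c) [ffun=> 0]) mu.
Proof.
case=> U [[F UF] [c0 Uc0] HU]; set L := (mu * n).+1.
pose rk (c : 'I_n -> K) := \rank (trunc_mx L (binomial_system r beta c)).
have rkU (c : {ffun 'I_n -> k}) : U c ->
    (#|{: 'X_{1..n < L}}| - rk (fun i => iota (c i)) = mu)%N.
  by move=> Uc; apply/mult_trunc/is_multiplicityP/HU.
have rk_le c : (rk c <= #|{: 'X_{1..n < L}}|)%N by apply: rank_leq_col.
set c1 := fun i => iota (c0 i).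
have rk_max c : (rk c <= rk c1)%N.
  have [f [g]] := max_minor (trunc_mx L (binomial_system r beta c)).
  rewrite generic_trunc_mx_minor => minor0.
  have [c0_neq0 [F0 FF0 F0c]] := (UF c0).1 Uc0.
  set M := \det _ in minor0.
  (* A point of [U] at which the minor that is nonzero at [c] remains nonzero; on [U] the rank is
     constant. *)
  have [|c2] := @mpoly_neq0_eval k n (M * (F0 * \prod_i 'X_i)) k_char0.
    rewrite !mulf_neq0 ?mpoly_prodX_neq0 //.
      by apply: contraNneq minor0 => ->; rewrite raddf0.
    by apply: contraNneq F0c => ->; rewrite meval0.
  rewrite !mevalM !mulf_eq0 !negb_or => /and3P[Mc2 F0c2].
  rewrite rmorph_prod /= => /prodf_neq0 c2_neq0.
  have Uc2 : U c2.
    by apply/UF; split; [move=> i; have := c2_neq0 i isT; rewrite mevalXU|exists F0].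
  have : (rk c <= rk (fun i => iota (c2 i)))%N.
    apply: (@minor_rank _ _ _ _ _ f g); rewrite generic_trunc_mx_minor mmap_point fmorph_eq0.
    exact: Mc2.
  have := rkU _ Uc0; have := rkU _ Uc2; rewrite -/c1.
  have := rk_le c1; have := rk_le (fun i => iota (c2 i)).
  by rewrite -/(rk c); lia.
have [f [g minor0]] := max_minor (trunc_mx L (binomial_system r beta c1)).
rewrite generic_trunc_mx_minor in minor0; set M := \det _ in minor0.
exists (map_mpoly iota M) => [|c].
  apply: contraNneq minor0 => M0; rewrite -meval_map_mpoly M0.
  by rewrite meval0.
rewrite meval_map_mpoly -generic_trunc_mx_minor => /minor_rank rk_ge.
apply: trunc_mult; rewrite -/(rk c).
by rewrite (_ : rk c = rk c1) ?rkU //; apply/eqP; rewrite eqn_leq rk_max.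
Qed.

End GenericMult.

(** * Solutions in the torus *)

Section Torus.
Variables (K : closedFieldType) (n : nat).
Hypothesis K_char0 : [pchar K] =i pred0.
Implicit Types (z c : {ffun 'I_n -> K}) (A B : 'M[int]_n).

Definition torus z : Prop := forall i, z i != 0.

Definition mpow z A : {ffun 'I_n -> K} := [ffun i => \prod_j z j ^ A i j].

Lemma torus_mpow z A : torus z -> torus (mpow z A).
Proof. by move=> tz i; rewrite ffunE; apply/prodf_neq0 => j _; rewrite expfz_neq0. Qed.

Lemma prodXz (I : Type) (s : seq I) (P : pred I) (F : I -> K) (e : int) :
  (\prod_(i <- s | P i) F i) ^ e = \prod_(i <- s | P i) F i ^ e.
Proof. exact: (big_morph (fun x : K => x ^ e) (fun x y => expfzMl x y e) (exp1rz _ e)). Qed.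

Lemma expz_sum (x : K) (I : Type) (s : seq I) (P : pred I) (F : I -> int) :
  x != 0 -> x ^ (\sum_(i <- s | P i) F i) = \prod_(i <- s | P i) x ^ F i.
Proof. move=> x0; exact: (big_morph _ (fun a b => expfzDr a b x0) (expr0z x)). Qed.

Lemma mpowM z A B : torus z -> mpow (mpow z A) B = mpow z (B *m A).
Proof.
move=> tz; apply/ffunP => i; rewrite !ffunE.
under eq_bigr => j _ do rewrite ffunE prodXz.
rewrite exchange_big /=; apply: eq_bigr => l _; rewrite mxE expz_sum //.
by apply: eq_bigr => j _; rewrite exprz_exp mulrC.
Qed.

Lemma mpow1 z : mpow z 1%:M = z.
Proof.
apply/ffunP => i; rewrite !ffunE (bigD1 i) //= mxE eqxx expr1z big1 ?mulr1 // => j.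
by rewrite mxE eq_sym => /negbTE ->.
Qed.

Lemma roots_Xn (e : nat) (a : K) : (0 < e)%N -> a != 0 ->
  exists s : seq K, [/\ uniq s, size s = e & forall x, (x \in s) = (x ^+ e == a)].
Proof.
move=> e0 a0; pose p : {poly K} := 'X^e - a%:P.
have e0K : e%:R != 0 :> K by have/pcharf0P -> := K_char0; rewrite -lt0n.
have pm : p \is monic := monicXnsubC a e0.
have [s Es] := closed_field_poly_normal p.
rewrite (monicP pm) scale1r in Es.
have : separable_poly p.
  rewrite unlock; apply/Bezout_coprimepP.
  (* Bezout relation [- p + (X / e) p' = a] with a nonzero constant on the right. *)
  exists (- 1, (e%:R^-1)%:P * 'X) => /=; rewrite derivB derivXn derivC subr0.
  rewrite mulrnAr -mulrA -exprS prednK // -mulr_natr mulrAC -polyC_natr -polyCM.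
  by rewrite mulVf // mul1r mulN1r opprB subrK polyC_eqp1.
rewrite Es separable_prod_XsubC => us; exists s; split=> // [|x].
  by apply: succn_inj; rewrite -(size_XnsubC a e0) -/p Es size_prod_XsubC.
by rewrite -root_prod_XsubC -Es rootE !hornerE subr_eq0.
Qed.

Lemma roots_Xz (e : int) (a : K) : e != 0 -> a != 0 ->
  exists s : seq K, [/\ uniq s, size s = `|e|%N &
    forall x, x \in s <-> x != 0 /\ x ^ e = a].
Proof.
have pos (m : nat) b x : (0 < m)%N -> b != 0 -> x ^+ m == b <-> x != 0 /\ x ^+ m = b.
  move=> m0 b0; split=> [/eqP E|[_ ->] //]; split=> //.
  by apply: contraNneq b0 => x0; rewrite -E x0 expr0n gtn_eqF.
case: e => m e0 a0.
  have m0 : (0 < m)%N by rewrite lt0n.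
  have [s [us ss Hs]] := roots_Xn m0 a0; exists s; split=> // x.
  by rewrite Hs; apply: pos.
have a0' : a^-1 != 0 by rewrite invr_eq0.
have [s [us ss Hs]] := roots_Xn (ltn0Sn m) a0'; exists s; split=> // x.
rewrite Hs pos // NegzE; split=> -[x0 E]; split=> //.
  by rewrite -exprnN E invrK.
by rewrite -E -exprnN invrK.
Qed.

Lemma prod_enum (s : 'I_n -> seq K) : (forall i, uniq (s i)) ->
  exists t : seq {ffun 'I_n -> K},
    [/\ uniq t, size t = (\prod_i size (s i))%N & forall z, z \in t <-> forall i, z i \in s i].
Proof.
move=> us; pose T := {dffun forall i : 'I_n, 'I_(size (s i))}.
pose f (u : T) : {ffun 'I_n -> K} := [ffun i => nth 0 (s i) (u i)].
exists (codom f); split=> [||z].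
- rewrite map_inj_uniq ?enum_uniq // => u v /ffunP E; apply/ffunP => i.
  have := E i; rewrite !ffunE => /eqP.
  by rewrite nth_uniq // => /eqP/val_inj.
- rewrite size_codom card_dep_ffun foldrE big_map big_enum /=.
  by apply: eq_bigr => i _; rewrite card_ord.
split=> [/codomP[u ->] i|H]; first by rewrite ffunE mem_nth.
have lt_i i : (index (z i) (s i) < size (s i))%N by rewrite index_mem.
apply/codomP; exists ([ffun i => Ordinal (lt_i i)] : T).
by apply/ffunP => i; rewrite !ffunE /= nth_index.
Qed.

Lemma mpow_invl z A : A \in unitmx -> torus z -> mpow (mpow z A) (invmx A) = z.
Proof. by move=> uA tz; rewrite mpowM // mulVmx // mpow1. Qed.

Lemma mpow_invr z A : A \in unitmx -> torus z -> mpow (mpow z (invmx A)) A = z.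
Proof. by move=> uA tz; rewrite mpowM // mulmxV // mpow1. Qed.

Definition smith_diag (d : seq int) : 'M[int]_n := \matrix_(i, j) (d`_i *+ (i == j :> nat)).

Lemma mpow_diag z d i : mpow z (smith_diag d) i = z i ^ d`_i.
Proof.
rewrite ffunE (bigD1 i) //= mxE eqxx mulr1n big1 ?mulr1 // => j.
by rewrite eq_sym mxE -val_eqE => /negbTE ->; rewrite mulr0n.
Qed.

Lemma absz_unit (m : int) : m \is a GRing.unit -> `|m|%N = 1%N.
Proof. by rewrite unfold_in => /orP[] /eqP ->. Qed.

Lemma absz_det_smith L R d : L \in unitmx -> R \in unitmx ->
  `|\det (L *m smith_diag d *m R)|%N = (\prod_(i < n) `|(d`_i)%R|)%N.
Proof.
rewrite !unitmxE => uL uR.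
rewrite !det_mulmx !abszM (absz_unit uL) (absz_unit uR) mul1n muln1.
rewrite (_ : smith_diag d = diag_mx (\row_i d`_i)); last first.
  by apply/matrixP => i j; rewrite !mxE -val_eqE.
rewrite det_diag (big_morph absz abszM absz1).
by apply: eq_bigr => i _; rewrite mxE.
Qed.

(** Unimodular matrices act bijectively on the torus, so the Smith normal form reduces the system to
    separate equations [y_i ^ d_i = c'_i], with [|d_i|] solutions each. *)
Lemma torus_count A c : \det A != 0 -> torus c ->
  exists s : seq {ffun 'I_n -> K}, [/\ uniq s, size s = `|\det A|%N &
    forall z, z \in s <-> torus z /\ mpow z A = c].
Proof.
have [L uL [R uR [d _ EA]]] := int_Smith_normal_form A; rewrite -/(smith_diag d) in EA.
move=> A0 tc; pose c' := mpow c (invmx L); have tc' : torus c' by apply: torus_mpow.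
have d0 (i : 'I_n) : d`_i != 0.
  apply: contraNneq A0 => di; rewrite -absz_eq0 EA absz_det_smith //.
  by rewrite (bigD1 i) //= di mul0n.
have /fin_all_exists[t Ht] : forall i : 'I_n, exists s : seq K,
    [/\ uniq s, size s = `|(d`_i)%R|%N & forall x, x \in s <-> x != 0 /\ x ^ d`_i = c' i].
  by move=> i; apply: roots_Xz (d0 i) (tc' i).
have [|s [us ss Hs]] := @prod_enum t; first by move=> i; case: (Ht i).
pose g y := mpow y (invmx R).
have memT y : y \in s <-> torus y /\ mpow y (smith_diag d) = c'.
  rewrite Hs; split=> [H|[ty /ffunP E] i].
    have H' i : y i != 0 /\ y i ^ d`_i = c' i by case: (Ht i) => _ _ H'; apply/H'.
    split=> [i|]; first by case: (H' i).
    by apply/ffunP => i; rewrite mpow_diag; case: (H' i).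
  by case: (Ht i) => _ _ ->; split; rewrite // -E mpow_diag.
exists [seq g y | y <- s]; split=> [||z].
- rewrite map_inj_in_uniq // => y y' /memT[ty _] /memT[ty' _] E.
  by rewrite -(mpow_invr uR ty) -/(g y) E mpow_invr.
- rewrite size_map ss EA absz_det_smith //.
  by apply: eq_bigr => i _; case: (Ht i).
split=> [/mapP[y /memT[ty E] ->]|[tz E]].
  split; first exact: torus_mpow.
  rewrite EA -mpowM; last exact: torus_mpow.
  rewrite mpow_invr // -mpowM // E; exact: mpow_invr.
apply/mapP; exists (mpow z R); last by rewrite /g mpow_invl.
apply/memT; split; first exact: torus_mpow.
rewrite mpowM // /c' -E [in RHS]mpowM // EA -mulmxA mulKmx //.
Qed.

Definition mpos (m : 'I_n -> int) : 'X_{1..n} :=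
  [multinom if (0 <= m i)%R then absz (m i) else 0%N | i < n].

Lemma meval_mpos c (m : 'I_n -> int) : (forall i, 0 <= m i)%R ->
  'X_[mpos m].@[c] = \prod_i c i ^ m i.
Proof.
move=> m0; rewrite mevalX; apply: eq_bigr => i _; rewrite mnmE m0.
by rewrite -[in RHS](gez0_abs (m0 i)).
Qed.

(** An integer vector [v] with [v A = 0] gives the relation [\prod_i c_i ^ v_i = 1] on the image;
    the positive and negative parts of [v] make it a binomial equation. *)
Lemma mpow_dependent A : \det A = 0 ->
  exists2 G : {mpoly K[n]}, G != 0 & forall z, torus z -> G.@[mpow z A] = 0.
Proof.
move/eqP/det0P => [v v0 vA].
pose vp (i : 'I_n) : int := if 0 <= v 0 i then v 0 i else 0.
pose vn (i : 'I_n) : int := if 0 <= v 0 i then 0 else - v 0 i.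
have vp_ge0 i : 0 <= vp i by rewrite /vp; case: ifP.
have vn_ge0 i : 0 <= vn i.
  by rewrite /vn; case: ifP => // /negbT; rewrite -ltNge oppr_ge0 => /ltW.
have vE i : v 0 i = vp i - vn i.
  by rewrite /vp /vn; case: ifP => _; rewrite ?subr0 // sub0r opprK.
exists ('X_[mpos vp] - 'X_[mpos vn]).
  apply: contraNneq v0 => /(congr1 (mcoeff (mpos vp))).
  rewrite mcoeffB !mcoeffX eqxx mcoeff0; case: eqP => [E _|_ /eqP]; last first.
    by rewrite subr0 oner_eq0.
  apply/eqP/rowP => i; rewrite mxE vE; apply/eqP; rewrite subr_eq0; apply/eqP.
  move/mnmP/(_ i): E; rewrite !mnmE vp_ge0 vn_ge0 => E.
  by rewrite -(gez0_abs (vp_ge0 i)) -(gez0_abs (vn_ge0 i)) E.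
move=> z tz; rewrite mevalB !meval_mpos //; apply/eqP; rewrite subr_eq0; apply/eqP.
have tA := torus_mpow A tz; set c := mpow z A in tA *.
have c0 : \prod_i c i ^ vn i != 0 by apply/prodf_neq0 => i _; rewrite expfz_neq0.
apply: (mulIf (invr_neq0 c0)); rewrite divff // -prodfV -big_split /=.
transitivity (\prod_i c i ^ v 0 i).
  by apply: eq_bigr => i _; rewrite vE expfzDr // invr_expz.
under eq_bigr => i _ do rewrite ffunE prodXz.
rewrite exchange_big big1 //= => j _.
under eq_bigr => i _ do rewrite exprz_exp mulrC.
rewrite -expz_sum //; have /rowP/(_ j) := vA; rewrite !mxE => ->.
by rewrite expr0z.
Qed.

End Torus.

Section Push.
Variables (K : closedFieldType) (n : nat).
Hypothesis K_char0 : [pchar K] =i pred0.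
Implicit Types (z c : {ffun 'I_n -> K}) (A B : 'M[int]_n).
Implicit Types (F G : {mpoly K[n]}).

Lemma primitive_root_exists d : (0 < d)%N -> exists zeta : K, d.-primitive_root zeta.
Proof.
move=> d0; have [s [us ss Hs]] := roots_Xn K_char0 d0 (oner_neq0 K).
have /hasP[zeta _ prim] : has d.-primitive_root s.
  apply: has_prim_root; rewrite ?ss //.
  by apply/allP => x; rewrite Hs => /eqP E; apply/unity_rootP.
by exists zeta.
Qed.

Definition rescale (u : 'I_n -> K) : {mpoly K[n]} -> {mpoly K[n]} :=
  comp_mpoly [tuple u i *: 'X_i | i < n].

Lemma rescaleX u m : rescale u 'X_[m] = (\prod_i u i ^+ m i) *: 'X_[m].
Proof.
rewrite /rescale comp_mpolyX [in RHS]mpolyXE_id -scaler_prod.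
by apply: eq_bigr => i _; rewrite tnth_mktuple exprZn.
Qed.

Lemma mcoeff_rescale u F m : (rescale u F)@_m = F@_m * \prod_i u i ^+ m i.
Proof.
have E m' : (rescale u (F@_m' *: 'X_[m']))@_m = (F@_m' *: 'X_[m'])@_m * \prod_i u i ^+ m i.
  rewrite /rescale comp_mpolyZ -/(rescale u _) rescaleX scalerA !mcoeffZ !mcoeffX.
  by case: eqP => [->|_]; rewrite ?mulr1 ?mulr0 ?mul0r.
have -> : rescale u F = \sum_(m' <- msupp F) rescale u (F@_m' *: 'X_[m']).
  by rewrite {1}[F]mpolyE /rescale raddf_sum.
rewrite raddf_sum /=; under eq_bigr => m' _ do rewrite E.
by rewrite -mulr_suml -raddf_sum -mpolyE.
Qed.

Lemma meval_rescale u F z : (rescale u F).@[z] = F.@[fun i => u i * z i].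
Proof.
rewrite comp_mpoly_meval; apply: meval_eq => i.
by rewrite tnth_mktuple mevalZ mevalXU.
Qed.

(* The product of F over all rescalings of the variables by d-th roots of     *)
(* unity is invariant under these rescalings, hence a polynomial in the       *)
(* d-th powers of the variables.                                              *)
Lemma power_multiple d F : (0 < d)%N -> F != 0 ->
  exists F1, [/\ F1 != 0, forall z, F1.@[z] != 0 -> F.@[z] != 0 &
    forall m, F1@_m != 0 -> forall i, (d %| m i)%N].
Proof.
case: d => // d _ F0; have [zeta prim] := primitive_root_exists (ltn0Sn d).
pose u (t : {ffun 'I_n -> 'I_d.+1}) i := zeta ^+ t i.
pose F1 := \prod_t rescale (u t) F.
have u0 t i : u t i != 0.
  apply: expf_neq0; apply: contra_eqN (prim_expr_order prim) => /eqP ->.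
  by rewrite expr0n /= eq_sym oner_eq0.
exists F1; split=> [|z|m F1m j].
- apply/prodf_neq0 => t _; apply: contraNneq F0 => E.
  apply/eqP/mpolyP => m; rewrite mcoeff0.
  have /(congr1 (mcoeff m)) := E; rewrite mcoeff_rescale mcoeff0 => /eqP.
  rewrite mulf_eq0 => /orP[/eqP //|].
  by rewrite prodf_seq_eq0 => /hasP[i _]; rewrite /= expf_eq0 (negbTE (u0 t i)) andbF.
- rewrite /F1 rmorph_prod /= => /prodf_neq0/(_ [ffun=> 0] isT).
  rewrite meval_rescale (@meval_eq _ _ _ z) // => i.
  by rewrite /u ffunE expr0 mul1r.
(* Rescaling the variable [j] alone by [zeta]: invariance of [F1] gives [zeta ^+ m j = 1] wherever
   the coefficient is nonzero. *)
pose t0 : {ffun 'I_n -> 'I_d.+1} := [ffun i => if i == j then inZp 1 else 0].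
have uD t i : u (t + t0) i = u t i * u t0 i.
  by rewrite /u ffunE /= -exprD -[RHS](prim_expr_mod prim).
have inv : rescale (u t0) F1 = F1.
  rewrite /F1 /rescale rmorph_prod /= [RHS](reindex_inj (addIr t0)) /=.
  apply: eq_bigr => t _; rewrite -/(rescale _ _); apply/mpolyP => m'.
  rewrite !mcoeff_rescale -mulrA -big_split /=; congr (_ * _).
  by apply: eq_bigr => i _; rewrite uD exprMn.
have := mcoeff_rescale (u t0) F1 m; rewrite inv -{1}[F1@_m]mulr1 => /(mulfI F1m)/esym.
rewrite (bigD1 j) //= big1 => [|i /negbTE ne_ij]; last first.
  by rewrite /u ffunE ne_ij expr0 expr1n.
(* For order one [inZp 1] is 0, which is harmless because [zeta] is then 1. *)
have zt : zeta ^+ (inZp 1 : 'I_d.+1) = zeta by rewrite /= (prim_expr_mod prim) expr1.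
by rewrite mulr1 /u ffunE eqxx zt => E; rewrite (prim_order_dvd prim) -E.
Qed.

(* z^d is a Laurent monomial in c = z^A when d = |det A|, so the polynomial   *)
(* in z^d provided by power_multiple becomes, once multiplied by a monomial,  *)
(* a polynomial in c.                                                         *)
Lemma mpow_push A F : \det A != 0 -> F != 0 ->
  exists2 G : {mpoly K[n]}, G != 0 &
    forall z, torus z -> G.@[mpow z A] != 0 -> F.@[z] != 0.
Proof.
move=> A0 F0; pose d := `|\det A|%N; have d0 : (0 < d)%N by rewrite lt0n absz_eq0.
have [F1 [F10 F1F F1d]] := power_multiple d0 F0.
(* The adjugate up to sign, so that [Gam *m A] is the scalar [d] and [z j ^+ d] is the monomial in
   [c] with exponents [Gam j]. *)
pose Gam : 'M[int]_n := sgz (\det A) *: \adj A.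
have GamA : Gam *m A = (d%:Z)%:M.
  by rewrite -scalemxAl mul_adj_mx scale_scalar_mx -normrEsg -abszE.
pose e (m : 'X_{1..n}) (i : 'I_n) : int := \sum_j (m j %/ d)%N%:Z * Gam j i.
have e_inj m m' : F1@_m != 0 -> F1@_m' != 0 -> e m =1 e m' -> m = m'.
  move=> /F1d dm /F1d dm' E.
  have : (\row_j ((m j %/ d)%N%:Z)) *m Gam = (\row_j ((m' j %/ d)%N%:Z)) *m Gam.
    apply/rowP => i; rewrite !mxE; have := E i; rewrite /e => E'.
    by under eq_bigr do rewrite mxE; under [RHS]eq_bigr do rewrite mxE.
  move/(congr1 (mulmx^~ A)); rewrite -!mulmxA GamA !mul_mx_scalar.
  move=> /rowP E'; apply/mnmP => i; have := E' i; rewrite !mxE -!PoszM => -[].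
  by rewrite ![(d * _)%N]mulnC !divnK.
pose N := (\sum_(m <- msupp F1) \sum_i `|e m i|)%N.
have N_ge m i : m \in msupp F1 -> 0 <= e m i + N%:Z.
  move=> Fm; have : (`|e m i| <= N)%N.
    rewrite /N (bigD1_seq m) ?msupp_uniq //= (bigD1 i) //=.
    by rewrite -addnA leq_addr.
  lia.
pose E m := mpos (fun i => e m i + N%:Z).
have E_inj m m' : m \in msupp F1 -> m' \in msupp F1 -> E m = E m' -> m = m'.
  move=> Fm Fm' /mnmP Em; apply: e_inj; rewrite -?mcoeff_msupp // => i.
  have := Em i; rewrite !mnmE !N_ge //; have := N_ge m i Fm; have := N_ge m' i Fm'.
  lia.
exists (\sum_(m <- msupp F1) F1@_m *: 'X_[E m]) => [|z tz].
  have [m Fm] : exists m, m \in msupp F1.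
    case Es : (msupp F1) => [|m s]; first by move: F10; rewrite -msupp_eq0 Es.
    by exists m; rewrite inE eqxx.
  apply/eqP => /(congr1 (mcoeff (E m))); rewrite mcoeff0 raddf_sum.
  rewrite (bigD1_seq m) ?msupp_uniq //= mcoeffZ mcoeffX eqxx mulr1.
  rewrite big_seq_cond big1 ?addr0; last first.
    move=> m' /andP[Fm' ne_m']; rewrite mcoeffZ mcoeffX; case: eqP; last by rewrite mulr0.
    by move/(E_inj _ _ Fm' Fm) => Em; rewrite Em eqxx in ne_m'.
  by apply/eqP; rewrite -mcoeff_msupp.
set c := mpow z A; have tc : torus c by apply: torus_mpow.
have zc j : z j ^+ d = \prod_i c i ^ Gam j i.
  have := mpowM A Gam tz; rewrite GamA -/c => /ffunP/(_ j); rewrite !ffunE => ->.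
  rewrite (bigD1 j) //= mxE eqxx mulr1n big1 ?mulr1 // => i.
  by rewrite mxE eq_sym => /negbTE ->.
suff -> : (\sum_(m <- msupp F1) F1@_m *: 'X_[E m]).@[c] = F1.@[z] * \prod_i c i ^+ N.
  by rewrite mulf_eq0 negb_or => /andP[/F1F].
rewrite [LHS]raddf_sum /= [F1.@[z]]mevalE mulr_suml big_seq [RHS]big_seq.
apply: eq_bigr => m Fm.
rewrite mevalZ -mulrA meval_mpos; last by move=> i; apply: N_ge.
congr (_ * _).
under eq_bigr => i _ do rewrite expfzDr //.
rewrite big_split /=; congr (_ * _).
under eq_bigr => i _ do rewrite expz_sum //.
rewrite exchange_big /=; apply: eq_bigr => j _.
rewrite -[in RHS](divnK (F1d m _ j)); last by rewrite -mcoeff_msupp.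
rewrite mulnC exprM zc -[in RHS]/(_ ^ _%:Z) prodXz; apply: eq_bigr => i _.
by rewrite exprz_exp mulrC.
Qed.

End Push.

(** * Determinants of block triangular matrices *)

Section BlockDet.
Variable R : comNzRingType.

(** Two factorizations of the block matrix [X] into block triangular matrices. *)
Lemma det_sylvester m n (U : 'M[R]_(n, m)) (V : 'M[R]_(m, n)) :
  \det (1%:M + U *m V) = \det (1%:M + V *m U).
Proof.
pose X : 'M[R]_(m + n) := block_mx 1%:M (- V) U 1%:M.
have E1 : X = block_mx 1%:M 0 U 1%:M *m block_mx 1%:M (- V) 0 (1%:M + U *m V).
  rewrite mulmx_block !mulmx1 !mul1mx !mul0mx !addr0.
  by rewrite mulmxN addrCA addNr addr0.
have E2 : X = block_mx (1%:M + V *m U) (- V) 0 1%:M *m block_mx 1%:M 0 U 1%:M.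
  by rewrite mulmx_block !mulmx1 !mul1mx ?mul0mx ?mulmx0 ?addr0 ?add0r mulNmx addrK.
have := congr1 determinant E2; rewrite {1}E1 !det_mulmx !det_lblock !det_ublock.
by rewrite !det1 !mul1r !mulr1.
Qed.

(** Padding with identity rows gives principal minors on different index sets a common size, so that
    the matrices can be multiplied. *)
Definition keep_rows n (S : {set 'I_n}) (M : 'M[R]_n) : 'M[R]_n :=
  \matrix_(i, j) if i \in S then M i j else (i == j)%:R.

(** The padded matrix is [1 + U V] with [U] the inclusion of [S]; Sylvester's identity brings its
    determinant down to size [#|S|]. *)
Lemma det_keep_rows n (S : {set 'I_n}) (M : 'M[R]_n) :
  \det (keep_rows S M) = \det (mxsub (@enum_val _ (mem S)) (@enum_val _ (mem S)) M).
Proof.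
pose U : 'M[R]_(n, #|S|) := \matrix_(i, a) (i == enum_val a)%:R.
pose V : 'M[R]_(#|S|, n) := \matrix_(a, j) (M (enum_val a) j - (enum_val a == j)%:R).
have -> : keep_rows S M = 1%:M + U *m V.
  apply/matrixP => i j; rewrite !mxE; case: ifP => iS.
    rewrite (bigD1 (enum_rank_in iS i)) //= !mxE enum_rankK_in // eqxx mul1r.
    rewrite big1 ?addr0 => [|a ne_a]; first by rewrite addrC subrK.
    rewrite mxE; case: eqP => [E|_]; last by rewrite mul0r.
    case/eqP: ne_a; apply: enum_val_inj; by rewrite enum_rankK_in.
  rewrite big1 ?addr0 // => a _; rewrite mxE; case: eqP => [E|_]; last by rewrite mul0r.
  by rewrite E enum_valP in iS.
rewrite det_sylvester; congr (\det _); apply/matrixP => a b; rewrite !mxE.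
rewrite (bigD1 (enum_val b)) //= !mxE eqxx mulr1 big1 ?addr0 => [|j /negbTE ne_j].
  by rewrite (inj_eq enum_val_inj) addrC subrK.
by rewrite !mxE ne_j mulr0.
Qed.

(* M is the product of the two matrices on the right. *)
Lemma det_closed_rows n (S : {set 'I_n}) (M : 'M[R]_n) :
  (forall i j, i \in S -> j \notin S -> M i j = 0) ->
  \det M = \det (keep_rows S M) * \det (keep_rows (~: S) M).
Proof.
move=> M0; rewrite -det_mulmx; congr (\det _); apply/matrixP => i j; rewrite !mxE.
have [iS|iS] := boolP (i \in S).
  rewrite (bigID (mem S)) /= [X in _ + X]big1 ?addr0 => [|l lS]; last first.
    by rewrite !mxE iS M0 // mul0r.
  have [jS|jS] := boolP (j \in S).
    rewrite (bigD1 j) //= !mxE iS !inE jS eqxx mulr1 big1 ?addr0 // => l /andP[lS].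
    by move=> /negbTE ne_lj; rewrite !mxE inE lS /= ne_lj mulr0.
  rewrite M0 // big1 // => l lS; rewrite !mxE iS inE lS /=.
  by case: eqP => [E|_]; [rewrite -E lS in jS|rewrite mulr0].
rewrite (bigD1 i) //= !mxE (negbTE iS) eqxx mul1r inE iS big1 ?addr0 // => l.
by rewrite eq_sym => /negbTE ne_l; rewrite !mxE (negbTE iS) ne_l mul0r.
Qed.

(** Rows of levels below [t] vanish outside these levels, so [det_closed_rows] splits off one level
    at a time; a level in [Z] has identity rows and contributes 1. *)
Lemma det_block_triangular n s (lev : 'I_n -> 'I_s) (M : 'M[R]_n) (Z : {set 'I_s}) :
  (forall i j, (lev i < lev j)%N -> M i j = 0) ->
  \det (keep_rows [set i | lev i \notin Z] M) =
  \prod_(a : 'I_s | a \notin Z) \det (keep_rows [set i | lev i == a] M).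
Proof.
move=> M0; pose S t := [set i | (lev i < t)%N && (lev i \notin Z)].
have main t : (t <= s)%N -> \det (keep_rows (S t) M) =
    \prod_(a : 'I_s | (a < t)%N && (a \notin Z)) \det (keep_rows [set i | lev i == a] M).
  elim: t => [|t IH] lt_t.
    rewrite big1 //; first rewrite (_ : keep_rows _ _ = 1%:M) ?det1 //.
    by apply/matrixP => i j; rewrite !mxE inE.
  pose T := [set i | (lev i < t)%N].
  rewrite (@det_closed_rows _ T) => [|i j]; last first.
    rewrite !inE -leqNgt => lt_i le_j; rewrite !mxE M0 ?(leq_trans lt_i) //.
    case: ifP => // _; case: eqP => // E.
    by move: lt_i; rewrite E ltnNge le_j.
  have -> : keep_rows T (keep_rows (S t.+1) M) = keep_rows (S t) M.
    apply/matrixP => i j; rewrite !mxE !inE ltnS.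
    by case: ltnP => // lt_i; rewrite ltnW.
  rewrite IH ?(ltnW lt_t) //; pose b : 'I_s := Ordinal lt_t.
  have -> : keep_rows (~: T) (keep_rows (S t.+1) M) =
      keep_rows (if b \in Z then set0 else [set i | lev i == b]) M.
    apply/matrixP => i j; rewrite !mxE !inE -leqNgt ltnS.
    have -> : (i \in if b \in Z then set0 else [set i0 | lev i0 == b]) =
        (lev i == b) && (lev i \notin Z).
      by case: ifP => bZ; rewrite inE; case: eqP => // ->; rewrite bZ.
    rewrite -(inj_eq val_inj (lev i)) /= [lev i == t :> nat]eqn_leq.
    by case: (lev i <= t)%N; case: (t <= lev i)%N; case: (lev i \in Z).
  case: ifP => bZ.
    rewrite (_ : keep_rows set0 M = 1%:M); last by apply/matrixP => i j; rewrite !mxE inE.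
    rewrite det1 mulr1; apply: eq_bigl => a; rewrite [in RHS]ltnS [in RHS]leq_eqVlt.
    case: eqP => // E; have -> : a = b by apply: val_inj.
    by rewrite bZ /= andbF.
  rewrite [RHS](bigD1 b) /= ?ltnSn ?bZ // mulrC; congr (_ * _).
  apply: eq_bigl => a; rewrite [in RHS]ltnS [in RHS]leq_eqVlt -(inj_eq val_inj a) /=.
  by case: eqP => [E|_]; rewrite ?E ?ltnn ?andbF ?andbT.
have -> : [set i | lev i \notin Z] = S s.
  by apply/setP => i; rewrite !inE ltn_ord.
by rewrite main //; apply: eq_bigl => a; rewrite ltn_ord.
Qed.

End BlockDet.

Lemma delta_keep_rows n (r : 'I_n -> nat) (beta : 'I_n -> 'X_{1..n}) nu a :
  delta r beta nu a = `|\det (keep_rows (block n nu a) (system_matrix r beta))|%N.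
Proof.
rewrite /delta det_keep_rows; congr (absz (\det _)); apply/matrixP => i j.
rewrite !mxE !mulmnE !mnm1E mnmE /sub_r.
by rewrite (inj_eq enum_val_inj).
Qed.

(** * Eliminating the nonzero coordinates *)

Section Taylor.
Variables (K : fieldType) (n : nat) (x : {ffun 'I_n -> K}).
Implicit Types (f g : {mpoly K[n]}) (S : {set 'I_n}) (m : 'X_{1..n}).

(** A first order expansion at [x] whose cofactors take the partial derivatives as values at [x];
    [S] contains the variables that are used. *)
Definition taylor1 S f : Prop :=
  exists g : 'I_n -> {mpoly K[n]},
    [/\ f - (f.@[x])%:MP = \sum_j g j * ('X_j - (x j)%:MP),
        forall j, (g j).@[x] = (f^`M(j)).@[x]
      & forall j, j \notin S -> g j = 0].

Lemma taylor1M S f f' : taylor1 S f -> taylor1 S f' -> taylor1 S (f * f').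
Proof.
case=> g [Eg dg g0] [g' [Eg' dg' g0']].
exists (fun j => g j * f' + (f.@[x])%:MP * g' j); split=> [|j|j jS].
- rewrite -[RHS](_ : (f - (f.@[x])%:MP) * f' + (f.@[x])%:MP * (f' - (f'.@[x])%:MP) = _).
    by rewrite mevalM mpolyCM; ring.
  rewrite Eg Eg' mulr_suml mulr_sumr -big_split /=.
  by apply: eq_bigr => j _; ring.
- by rewrite mderivM !mevalD !mevalM mevalC dg dg'.
by rewrite g0 // g0' // mul0r mulr0 addr0.
Qed.

Lemma taylor1_1 S : taylor1 S 1.
Proof.
exists (fun=> 0); split=> [|j|//].
  by rewrite meval1 mpolyC1 subrr big1 // => j _; rewrite mul0r.
by rewrite -mpolyC1 mderivC.
Qed.

Lemma taylor1_var S i : i \in S -> taylor1 S 'X_i.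
Proof.
move=> iS; exists (fun j => (i == j)%:R); split=> [|j|j jS].
- rewrite mevalXU (bigD1 i) //= eqxx mul1r big1 ?addr0 // => j.
  by rewrite eq_sym => /negbTE ->; rewrite mul0r.
- rewrite mderivX mevalZ mnm1E.
  case: eqP => [->|_]; last by rewrite meval0 mul0r.
  rewrite (_ : (U_(j) - U_(j))%MM = 0%MM) ?mpolyX0 ?meval1 ?mulr1 //.
  by apply/mnmP => l; rewrite mnmBE subnn mnm0E.
by case: eqP => // E; rewrite E (negbTE jS) in iS.
Qed.

Lemma taylor1D S f f' : taylor1 S f -> taylor1 S f' -> taylor1 S (f + f').
Proof.
case=> g [Eg dg g0] [g' [Eg' dg' g0']]; exists (fun j => g j + g' j); split=> [|j|j jS].
- rewrite mevalD mpolyCD opprD addrACA Eg Eg' -big_split /=.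
  by apply: eq_bigr => j _; rewrite mulrDl.
- by rewrite mderivD !mevalD dg dg'.
by rewrite g0 // g0' // addr0.
Qed.

Lemma taylor1Z S a f : taylor1 S f -> taylor1 S (a *: f).
Proof.
case=> g [Eg dg g0]; exists (fun j => a *: g j); split=> [|j|j jS].
- rewrite mevalZ mpolyCM mul_mpolyC -scalerBr Eg scaler_sumr.
  by apply: eq_bigr => j _; rewrite scalerAl.
- by rewrite mderivZ !mevalZ dg.
by rewrite g0 // scaler0.
Qed.

Lemma taylor1X S m : (forall j, j \notin S -> m j = 0%N) -> taylor1 S 'X_[m].
Proof.
move=> mS; rewrite mpolyXE_id; elim/big_ind: _ => [|f f'|j _].
- exact: taylor1_1.
- exact: taylor1M.
have [jS|jS] := boolP (j \in S); last by rewrite mS // expr0; apply: taylor1_1.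
elim: (m j) => [|e IH]; first by rewrite expr0; apply: taylor1_1.
by rewrite exprS; apply: taylor1M => //; apply: taylor1_var.
Qed.

Lemma mevalX_deriv m j : x j != 0 -> ('X_[m]^`M(j)).@[x] = (m j)%:R * 'X_[m].@[x] / x j.
Proof.
move=> xj; rewrite mderivX mevalZ.
have [->|mj] := eqVneq (m j) 0%N; first by rewrite !mul0r.
rewrite -mulrA; congr (_ * _).
rewrite -[m in RHS](@submK _ U_(j) m); last first.
  by apply/mnm_lepP => i; rewrite mnm1E; case: eqP => // <-; rewrite lt0n.
by rewrite mpolyXD mevalM mevalXU mulfK.
Qed.

End Taylor.

Definition part n (V : {set 'I_n}) (m : 'X_{1..n}) : 'X_{1..n} :=
  [multinom if j \in V then m j else 0 | j < n].

Lemma partE n (V : {set 'I_n}) (m : 'X_{1..n}) : m = (part V m + part (~: V) m)%MM.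
Proof.
apply/mnmP => i; rewrite mnmDE !mnmE inE.
by case: (i \in V); rewrite ?addn0.
Qed.

Lemma meval_lead (K : fieldType) n (x : 'I_n -> K) (r : 'I_n -> nat) i :
  'X_[lead_exp r i].@[x] = x i ^+ r i.
Proof.
rewrite mevalX (bigD1 i) //= mulmnE mnm1E eqxx mul1n.
rewrite big1 ?mulr1 // => j; rewrite eq_sym mulmnE mnm1E => /negbTE ->.
by rewrite mul0n expr0.
Qed.

Section TorusReduction.
Variables (K : fieldType) (n : nat) (x : {ffun 'I_n -> K}).
Variables (r : 'I_n -> nat) (beta : 'I_n -> 'X_{1..n}) (c : 'I_n -> K).
Variable V : {set 'I_n}.

Definition fibre_coef i : K := c i * 'X_[part V (beta i)].@[x].

Definition fibre_system i : {mpoly K[n]} :=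
  if i \in V then 'X_i - (x i)%:MP
  else binomial_system r (fun i => part (~: V) (beta i)) fibre_coef i.

Hypothesis V_nonzero : forall i, (i \in V) = (x i != 0).
Hypothesis V_closed : forall i j, i \in V -> beta i j != 0%N -> j \in V.
Let p := binomial_system r beta c.
Hypothesis x_solution : is_solution p x.

Lemma solution_monomial i : x i ^+ r i = c i * 'X_[beta i].@[x].
Proof.
have := x_solution i; rewrite /p /binomial_system mevalB mevalZ meval_lead => /eqP.
by rewrite subr_eq0 => /eqP.
Qed.

Lemma taylor1_binomial i : i \in V -> taylor1 x V (p i).
Proof.
move=> iV; rewrite /p /binomial_system -scaleN1r scalerA.
apply: taylor1D; last apply: taylor1Z; apply: taylor1X => j jV.
  by rewrite mulmnE mnm1E; case: eqP => // E; rewrite E (negbTE jV) in iV.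
by apply/eqP; apply: contraNT jV; apply: V_closed iV.
Qed.

Lemma fibre_diff q i : (forall j, j \in V -> in_loc q x ('X_j - (x j)%:MP)) ->
  in_loc q x (p i - binomial_system r (fun i => part (~: V) (beta i)) fibre_coef i).
Proof.
move=> Hq; rewrite /p /binomial_system /fibre_coef.
set P := part V (beta i); set Q := part (~: V) (beta i).
have [g [Eg _ g0]] : taylor1 x V 'X_[P].
  by apply: taylor1X => j /negbTE jV; rewrite mnmE jV.
have -> : 'X_[lead_exp r i] - c i *: 'X_[beta i] -
    ('X_[lead_exp r i] - (c i * 'X_[P].@[x]) *: 'X_[Q]) =
    - c i *: ('X_[Q] * ('X_[P] - ('X_[P].@[x])%:MP)).
  rewrite [beta i](partE V) -/P -/Q mpolyXD -!mul_mpolyC mpolyCN mpolyCM; ring.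
apply: in_locZ; apply: in_locM; rewrite Eg; apply: in_loc_sum => j _.
have [jV|jV] := boolP (j \in V); first by apply: in_locM; apply: Hq.
by rewrite g0 // mul0r; apply: in_loc0.
Qed.

Hypothesis det_neq0 : (\det (keep_rows V (system_matrix r beta)))%:~R != 0 :> K.

(* The Jacobian matrix at x of the equations indexed by V is, up to rescaling  *)
(* of rows and columns, the matrix of the system.                              *)
Lemma torus_coordinate j : j \in V -> in_loc p x ('X_j - (x j)%:MP).
Proof.
have /fin_all_exists[g Hg] : forall i, exists g : 'I_n -> {mpoly K[n]}, i \in V ->
    [/\ p i - ((p i).@[x])%:MP = \sum_j g j * ('X_j - (x j)%:MP),
     forall j, (g j).@[x] = ((p i)^`M(j)).@[x] & forall j, j \notin V -> g j = 0].
  move=> i; have [iV|_] := boolP (i \in V); last by exists (fun=> 0).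
  by have [g Hg] := taylor1_binomial iV; exists g.
(* Zeros in [v] and identity rows in [J] outside [V] allow Nakayama's lemma to be applied in size
   [n]. *)
pose v j : {mpoly K[n]} := if j \in V then 'X_j - (x j)%:MP else 0.
pose J : 'M[{mpoly K[n]}]_n := \matrix_(i, j) if i \in V then g i j else (i == j)%:R.
suff H : forall j, in_loc p x (v j) by move=> jV; have := H j; rewrite /v jV.
apply: (@in_loc_nakayama _ _ _ _ J) => [i|].
  have [iV|iV] := boolP (i \in V).
    have [Eg _ g0] := Hg i iV.
    rewrite (_ : \sum_j _ = p i); first exact: in_loc_gen.
    rewrite x_solution mpolyC0 subr0 in Eg; rewrite Eg; apply: eq_bigr => l _.
    rewrite mxE iV /v; case: ifP => // /negbT lV.
    by rewrite g0 // !mul0r.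
  rewrite big1 => [|l _]; first exact: in_loc0.
  rewrite mxE (negbTE iV) /v; case: eqP => [<-|_]; last by rewrite mul0r.
  by rewrite (negbTE iV) mulr0.
pose u i := if i \in V then x i ^+ r i else 1.
pose u' i := if i \in V then (x i)^-1 else 1.
rewrite -det_map_mx.
have -> : map_mx (meval x) J =
    diag_mx (\row_i u i) *m map_mx intr (keep_rows V (system_matrix r beta))
    *m diag_mx (\row_i u' i).
  apply/matrixP => i l; rewrite mul_mx_diag mxE [RHS]mxE mul_diag_mx [_ i l in RHS]mxE.
  rewrite !mxE; have [iV|iV] := boolP (i \in V); last first.
    rewrite /u (negbTE iV) mul1r; case: eqP => [<-|_]; last by rewrite meval0 mul0r.
    by rewrite meval1 /u' (negbTE iV) mulr1.
  have [_ dg g0] := Hg i iV; rewrite /u iV.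
  have [lV|lV] := boolP (l \in V); last first.
    rewrite g0 // meval0 /u' (negbTE lV) mulr1 mulmnE mnm1E.
    case: eqP => [E|_]; first by rewrite -E iV in lV.
    have /eqP -> : beta i l == 0%N by apply: contraNT lV; apply: V_closed iV.
    by rewrite subrr mulr0.
  rewrite dg /u' lV /p /binomial_system mderivB mderivZ mevalB mevalZ.
  have xl : x l != 0 by rewrite -V_nonzero.
  rewrite !mevalX_deriv // meval_lead solution_monomial rmorphB /= -!pmulrn.
  by rewrite !mulmnE; ring.
rewrite !det_mulmx !det_diag det_map_mx !mulf_neq0 //; apply/prodf_neq0 => i _; rewrite mxE.
  by rewrite /u; case: ifP; rewrite ?oner_eq0 // V_nonzero => xi; rewrite expf_neq0.
by rewrite /u'; case: ifP; rewrite ?oner_eq0 // V_nonzero invr_eq0.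
Qed.

(** Locally at [x] both ideals contain [X_j - x_j] for [j] in [V], and modulo these the other
    equations agree. *)
Lemma fibre_systemP f : in_loc p x f <-> in_loc fibre_system x f.
Proof.
split; apply: in_loc_trans => i.
  have coord j : j \in V -> in_loc fibre_system x ('X_j - (x j)%:MP).
    by move=> jV; have := in_loc_gen fibre_system x j; rewrite /fibre_system jV.
  have [iV|iV] := boolP (i \in V).
    have [g [Eg _ g0]] := taylor1_binomial iV.
    rewrite x_solution mpolyC0 subr0 in Eg; rewrite Eg; apply: in_loc_sum => j _.
    have [jV|jV] := boolP (j \in V); first by apply: in_locM; apply: coord.
    by rewrite g0 // mul0r; apply: in_loc0.
  have := in_locD (fibre_diff i coord) (in_loc_gen fibre_system x i).
  by rewrite /fibre_system (negbTE iV) subrK.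
rewrite /fibre_system; case: ifP => iV; first exact: torus_coordinate.
have := in_locB (in_loc_gen p x i) (fibre_diff i torus_coordinate).
by rewrite opprB addrC subrK.
Qed.

End TorusReduction.

Section Translation.
Variables (K : fieldType) (n : nat) (x : {ffun 'I_n -> K}).
Implicit Types (f g : {mpoly K[n]}).

Definition shift (y : 'I_n -> K) : {mpoly K[n]} -> {mpoly K[n]} :=
  comp_mpoly [tuple 'X_i + (y i)%:MP | i < n].

Lemma shift_var y i : shift y 'X_i = 'X_i + (y i)%:MP.
Proof. by rewrite /shift comp_mpolyXU -tnth_nth tnth_mktuple. Qed.

Lemma meval_shift y f (z : 'I_n -> K) : (shift y f).@[z] = f.@[fun i => z i + y i].
Proof.
rewrite comp_mpoly_meval; apply: meval_eq => i.
by rewrite tnth_mktuple mevalD mevalXU mevalC.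
Qed.

Lemma shift_ext (h : {rmorphism {mpoly K[n]} -> {mpoly K[n]}}) f :
  (forall a, h a%:MP = a%:MP) -> (forall i, h 'X_i = 'X_i) -> h f = f.
Proof.
move=> hC hX; rewrite [f]mpolyE rmorph_sum; apply: eq_bigr => m _.
rewrite -mul_mpolyC rmorphM /= hC; congr (_ * _).
rewrite mpolyXE_id rmorph_prod; apply: eq_bigr => i _.
by rewrite rmorphXn /= hX.
Qed.

Lemma shiftK y y' f : (forall i, y i + y' i = 0) -> shift y (shift y' f) = f.
Proof.
move=> yy'; apply: (@shift_ext (comp_mpoly _ \o comp_mpoly _)) => [a|i] /=.
  by rewrite !comp_mpolyC.
rewrite -/(shift y' _) -/(shift y _) shift_var /shift comp_mpolyD -/(shift y _).
by rewrite comp_mpolyC shift_var -addrA -mpolyCD yy' mpolyC0 addr0.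
Qed.

Lemma in_ideal_shift y p f : in_ideal p f -> in_ideal (fun i => shift y (p i)) (shift y f).
Proof.
case=> a ->; exists (fun i => shift y (a i)).
by rewrite /shift rmorph_sum; apply: eq_bigr => i _; rewrite rmorphM.
Qed.

Lemma in_loc_shift p f :
  in_loc p x f <-> in_loc (fun i => shift x (p i)) [ffun=> 0] (shift x f).
Proof.
have E g : (shift x g).@[[ffun=> 0]] = g.@[x].
  by rewrite meval_shift; apply: meval_eq => i; rewrite ffunE add0r.
split=> -[h h0 Hh].
  exists (shift x h); first by rewrite E.
  by rewrite /shift -rmorphM; apply: in_ideal_shift.
pose y i := - x i.
have yx g : shift y (shift x g) = g by apply: shiftK => i; rewrite /y addNr.
have xy g : shift x (shift y g) = g by apply: shiftK => i; rewrite /y addrN.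
exists (shift y h); first by rewrite -E xy.
have -> : shift y h * f = shift y (h * shift x f).
  by rewrite [in RHS]/shift rmorphM /= -!/(shift _ _) yx.
case: (in_ideal_shift y Hh) => a ->; exists a.
by apply: eq_bigr => i _; rewrite yx.
Qed.

Lemma has_codim_shift p m :
  has_codim (in_loc (fun i => shift x (p i)) [ffun=> 0]) m -> has_codim (in_loc p x) m.
Proof.
case=> phi [lin surj ker]; exists (fun f => phi (shift x f)); split=> [a f g|v|f].
- by rewrite /shift comp_mpolyD comp_mpolyZ lin.
- have [f <-] := surj v; exists (shift (fun i => - x i) f).
  by rewrite shiftK // => i; rewrite addrN.
by rewrite in_loc_shift; apply: ker.
Qed.

Lemma shiftX (m : 'X_{1..n}) : (forall i, m i != 0%N -> x i = 0) -> shift x 'X_[m] = 'X_[m].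
Proof.
move=> Hm; rewrite /shift comp_mpolyX [RHS]mpolyXE_id; apply: eq_bigr => i _.
rewrite tnth_mktuple; have [->|mi] := eqVneq (m i) 0%N; first by rewrite !expr0.
by rewrite Hm // mpolyC0 addr0.
Qed.

End Translation.

Lemma in_loc_ext (K : fieldType) n (p q : 'I_n -> {mpoly K[n]}) x f :
  p =1 q -> in_loc p x f <-> in_loc q x f.
Proof.
move=> pq; split; apply: in_loc_trans => i; last by rewrite -pq; apply: in_loc_gen.
by rewrite pq; apply: in_loc_gen.
Qed.

Lemma has_codim_fibre (K : fieldType) n (x : {ffun 'I_n -> K})
    (r : 'I_n -> nat) (beta : 'I_n -> 'X_{1..n}) (c : 'I_n -> K) (V : {set 'I_n}) m :
  (forall i, (i \in V) = (x i != 0)) ->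
  (forall i j, i \in V -> beta i j != 0%N -> j \in V) ->
  is_solution (binomial_system r beta c) x ->
  (\det (keep_rows V (system_matrix r beta)))%:~R != 0 :> K ->
  has_codim (in_loc (fun i => if i \in V then 'X_i else
     binomial_system r (fun i => part (~: V) (beta i)) (fibre_coef x beta c V) i)
     [ffun=> 0]) m ->
  has_codim (in_loc (binomial_system r beta c) x) m.
Proof.
move=> V_nz V_cl sol det0 H.
apply: (@has_codim_ext _ _ (in_loc (fibre_system x r beta c V) x)) => [f|].
  by apply: iff_sym; apply: fibre_systemP.
apply: has_codim_shift; apply: has_codim_ext H => f; apply: in_loc_ext => i.
rewrite /fibre_system; case: ifP => iV.
  by rewrite /shift comp_mpolyB -/(shift x _) shift_var comp_mpolyC addrK.
have x0 j : j \notin V -> x j = 0 by rewrite V_nz negbK => /eqP.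
rewrite /binomial_system /shift comp_mpolyB comp_mpolyZ -!/(shift x _).
rewrite !shiftX // => j.
  by rewrite mnmE inE; case: ifP => // jV _; apply: x0.
rewrite mulmnE mnm1E; case: (i =P j) => [<- _|//]; apply: x0.
by rewrite iV.
Qed.

(** * Deformation to the leading powers *)

Section LinearExtension.
Variables (K : fieldType) (n : nat) (M : lmodType K).
Implicit Types (f g : {mpoly K[n]}) (F : 'X_{1..n} -> M).

Definition linear_ext F f : M := \sum_(m <- msupp f) f@_m *: F m.

Lemma linear_extwE F f k : (msize f <= k)%N ->
  linear_ext F f = \sum_(m : 'X_{1..n < k}) f@_m *: F m.
Proof.
move=> le_fk; rewrite /linear_ext (big_mksub 'X_{1..n < k}) //=; first last.
- by move=> m /msize_mdeg_lt /leq_trans; apply.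
- exact: msupp_uniq.
by rewrite big_rmcond //= => m /memN_msupp_eq0 ->; rewrite scale0r.
Qed.

Lemma linear_ext_linear F : linear (linear_ext F).
Proof.
move=> a f g; pose k := maxn (msize (a *: f + g)) (maxn (msize f) (msize g)).
rewrite !(@linear_extwE F _ k) ?leq_max ?leqnn ?orbT // scaler_sumr -big_split /=.
by apply: eq_bigr => m _; rewrite mcoeffD mcoeffZ scalerDl scalerA.
Qed.

Lemma linear_extX F m : linear_ext F 'X_[m] = F m.
Proof. by rewrite /linear_ext msuppX big_seq1 mcoeffX eqxx scale1r. Qed.

Lemma linear_eq_mpoly (phi psi : {mpoly K[n]} -> M) : linear phi -> linear psi ->
  (forall m, phi 'X_[m] = psi 'X_[m]) -> phi =1 psi.
Proof.
move=> lin lin' E f.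
elim/mpolyind: f => [|a m f _ _ IH]; first by rewrite !linear0E.
by rewrite lin lin' E IH.
Qed.

End LinearExtension.

Section Deformation.
Variables (K : fieldType) (n : nat) (w : 'I_n -> nat).
Hypothesis w_gt0 : forall i, (0 < w i)%N.
Variables (N : {set 'I_n}) (d : 'I_n -> nat) (gam : 'I_n -> 'X_{1..n}) (c : 'I_n -> K).
Variables (p : 'I_n -> {mpoly K[n]}).
Hypothesis d_gt0 : forall i, (0 < d i)%N.
Hypothesis p_binomial : forall i, i \in N -> p i = binomial_system d gam c i.
Hypothesis p_indep : forall i m j, i \notin N -> m \in msupp (p i) -> j \in N -> m j = 0%N.
Hypothesis gam_heavy : forall i, i \in N -> (d i * w i < wt w (gam i))%N.
Implicit Types (f g : {mpoly K[n]}).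

Let q i : {mpoly K[n]} := if i \in N then 'X_i ^+ d i else p i.

Let leading g m := wt_ge w (wt w m).+1 (g - 'X_[m]).

Lemma leading_wt_ge g m : leading g m -> wt_ge w (wt w m) g.
Proof.
by move=> H; rewrite -(subrK 'X_[m] g); apply: wt_geD; [apply: wt_ge_mono H|apply: wt_geX].
Qed.

Lemma leadingM g g' m m' :
  leading g m -> leading g' m' -> leading (g * g') (m + m')%MM.
Proof.
move=> H H'; rewrite /leading mpolyXD wtD.
have -> : g * g' - 'X_[m] * 'X_[m'] = (g - 'X_[m]) * g' + 'X_[m] * (g' - 'X_[m']) by ring.
apply: wt_geD; first by rewrite -addSn; apply: wt_geM => //; apply: leading_wt_ge.
by rewrite -addnS; apply: wt_geM => //; apply: wt_geX.
Qed.

Lemma leadingX m : leading 'X_[m] m.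
Proof. by rewrite /leading subrr; apply: wt_ge0. Qed.

(* Deforming X_i^d_i into p_i for i in N changes only terms of higher weight. *)
Definition deform_mon (m : 'X_{1..n}) : {mpoly K[n]} :=
  'X_[[multinom if i \in N then (m i %% d i)%N else m i | i < n]] *
  \prod_(i in N) p i ^+ (m i %/ d i).

Lemma leading_deform_mon m : leading (deform_mon m) m.
Proof.
rewrite /deform_mon; set m0 := [multinom _ | _ < n].
have {2}-> : m = (m0 + \sum_(i in N) U_(i) *+ d i *+ (m i %/ d i))%MM.
  apply/mnmP => j; rewrite mnmDE mnm_sumE mnmE.
  case: ifP => jN; last first.
    rewrite big1 ?addn0 // => i iN; rewrite !mulmnE mnm1E.
    by case: eqP => // E; rewrite -E iN in jN.
  rewrite (bigD1 j) //= !mulmnE mnm1E eqxx mul1n big1 ?addn0 => [|i /andP[_ /negbTE ne]].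
    by rewrite addnC mulnC -divn_eq.
  by rewrite !mulmnE mnm1E ne.
apply: leadingM; first exact: leadingX.
apply: (big_ind2 leading) => [|g m1 g' m2|i iN].
- by rewrite -mpolyX0; apply: leadingX.
- exact: leadingM.
elim: (m i %/ d i)%N => [|e IH]; first by rewrite expr0 mulm0n -mpolyX0; apply: leadingX.
rewrite exprS mulmS; apply: leadingM => //.
rewrite p_binomial // /binomial_system /leading addrAC subrr sub0r.
apply: wt_geN; apply: wt_geZ; apply: wt_geX; apply: leq_trans (gam_heavy iN).
rewrite ltnS /wt (bigD1 i) //= big1 ?addn0 => [|j].
  by rewrite mulmnE mnm1E eqxx mul1n mulnC.
by rewrite mulmnE mnm1E eq_sym => /negbTE ->; rewrite muln0.
Qed.

Definition deform : {mpoly K[n]} -> {mpoly K[n]} := linear_ext deform_mon.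

Lemma deform_linear : linear deform. Proof. exact: linear_ext_linear. Qed.

Lemma linear_mpolyE (h : {mpoly K[n]} -> {mpoly K[n]}) : linear h ->
  [/\ h 0 = 0, forall f g, h (f + g) = h f + h g & forall a f, h (a *: f) = a *: h f].
Proof.
move=> lin; have h0 := linear0E lin; split=> // [f g|a f].
  by rewrite -[f]scale1r lin !scale1r.
by rewrite -[a *: f]addr0 lin h0 addr0.
Qed.

Lemma deform_shift (h h' : {mpoly K[n]}) :
  (forall m, deform (h * 'X_[m]) = h' * deform 'X_[m]) ->
  forall f, deform (h * f) = h' * deform f.
Proof.
have [_ TD TZ] := linear_mpolyE deform_linear.
move=> E; apply: linear_eq_mpoly => // a f g.
  by rewrite mulrDr -scalerAr TD TZ.
by rewrite TD TZ mulrDr -scalerAr.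
Qed.

(** The factor [X_i ^ d_i] raises the quotient [m i %/ d i] by one and keeps the remainder. *)
Lemma deform_mulX i f : i \in N -> deform ('X_i ^+ d i * f) = p i * deform f.
Proof.
move=> iN; apply: deform_shift => m.
rewrite mpolyXn -mpolyXD /deform !linear_extX /deform_mon mulrCA.
congr (_ * _).
  congr 'X_[_]; apply/mnmP => j; rewrite [LHS]mnmE [RHS]mnmE mnmDE mulmnE mnm1E.
  have [Eij|_] := i =P j; last by rewrite mul0n add0n.
  by rewrite -Eij iN mul1n modnDl.
rewrite (bigD1 i) //= [in RHS](bigD1 i) //= mulrA; congr (_ * _).
  by rewrite -exprS mnmDE mulmnE mnm1E eqxx mul1n divnDl // divnn d_gt0.
apply: eq_bigr => j /andP[_ ne_ji].
by rewrite mnmDE mulmnE mnm1E eq_sym (negbTE ne_ji) mul0n add0n.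
Qed.

(** Such a [p i] has no variable of [N], and [deform_mon] leaves the exponents of the other
    variables alone. *)
Lemma deform_mulp i f : i \notin N -> deform (p i * f) = p i * deform f.
Proof.
move=> iN; have [T0 TD TZ] := linear_mpolyE deform_linear.
suff H (s : seq 'X_{1..n}) : {subset s <= msupp (p i)} ->
    deform ((\sum_(m <- s) (p i)@_m *: 'X_[m]) * f) =
    (\sum_(m <- s) (p i)@_m *: 'X_[m]) * deform f.
  by have := H _ (fun _ => id); rewrite -mpolyE.
elim: s => [|l s IH] sub; first by rewrite !big_nil !mul0r T0.
rewrite !big_cons !mulrDl TD IH => [|m ms]; last by apply: sub; rewrite inE ms orbT.
congr (_ + _); rewrite -!scalerAl TZ; congr (_ *: _).
have l0 j : j \in N -> l j = 0%N by apply: p_indep iN _; apply: sub; rewrite inE eqxx.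
apply: deform_shift => m; rewrite -mpolyXD /deform !linear_extX /deform_mon mulrA -mpolyXD.
congr ('X_[_] * _).
  by apply/mnmP => j; rewrite !mnmE; case: ifP => // jN; rewrite l0.
by apply: eq_bigr => j jN; rewrite mnmDE l0.
Qed.

Definition defect f := f - deform f.

Lemma defect_linear : linear defect.
Proof.
by move=> a f g; rewrite /defect deform_linear opprD scalerBr addrACA.
Qed.

Lemma defect_wt_ge W f : wt_ge w W f -> wt_ge w W.+1 (defect f).
Proof.
have [U0 UD UZ] := linear_mpolyE defect_linear.
elim/wt_ge_ind => [|f1 f2 H1 H2|a g H|m le_m].
- by rewrite U0; apply: wt_ge0.
- by rewrite UD; apply: wt_geD.
- by rewrite UZ; apply: wt_geZ.
rewrite /defect /deform linear_extX -opprB; apply: wt_geN.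
have H := @leading_deform_mon m; rewrite /leading in H.
by apply: wt_ge_mono H; rewrite ltnS.
Qed.

Lemma iter_defect_linear t : linear (iter t defect).
Proof. by elim: t => [|t IH] a f g //=; rewrite IH defect_linear. Qed.

Lemma iter_defect_wt_ge t W f : wt_ge w W f -> wt_ge w (W + t) (iter t defect f).
Proof. by move=> H; elim: t => [|t IH]; rewrite ?addn0 // addnS; apply: defect_wt_ge. Qed.

(* Truncated inverse of deform = 1 - defect. *)
Definition deform_inv W f := \sum_(t < W) iter t defect f.

Lemma deform_inv_linear W : linear (deform_inv W).
Proof.
move=> a f g; rewrite /deform_inv scaler_sumr -big_split; apply: eq_bigr => t _.
exact: iter_defect_linear.
Qed.

Lemma deform_inv_wt_ge W W' f : wt_ge w W' f -> wt_ge w W' (deform_inv W f).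
Proof.
move=> H; apply: wt_ge_sum => t _; apply: wt_ge_mono (@iter_defect_wt_ge t _ _ H).
exact: leq_addr.
Qed.

Lemma deform_deform_inv W f : deform (deform_inv W f) = f - iter W defect f.
Proof.
have [T0 TD TZ] := linear_mpolyE deform_linear.
have TB g : deform g = g - defect g by rewrite /defect opprB addrC subrK.
elim: W => [|W IH]; first by rewrite /deform_inv big_ord0 T0 subrr.
by rewrite /deform_inv big_ord_recr /= TD -/(deform_inv W f) IH TB /=; ring.
Qed.

Lemma iter_defect_deform W f : iter W defect (deform f) = deform (iter W defect f).
Proof.
have [_ UD UZ] := linear_mpolyE defect_linear.
have UTU g : defect (deform g) = deform (defect g).
  have [T0 TD TZ] := linear_mpolyE deform_linear.
  by rewrite /defect TD -[- deform g]scaleN1r TZ scaleN1r.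
by elim: W => //= W ->.
Qed.

Lemma deform_invK W f : deform_inv W (deform f) = f - iter W defect f.
Proof.
rewrite -deform_deform_inv /deform_inv; have [T0 TD TZ] := linear_mpolyE deform_linear.
rewrite (big_morph deform TD T0); apply: eq_bigr => t _; exact: iter_defect_deform.
Qed.

Lemma hi_iter_defect W f : wt_ge w W (iter W defect f).
Proof. by rewrite -[W in wt_ge _ W]add0n; apply: iter_defect_wt_ge. Qed.

Variable W : nat.
Hypothesis p_nilp : forall m, (W <= wt w m)%N -> in_loc p [ffun=> 0] 'X_[m].
Hypothesis q_nilp : forall m, (W <= wt w m)%N -> in_loc q [ffun=> 0] 'X_[m].

Lemma wt_ge_in_loc p' f : (forall m, (W <= wt w m)%N -> in_loc p' [ffun=> 0] 'X_[m]) ->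
  wt_ge w W f -> in_loc p' [ffun=> 0] f.
Proof.
move=> H hf; apply: (in_trunc_loc H); exact: in_trunc_wt_ge.
Qed.

(** Although [deform] is not multiplicative, this suffices for it to carry the ideal of [q] into
    that of [p]. *)
Lemma deform_mul_q i f : deform (q i * f) = p i * deform f.
Proof. by rewrite /q; case: ifP => iN; [apply: deform_mulX|apply: deform_mulp; rewrite iN]. Qed.

(** Composition with the truncated inverse of [deform] exchanges the two ideals up to terms of
    weight at least [W], and these are zero in both local rings. *)
Lemma has_codim_deformation m : has_codim (in_loc q [ffun=> 0]) m ->
  has_codim (in_loc p [ffun=> 0]) m.
Proof.
have [T0 TD TZ] := linear_mpolyE deform_linear.
have [S0 SD SZ] := linear_mpolyE (deform_inv_linear W).
have SN f : deform_inv W (- f) = - deform_inv W f by rewrite -scaleN1r SZ scaleN1r.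
case=> phi [lin surj ker]; exists (fun f => phi (deform_inv W f)); split=> [a f g|v|f].
- by rewrite deform_inv_linear lin.
- have [g <-] := surj v; exists (deform g); rewrite deform_invK.
  apply/(linear_kereq lin _ _ ker); rewrite addrAC subrr sub0r.
  by apply: in_locN; apply: wt_ge_in_loc q_nilp _; apply: hi_iter_defect.
rewrite ker; split=> H.
  have [g [a Eg] Hg] := in_loc_trunc w_gt0 W H.
  have Ef : f = \sum_i p i * deform (a i) + (deform (deform_inv W f - g) + iter W defect f).
    rewrite addrA -[LHS](subrK (iter W defect f)); congr (_ + _).
    rewrite -deform_deform_inv -[in LHS](subrK g (deform_inv W f)) TD addrC; congr (_ + _).
    rewrite Eg (big_morph deform TD T0); apply: eq_bigr => i _.
    by rewrite mulrC deform_mul_q.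
  rewrite Ef; apply: in_locD.
    apply: in_loc_sum => i _; rewrite mulrC; apply: in_locM; exact: in_loc_gen.
  apply: (wt_ge_in_loc p_nilp); apply: wt_geD; last exact: hi_iter_defect.
  set u := deform_inv W f - g in Hg *; rewrite -[deform u](_ : u - defect u = _).
    by apply: wt_geB => //; apply: wt_ge_mono (@defect_wt_ge _ _ Hg).
  by rewrite /defect opprB addrC subrK.
have [g [a Eg] Hg] := in_loc_trunc w_gt0 W H.
rewrite -(subrK g f) addrC SD; apply: in_locD; last first.
  by apply: (wt_ge_in_loc q_nilp); apply: deform_inv_wt_ge.
rewrite Eg (big_morph (deform_inv W) SD S0); apply: in_loc_sum => i _.
have -> : a i * p i = deform (q i * deform_inv W (a i)) + iter W defect (a i) * p i.
  by rewrite deform_mul_q deform_deform_inv; ring.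
rewrite SD deform_invK; apply: in_locD; last first.
  by apply: (wt_ge_in_loc q_nilp); apply: deform_inv_wt_ge; rewrite mulrC;
    apply: wt_geMl; apply: hi_iter_defect.
apply: in_locB; first by rewrite mulrC; apply: in_locM; apply: in_loc_gen.
by apply: (wt_ge_in_loc q_nilp); apply: hi_iter_defect.
Qed.

End Deformation.

(** * Weights and nilpotency by reachability *)

Section Reach.
Variables (n : nat) (N : {set 'I_n}) (gam : 'I_n -> 'X_{1..n}).
Hypothesis reach : forall Y : {set 'I_n}, ~: N \subset Y -> Y != setT ->
  exists i j, [/\ i \notin Y, j \in Y & gam i j != 0%N].

Lemma reach_ind (P : {set 'I_n} -> Prop) : P (~: N) ->
  (forall Y i j, P Y -> i \in N -> i \notin Y -> j \in Y -> gam i j != 0%N -> P (i |: Y)) ->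
  P setT.
Proof.
move=> P0 PS; suff H q (Y : {set 'I_n}) : (#|~: Y| <= q)%N -> ~: N \subset Y -> P Y -> P setT.
  by apply: (H _ (~: N)).
elim: q Y => [|q IH] Y le_q NY PY.
  have [<- //|/(reach NY)[i [j [iY _ _]]]] := eqVneq Y setT.
  by move: le_q; rewrite leqn0 cards_eq0 => /eqP/setP/(_ i); rewrite !inE iY.
have [<- //|/(reach NY)[i [j [iY jY gij]]]] := eqVneq Y setT.
have iN : i \in N by apply: contraNT iY => iN; apply: (subsetP NY); rewrite inE.
apply: (IH (i |: Y)); last exact: PS gij.
  rewrite setCU setIC -setDE; have := cardsD1 i (~: Y).
  by rewrite inE iY => E; rewrite -ltnS (leq_trans _ le_q) // E.
by apply: subset_trans NY _; apply: subsetUr.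
Qed.

(** When [i] is reached, it gets weight 1 and all other weights are multiplied by [M], larger than
    every [d l]. A variable of [Y] in [gam i] then outweighs [d i], and the earlier inequalities are
    only scaled. *)
Lemma heavy_weights (d : 'I_n -> nat) :
  exists w : 'I_n -> nat, (forall i, (0 < w i)%N) /\
    forall i, i \in N -> (d i * w i < wt w (gam i))%N.
Proof.
pose P (Y : {set 'I_n}) := exists w : 'I_n -> nat, (forall i, (0 < w i)%N) /\
  forall i, i \in N -> i \in Y -> (d i * w i < \sum_(j in Y) w j * gam i j)%N.
suff [w [w0 Hw]] : P setT.
  exists w; split=> // i iN; have := Hw i iN (in_setT _).
  by under eq_bigl do rewrite in_setT.
apply: reach_ind => [|Y i j [w [w0 Hw]] iN iY jY gij].
  by exists (fun=> 1%N); split=> // i iN; rewrite inE iN.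
pose M := (\sum_i d i).+1.
have M_gt l : (d l < M)%N by rewrite ltnS (bigD1 l) //= leq_addr.
exists (fun l => if l == i then 1 else M * w l)%N; split=> [l|l lN].
  by case: ifP => //; rewrite muln_gt0 w0.
have Msum : (M * (\sum_(j in Y) w j * gam l j) <=
    \sum_(j in i |: Y) (if j == i then 1 else M * w j) * gam l j)%N.
  rewrite big_setU1 //= big_distrr /=; apply: leq_trans (leq_addl _ _).
  apply: leq_sum => m mY; have [E|_] := m =P i; last by rewrite mulnA.
  by rewrite -E mY in iY.
case: eqVneq => [->|ne_li] => [_|].
  rewrite muln1; apply: leq_trans (M_gt i) _.
  rewrite big_setU1 //= (bigD1 j) //=.
  have [E|_] := j =P i; first by rewrite -E jY in iY.
  apply: leq_trans (leq_addl _ _); apply: leq_trans (leq_addr _ _).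
  by rewrite -mulnA leq_pmulr // muln_gt0 w0 lt0n.
rewrite !inE (negbTE ne_li) /= => lY; apply: leq_trans Msum.
by rewrite mulnCA ltn_mul2l Hw.
Qed.

End Reach.

Section Nilpotency.
Variables (K : fieldType) (n : nat) (x : {ffun 'I_n -> K}).
Implicit Types (p : 'I_n -> {mpoly K[n]}) (f g : {mpoly K[n]}).

Definition loc_nilp p f := exists a, in_loc p x (f ^+ a).

Lemma loc_nilp_congr p f g : in_loc p x (f - g) -> loc_nilp p g -> loc_nilp p f.
Proof.
move=> fg [a ga]; exists a; rewrite -(subrK (g ^+ a) (f ^+ a)).
by apply: in_locD => //; rewrite subrXX mulrC; apply: in_locM.
Qed.

Lemma loc_nilpM p f g : loc_nilp p f -> loc_nilp p (g * f).
Proof. by case=> a fa; exists a; rewrite exprMn; apply: in_locM. Qed.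

Lemma loc_nilpX p f d : loc_nilp p (f ^+ d) -> loc_nilp p f.
Proof. by case=> a fa; exists (d * a)%N; rewrite exprM. Qed.

Lemma loc_nilp_all p : (forall i, loc_nilp p 'X_i) ->
  exists a, forall i, in_loc p x ('X_i ^+ a).
Proof.
case/fin_all_exists => a Ha; exists (\sum_i a i)%N => i.
by rewrite (bigD1 i) //= addnC exprD; apply: in_locM.
Qed.

(** [X_i ^ d_i] is congruent to a multiple of a variable already known to be nilpotent. *)
Lemma loc_nilp_reach (N : {set 'I_n}) (d : 'I_n -> nat)
    (gam : 'I_n -> 'X_{1..n}) (c : 'I_n -> K) p :
  (forall Y : {set 'I_n}, ~: N \subset Y -> Y != setT ->
     exists i j, [/\ i \notin Y, j \in Y & gam i j != 0%N]) ->
  (forall i, i \in N -> p i = binomial_system d gam c i) ->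
  (forall i, i \notin N -> loc_nilp p 'X_i) -> forall i, loc_nilp p 'X_i.
Proof.
move=> reach Hp nilp i; move: i (in_setT i).
apply: (reach_ind reach (P := fun Y => forall i, i \in Y -> loc_nilp p 'X_i)) => [i|].
  by rewrite inE; apply: nilp.
move=> Y i j HY iN iY jY gij l; rewrite !inE => /orP[/eqP ->|]; last exact: HY.
apply: (@loc_nilpX _ _ (d i)); apply: (@loc_nilp_congr _ _ (c i *: 'X_[gam i])).
  by have := in_loc_gen p x i; rewrite Hp // /binomial_system mpolyXn.
have -> : gam i = (gam i - U_(j) + U_(j))%MM.
  by rewrite submK //; apply/mnm_lepP => m; rewrite mnm1E; case: (j =P m) => // <-; rewrite lt0n.
by rewrite -mul_mpolyC mpolyXD mulrA; apply: loc_nilpM; apply: HY.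
Qed.

End Nilpotency.

(** The monomials with all [m i < d i], indexed by [B], are a basis of the quotient; [J f] says that
    none of them occurs in [f]. *)
Lemma has_codim_monomial (K : fieldType) n (d : 'I_n -> nat) :
  has_codim (in_loc (fun i => 'X_i ^+ d i : {mpoly K[n]}) [ffun=> 0]) (\prod_i d i).
Proof.
pose p i : {mpoly K[n]} := 'X_i ^+ d i; rewrite -/p.
pose B := {dffun forall i : 'I_n, 'I_(d i)}.
have cardB : #|{: B}| = (\prod_i d i)%N.
  by rewrite card_dep_ffun foldrE big_map big_enum /=; apply: eq_bigr => i _; rewrite card_ord.
rewrite -cardB; pose mon (t : B) : 'X_{1..n} := [multinom (t i : nat) | i < n].
pose J (f : {mpoly K[n]}) := forall m : 'X_{1..n}, (forall i, (m i < d i)%N) -> f@_m = 0.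
have JI f : J f <-> in_loc p [ffun=> 0] f.
  split=> [Jf|]; last first.
    move/(in_loc_trunc (w := fun=> 1%N) (fun=> isT) (\sum_i d i).+1).
    case=> g [a ->] Hf m lt_m; rewrite -(subrK (\sum_i a i * p i) f) mcoeffD Hf ?add0r.
      rewrite raddf_sum big1 //= => i _; rewrite mcoeffM big1 // => -[k1 k2] /= /eqP Em.
      rewrite /p mcoeffXn; case: eqP => [E|]; last by rewrite mulr0.
      have Ei : m i = (k1 i + d i)%N by rewrite [in LHS]Em mnmDE -E mulmnE mnm1E eqxx mul1n.
      by have := lt_m i; rewrite Ei ltnNge leq_addl.
    by rewrite wt1E mdegE ltnS leq_sum // => i _; rewrite ltnW.
  rewrite [f]mpolyE big_seq; apply: in_loc_sum => m fm; apply: in_locZ.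
  have [i le_i] : exists i, (d i <= m i)%N.
    apply/existsP; apply: contraTT fm; rewrite negb_exists => /forallP H.
    by rewrite mcoeff_msupp negbK Jf // => i; rewrite ltnNge.
  have -> : m = (m - U_(i) *+ d i + U_(i) *+ d i)%MM.
    rewrite submK //; apply/mnm_lepP => j; rewrite mulmnE mnm1E.
    by case: (i =P j) => [<-|_]; rewrite ?mul1n ?mul0n.
  by rewrite mpolyXD -mpolyXn; apply: in_locM; apply: (in_loc_gen p).
exists (fun f => \row_j f@_(mon (enum_val j))); split=> [a f g|v|f].
- by apply/rowP => j; rewrite !mxE mcoeffD mcoeffZ.
- exists (\sum_j v 0 j *: 'X_[mon (enum_val j)]); apply/rowP => j.
  rewrite mxE raddf_sum (bigD1 j) //= mcoeffZ mcoeffX eqxx mulr1.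
  rewrite big1 ?addr0 // => i ne_ij; rewrite mcoeffZ mcoeffX.
  case: eqP => [/mnmP E|_]; last by rewrite mulr0.
  case/eqP: ne_ij; apply: enum_val_inj; apply/ffunP => l; apply: val_inj.
  by have := E l; rewrite !mnmE.
rewrite -JI; split=> [/rowP H m lt_m|Jf].
  pose t : B := [ffun i => Ordinal (lt_m i)].
  have := H (enum_rank t); rewrite !mxE enum_rankK => <-; congr (f@__).
  by apply/mnmP => i; rewrite mnmE ffunE.
by apply/rowP => j; rewrite !mxE Jf // => i; rewrite mnmE ltn_ord.
Qed.

(** * Systems in separated variables *)

Section Product.
Variables (K : fieldType) (n : nat) (A : {set 'I_n}).
Implicit Types (f : {mpoly K[n]}).

Definition embed : {mpoly K[#|A|]} -> {mpoly K[n]} :=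
  comp_mpoly [tuple 'X_(enum_val i) | i < #|A|].

(** [kill f = f] expresses that no variable of [A] occurs in [f]. *)
Definition kill : {mpoly K[n]} -> {mpoly K[n]} :=
  comp_mpoly [tuple if i \in A then 0 else 'X_i | i < n].

Definition sub_mon (m : 'X_{1..n}) : 'X_{1..#|A|} := [multinom m (enum_val j) | j < #|A|].

Definition emb_mon (l : 'X_{1..#|A|}) : 'X_{1..n} := (\sum_j U_(enum_val j) *+ l j)%MM.

Lemma embedX l : embed 'X_[l] = 'X_[emb_mon l].
Proof.
rewrite /embed comp_mpolyX /emb_mon -mprodXE.
by apply: eq_bigr => j _; rewrite tnth_mktuple mpolyXn.
Qed.

Lemma emb_monE l (j : 'I_#|A|) : emb_mon l (enum_val j) = l j.
Proof.
rewrite mnm_sumE (bigD1 j) //= mulmnE mnm1E eqxx mul1n big1 ?addn0 // => i ne_ij.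
by rewrite mulmnE mnm1E (inj_eq enum_val_inj) (negbTE ne_ij).
Qed.

Lemma emb_mon_out l i : i \notin A -> emb_mon l i = 0%N.
Proof.
move=> iA; rewrite mnm_sumE big1 // => j _; rewrite mulmnE mnm1E.
by case: eqP => // E; rewrite -E enum_valP in iA.
Qed.

Lemma emb_sub_mon m : emb_mon (sub_mon m) = part A m.
Proof.
apply/mnmP => i; rewrite [RHS]mnmE; case: ifP => iA; last by rewrite emb_mon_out ?iA.
by rewrite -(enum_rankK_in iA iA) emb_monE mnmE.
Qed.

Lemma killX m : kill 'X_[m] = if sub_mon m == 0%MM then 'X_[m] else 0.
Proof.
rewrite /kill comp_mpolyX; case: eqP => [E|E].
  rewrite [RHS]mpolyXE_id; apply: eq_bigr => i _; rewrite tnth_mktuple.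
  case: ifP => // iA; have -> : m i = 0%N.
    by move/mnmP/(_ (enum_rank_in iA i)): E; rewrite mnmE mnm0E enum_rankK_in.
  by rewrite !expr0.
have [j mj] : exists j : 'I_#|A|, m (enum_val j) != 0%N.
  apply/existsP; apply: contra_notT E; rewrite negb_exists => /forallP H.
  by apply/mnmP => j; rewrite mnmE mnm0E; apply/eqP; have := H j; rewrite negbK.
by rewrite (bigD1 (enum_val j)) //= tnth_mktuple enum_valP expr0n (negbTE mj) mul0r.
Qed.

Lemma kill_linear : linear kill.
Proof. by move=> a f g; rewrite /kill comp_mpolyD comp_mpolyZ. Qed.

Lemma embed_linear : linear embed.
Proof. by move=> a f g; rewrite /embed comp_mpolyD comp_mpolyZ. Qed.

Lemma kill_idem f : kill (kill f) = kill f.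
Proof.
apply: (linear_eq_mpoly (phi := fun f => kill (kill f)) _ kill_linear) => [a g h|m].
  by rewrite !kill_linear.
by rewrite !killX; case: ifP => E; rewrite ?killX ?E // /kill comp_mpoly0.
Qed.

Lemma meval_kill0 f : (kill f).@[[ffun=> 0]] = f.@[[ffun=> 0]].
Proof.
rewrite comp_mpoly_meval; apply: meval_eq => i; rewrite tnth_mktuple ffunE.
by case: ifP => _; rewrite ?meval0 // mevalXU ffunE.
Qed.

Lemma meval_embed0 (f : {mpoly K[#|A|]}) : (embed f).@[[ffun=> 0]] = f.@[[ffun=> 0]].
Proof.
rewrite comp_mpoly_meval; apply: meval_eq => i.
by rewrite tnth_mktuple mevalXU !ffunE.
Qed.

Lemma mon_split m : 'X_[m] = embed 'X_[sub_mon m] * 'X_[part (~: A) m].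
Proof. by rewrite embedX emb_sub_mon -mpolyXD -partE. Qed.

Lemma sub_mon_emb l m : sub_mon m = 0%MM -> sub_mon (emb_mon l + m)%MM = l.
Proof.
move/mnmP => m0; apply/mnmP => j; rewrite [LHS]mnmE mnmDE emb_monE.
by have := m0 j; rewrite [X in X = _]mnmE mnm0E => ->; rewrite addn0.
Qed.

Lemma sub_mon_part m : sub_mon (part (~: A) m) = 0%MM.
Proof. by apply/mnmP => j; rewrite !mnmE inE enum_valP. Qed.

Lemma sub_mon0E m : sub_mon m = 0%MM -> part (~: A) m = m.
Proof.
move=> m0; rewrite [RHS](partE A m) -emb_sub_mon m0 /emb_mon big1 ?add0m // => j _.
by rewrite mnm0E mulm0n.
Qed.

Lemma part_emb l m : sub_mon m = 0%MM -> part (~: A) (emb_mon l + m)%MM = m.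
Proof.
move=> m0; rewrite -[RHS]sub_mon0E //; apply/mnmP => i; rewrite [LHS]mnmE [RHS]mnmE inE mnmDE.
by case: ifP => // iA; rewrite emb_mon_out ?add0n.
Qed.

Lemma mdeg_split m : mdeg m = (mdeg (sub_mon m) + mdeg (part (~: A) m))%N.
Proof.
rewrite {1}(partE A m) mdegD; congr (_ + _)%N; rewrite -emb_sub_mon mdeg_sum.
by rewrite mdegE; apply: eq_bigr => j _; rewrite mdegMn mdeg1 mul1n.
Qed.

Variables (g : 'I_#|A| -> {mpoly K[#|A|]}) (q p : 'I_n -> {mpoly K[n]}).
Hypothesis p_in : forall j, p (enum_val j) = embed (g j).
Hypothesis p_out : forall i, i \notin A -> p i = q i.
Hypothesis q_in : forall i, i \in A -> q i = 'X_i.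
Hypothesis q_out : forall i, i \notin A -> kill (q i) = q i.

Lemma in_loc_embed (f : {mpoly K[#|A|]}) :
  in_loc g [ffun=> 0] f -> in_loc p [ffun=> 0] (embed f).
Proof.
case=> h h0 [a Ea]; apply: (@in_loc_cancel _ _ _ _ (embed h)).
  by rewrite meval_embed0.
rewrite /embed -rmorphM /= Ea rmorph_sum; apply: in_loc_sum => j _ /=.
by rewrite rmorphM /= -/(embed (g j)) -p_in; apply: in_locM; apply: in_loc_gen.
Qed.

Lemma in_loc_kill f : kill f = f -> in_loc q [ffun=> 0] f -> in_loc p [ffun=> 0] f.
Proof.
move=> kf [h h0 [a Ea]]; apply: (@in_loc_cancel _ _ _ _ (kill h)).
  by rewrite meval_kill0.
have -> : kill h * f = \sum_i kill (a i) * kill (q i).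
  rewrite -{1}kf /kill -rmorphM /= Ea rmorph_sum.
  by apply: eq_bigr => i _; rewrite rmorphM.
apply: in_loc_sum => i _; apply: in_locM.
have [iA|iA] := boolP (i \in A); last by rewrite q_out // -p_out //; apply: in_loc_gen.
by rewrite q_in // /kill comp_mpolyXU -tnth_nth tnth_mktuple iA; apply: in_loc0.
Qed.

Lemma in_loc_sub_kill f : in_loc q [ffun=> 0] (f - kill f).
Proof.
elim/mpolyind: f => [|a m f _ _ IH].
  by rewrite /kill comp_mpoly0 subrr; apply: in_loc0.
rewrite kill_linear opprD addrACA -scalerBr; apply: in_locD => //; apply: in_locZ.
rewrite killX; case: eqP => [_|E]; first by rewrite subrr; apply: in_loc0.
have [j mj] : exists j : 'I_#|A|, m (enum_val j) != 0%N.
  apply/existsP; apply: contra_notT E; rewrite negb_exists => /forallP H.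
  by apply/mnmP => j; rewrite mnmE mnm0E; apply/eqP; have := H j; rewrite negbK.
rewrite subr0 (_ : m = (m - U_(enum_val j) + U_(enum_val j))%MM); last first.
  rewrite submK //; apply/mnm_lepP => i; rewrite mnm1E.
  by case: (enum_val j =P i) => // <-; rewrite lt0n.
rewrite mpolyXD; apply: in_locM; rewrite -q_in ?enum_valP //; exact: in_loc_gen.
Qed.

(** The quotient is a tensor product, realized by matrices: [Phi] sends a monomial to the column of
    its part in [A] times the row of its other part. [Phi] vanishes on the local kernel, and every
    [f] is congruent to [E (Phi f)], so that this kernel is the whole kernel of [Phi]. *)
Lemma has_codim_product m1 m2 : has_codim (in_loc g [ffun=> 0]) m1 ->
  has_codim (in_loc q [ffun=> 0]) m2 -> has_codim (in_loc p [ffun=> 0]) (m1 * m2).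
Proof.
move=> H1 H2; have nilp1 := codim_nilpotent H1; have nilp2 := codim_nilpotent H2.
case: H1 => phi1 [lin1 surj1 ker1]; case: H2 => phi2 [lin2 surj2 ker2].
pose F m := mxvec ((phi1 'X_[sub_mon m])^T *m phi2 'X_[part (~: A) m]).
pose Phi : {mpoly K[n]} -> 'rV[K]_(m1 * m2) := linear_ext F.
have PhiL : linear Phi by apply: linear_ext_linear.
have PhiM (f1 : {mpoly K[#|A|]}) f2 : kill f2 = f2 ->
    Phi (embed f1 * f2) = mxvec ((phi1 f1)^T *m phi2 f2).
  move=> <-; move: f2; apply: linear_eq_mpoly => [a f f'|a f f'|m].
  - by rewrite kill_linear mulrDr -scalerAr PhiL.
  - by rewrite kill_linear lin2 mulmxDr -scalemxAr linearP.
  rewrite killX; case: eqP => [m0|_]; last first.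
    by rewrite mulr0 !linear0E // mulmx0 linear0.
  move: f1; apply: linear_eq_mpoly => [a f f'|a f f'|l].
  - by rewrite embed_linear mulrDl -scalerAl PhiL.
  - by rewrite lin1 linearP mulmxDl -scalemxAl linearP.
  by rewrite embedX -mpolyXD /Phi linear_extX /F sub_mon_emb // part_emb.
have Phi0 f : in_loc p [ffun=> 0] f -> Phi f = 0.
  (* In a monomial of degree at least [W], one of the two parts is large enough to be killed by
     [phi1] or [phi2]. *)
  pose W := (m1 * #|A| + m2 * n).+1.
  move/(in_loc_trunc (w := fun=> 1%N) (fun=> isT) W) => [h [a Eh] Hh].
  have Phi_wt_ge u : wt_ge (fun=> 1%N) W u -> Phi u = 0.
    elim/wt_ge_ind => [|v v' E E'|b v E|m]; first exact: linear0E.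
    - by rewrite -[v]scale1r PhiL E E' scaler0 addr0.
    - by rewrite -[b *: v]addr0 PhiL E scaler0 linear0E // addr0.
    rewrite wt1E mdeg_split => lt_m; rewrite /Phi linear_extX /F.
    have [lt1|le1] := ltnP (m1 * #|A|) (mdeg (sub_mon m)).
      have /ker1 -> : in_loc g [ffun=> 0] 'X_[sub_mon m].
        apply: (nilp_wt_ge (w := fun=> 1%N) nilp1 (W := mdeg (sub_mon m))).
          by rewrite sum_w1.
        by rewrite wt1E.
      by rewrite trmx0 mul0mx linear0.
    have lt2 : (m2 * n < mdeg (part (~: A) m))%N.
      by rewrite -(ltn_add2l (m1 * #|A|)) (leq_trans lt_m) // leq_add2r.
    have /ker2 -> : in_loc q [ffun=> 0] 'X_[part (~: A) m].
      apply: (nilp_wt_ge (w := fun=> 1%N) nilp2 (W := mdeg (part (~: A) m))).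
        by rewrite sum_w1.
      by rewrite wt1E.
    by rewrite mulmx0 linear0.
  rewrite -(subrK h f) -[f - h]scale1r PhiL Phi_wt_ge // scaler0 add0r Eh.
  have PhiS (I : Type) (s : seq I) (G : I -> {mpoly K[n]}) :
      (forall i, Phi (G i) = 0) -> Phi (\sum_(i <- s) G i) = 0.
    move=> HG; elim: s => [|i s IH]; first by rewrite big_nil linear0E.
    by rewrite big_cons -[G i]scale1r PhiL HG IH scaler0 addr0.
  apply: (PhiS) => i; rewrite [a i]mpolyE mulr_suml; apply: (PhiS) => m.
  rewrite -scalerAl -[_ *: _]addr0 PhiL linear0E // addr0.
  suff -> : Phi ('X_[m] * p i) = 0 by rewrite scaler0.
  have kp : kill 'X_[part (~: A) m] = 'X_[part (~: A) m] by rewrite killX sub_mon_part eqxx.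
  have [iA|iA] := boolP (i \in A).
    pose j := enum_rank_in iA i; have Ei : enum_val j = i by rewrite enum_rankK_in.
    rewrite mon_split mulrAC -Ei p_in /embed -rmorphM /= -/(embed _) PhiM //.
    have /ker1 -> : in_loc g [ffun=> 0] ('X_[sub_mon m] * g j).
      by apply: in_locM; apply: in_loc_gen.
    by rewrite trmx0 mul0mx linear0.
  rewrite mon_split -mulrA p_out // PhiM; last first.
    by rewrite /kill rmorphM /= -!/(kill _) kp q_out.
  have /ker2 -> : in_loc q [ffun=> 0] ('X_[part (~: A) m] * q i).
    by apply: in_locM; apply: in_loc_gen.
  by rewrite mulmx0 linear0.
have /fin_all_exists[e1 He1] : forall a : 'I_m1, exists h, phi1 h = delta_mx 0 a.
  by move=> a; apply: surj1.
have /fin_all_exists[e2 He2] : forall b : 'I_m2, exists f, kill f = f /\ phi2 f = delta_mx 0 b.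
  move=> b; have [f Hf] := surj2 (delta_mx 0 b); exists (kill f); split; first exact: kill_idem.
  by rewrite -Hf; apply/esym/(linear_kereq lin2 _ _ ker2)/in_loc_sub_kill.
pose I : finType := ('I_m1 * 'I_m2)%type.
pose E v : {mpoly K[n]} := \sum_(ab : I) vec_mx v ab.1 ab.2 *: (embed (e1 ab.1) * e2 ab.2).
have PhiE v : Phi (E v) = v.
  rewrite /E linear_sumE // -[RHS]vec_mxK [vec_mx v in RHS]matrix_sum_delta.
  rewrite pair_bigA linear_sum; apply: eq_bigr => -[a b] _ /=; rewrite linearZ /=.
  have [k2 Hb] := He2 b; rewrite PhiM // He1 Hb trmx_delta mul_delta_mx.
  by [].
have FE f : in_loc p [ffun=> 0] (f - E (Phi f)).
  elim/mpolyind: f => [|c m f _ _ IH].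
    rewrite linear0E // /E big1 ?subrr; first exact: in_loc0.
    by move=> ab _; rewrite linear0 mxE scale0r.
  have EL : E (Phi (c *: 'X_[m] + f)) = c *: E (Phi 'X_[m]) + E (Phi f).
    rewrite PhiL /E scaler_sumr -big_split; apply: eq_bigr => ab _ /=.
    by rewrite linearP !mxE scalerDl scalerA.
  rewrite EL opprD addrACA -scalerBr; apply: in_locD => //; apply: in_locZ => {IH EL f}.
  set X1 := sub_mon m; set X2 := part (~: A) m.
  pose S1 := \sum_a phi1 'X_[X1] 0 a *: e1 a; pose S2 := \sum_b phi2 'X_[X2] 0 b *: e2 b.
  have -> : E (Phi 'X_[m]) = embed S1 * S2.
    rewrite /E /Phi linear_extX /F mxvecK /S1 /S2 -/X1 -/X2.
    have -> : embed (\sum_a phi1 'X_[X1] 0 a *: e1 a) = \sum_a phi1 'X_[X1] 0 a *: embed (e1 a).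
      by rewrite /embed raddf_sum; apply: eq_bigr => a _ /=; rewrite comp_mpolyZ.
    rewrite mulr_suml -(pair_bigA _ (fun a b => ((phi1 'X_[X1])^T *m phi2 'X_[X2]) a b
      *: (embed (e1 a) * e2 b))) /=; apply: eq_bigr => a _.
    rewrite mulr_sumr; apply: eq_bigr => b _.
    by rewrite !mxE big_ord1 !mxE -scalerAr -scalerAl scalerA mulrC.
  have L1 : in_loc g [ffun=> 0] ('X_[X1] - S1).
    apply/(linear_kereq lin1 _ _ ker1); rewrite linear_sumE // [LHS]row_sum_delta.
    by apply: eq_bigr => a _; rewrite He1.
  have L2 : in_loc p [ffun=> 0] ('X_[X2] - S2).
    apply: in_loc_kill.
      rewrite -scaleN1r addrC kill_linear killX sub_mon_part eqxx; congr (_ *: _ + _).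
      rewrite /kill raddf_sum; apply: eq_bigr => b _ /=.
      by rewrite comp_mpolyZ -/(kill _); case: (He2 b) => ->.
    apply/(linear_kereq lin2 _ _ ker2); rewrite linear_sumE // [LHS]row_sum_delta.
    by apply: eq_bigr => b _; case: (He2 b) => _ ->.
  have -> : 'X_[m] - embed S1 * S2 =
      'X_[X2] * embed ('X_[X1] - S1) + embed S1 * ('X_[X2] - S2).
    rewrite mon_split -/X1 -/X2 /embed comp_mpolyB; ring.
  by apply: in_locD; apply: in_locM => //; apply: in_loc_embed.
exists Phi; split=> // [v|f]; first by exists (E v).
split=> [f0|]; last exact: Phi0.
have := FE f; rewrite f0 (_ : E 0 = 0) ?subr0 //.
by rewrite /E big1 // => ab _; rewrite linear0 mxE scale0r.
Qed.

End Product.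

(** * Triangular systems *)

(** A level function replaces the intervals, and irreducibility takes the form in which it is
    applied: a nonempty part of a block that is closed under dependence inside the block is the
    whole block. *)
Lemma triangular_levels n (r : 'I_n -> nat) (beta : 'I_n -> 'X_{1..n}) s nu :
  triangular_form r beta s nu ->
  exists lev : 'I_n -> 'I_s,
    [/\ forall a : 'I_s, block n nu a = [set i | lev i == a],
        forall a, exists i, lev i = a,
        forall i j, beta i j != 0%N -> (lev j <= lev i)%N,
        forall i, exists2 j, lev j = lev i & beta i j != 0%N
      & forall (a : 'I_s) (I : {set 'I_n}) i0, i0 \in I -> (forall i, i \in I -> lev i = a) ->
          (forall i j, i \in I -> lev j = a -> beta i j != 0%N -> j \in I) ->
          forall i, lev i = a -> i \in I].
Proof.
case=> nu0 nus nu_inc occ irr.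
have nu_mono a b : (a <= b)%N -> (b <= s)%N -> (nu a <= nu b)%N.
  elim: b => [|b IH]; first by rewrite leqn0 => /eqP ->.
  rewrite leq_eqVlt => /orP[/eqP -> //|]; rewrite ltnS => le_ab lt_b.
  by apply: leq_trans (IH le_ab (ltnW lt_b)) (ltnW (nu_inc _ lt_b)).
have /fin_all_exists[lev Hlev] : forall i : 'I_n, exists a : 'I_s, i \in block n nu a.
  move=> i; suff H t : (t <= s)%N -> (i < nu t)%N -> exists a : 'I_s, i \in block n nu a.
    by apply: (H s); rewrite ?nus.
  elim: t => [|t IH] lt_t; first by rewrite nu0.
  have [lt_i _|le_i lt_i] := ltnP i (nu t); first exact: IH (ltnW lt_t) lt_i.
  by exists (Ordinal lt_t); rewrite inE le_i lt_i.
have lev_uniq i (a : 'I_s) : i \in block n nu a -> lev i = a.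
  have H (b b' : 'I_s) : i \in block n nu b -> i \in block n nu b' -> (b <= b')%N.
    rewrite !inE => /andP[le_b _] /andP[_ lt_b']; rewrite leqNgt; apply/negP => lt_bb'.
    have := nu_mono _ _ lt_bb' (ltnW (ltn_ord b)); lia.
  by move=> ia; apply/val_inj/eqP; rewrite eqn_leq !H.
have blockE (a : 'I_s) : block n nu a = [set i | lev i == a].
  by apply/setP => i; rewrite [RHS]inE; apply/idP/eqP => [/lev_uniq|<-].
exists lev; split=> // [a|i j bij|i|a I i0 i0I Ia Icl i ia].
- have lt_a := nu_inc a (ltn_ord a).
  have lt_n : (nu a < n)%N by rewrite (leq_trans lt_a) // -[X in (_ <= X)%N]nus nu_mono.
  by exists (Ordinal lt_n); apply: lev_uniq; rewrite inE leqnn lt_a.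
- rewrite leqNgt; apply/negP => lt_ij.
  have := occ (lev i) i (ltn_ord _) (Hlev i) j; rewrite /occurs bij orbT => /(_ isT).
  have := nu_mono _ _ lt_ij (ltnW (ltn_ord _)); have := Hlev j; rewrite inE; lia.
- have [normal _] := irr _ (ltn_ord (lev i)); have iB := Hlev i.
  have [_ /eqP nz _] := normal (enum_rank_in iB i).
  have [j bj] : exists j : 'I_#|block n nu (lev i)|, beta i (enum_val j) != 0%N.
    apply/existsP; apply: contra_notT nz; rewrite negb_exists => /forallP H.
    apply/mnmP => j; rewrite mnmE mnm0E enum_rankK_in //; apply/eqP.
    by have := H j; rewrite negbK.
  by exists (enum_val j) => //; apply: lev_uniq; apply: enum_valP.
have [_ nex] := irr _ (ltn_ord a).
have IB : I \subset block n nu a by apply/subsetP => j jI; rewrite blockE inE Ia.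
pose I' : {set 'I_#|block n nu a|} := [set x | enum_val x \in I].
case: (boolP (I' \proper [set: 'I_#|block n nu a|])) => [prop|].
  case: nex; exists I'; split=> // [|x].
    apply/set0Pn; have i0B := subsetP IB _ i0I.
    by exists (enum_rank_in i0B i0); rewrite inE enum_rankK_in.
  rewrite inE => xI y; rewrite /occurs mulmnE mnm1E mnmE inE.
  have [<- //|_ /= bxy] := x =P y.
  by apply: Icl xI _ bxy; apply: lev_uniq; apply: enum_valP.
rewrite properT negbK => /eqP/setP H.
have iB : i \in block n nu a by rewrite blockE inE ia.
by have := H (enum_rank_in iB i); rewrite !inE enum_rankK_in.
Qed.

Section Levels.
Variables (n s : nat) (r : 'I_n -> nat) (beta : 'I_n -> 'X_{1..n}) (nu : nat -> nat).
Variable lev : 'I_n -> 'I_s.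
Hypothesis r_gt0 : forall i, (0 < r i)%N.
Hypothesis blockE : forall a : 'I_s, block n nu a = [set i | lev i == a].
Hypothesis lev_le : forall i j, beta i j != 0%N -> (lev j <= lev i)%N.
Hypothesis lev_self : forall i, exists2 j, lev j = lev i & beta i j != 0%N.
Hypothesis lev_irr : forall (a : 'I_s) (I : {set 'I_n}) i0, i0 \in I ->
  (forall i, i \in I -> lev i = a) ->
  (forall i j, i \in I -> lev j = a -> beta i j != 0%N -> j \in I) ->
  forall i, lev i = a -> i \in I.

Let G := arrow r beta (s := s) nu.

(** Leading exponents sit on the diagonal, so off the diagonal blocks the matrix is the negative of
    [beta]. *)
Lemma arrowP (a b : 'I_s) :
  reflect ((a < b)%N /\ exists i j, [/\ lev i = b, lev j = a & beta i j != 0%N])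
  (G a b).
Proof.
apply: (iffP andP) => -[lt_ab H]; split=> //.
  case/existsP: H => i /andP[]; rewrite blockE inE => /eqP ib /existsP[j /andP[]].
  rewrite blockE inE => /eqP ja Bij; exists i, j; split=> //; apply: contraNneq Bij => bij.
  rewrite mxE bij subr0 mulmnE mnm1E; have [E|//] := i =P j.
  by move: lt_ab; rewrite -ib -ja E ltnn.
case: H => i [j [ib ja bij]]; apply/existsP; exists i; rewrite blockE inE ib eqxx /=.
apply/existsP; exists j; rewrite blockE inE ja eqxx mxE mulmnE mnm1E.
have [E|_] := i =P j; first by move: lt_ab; rewrite -ib -ja E ltnn.
by rewrite mul0n sub0r oppr_eq0.
Qed.

(* The identity rows make the system square: its torus solutions z are the    *)
(* solutions of the binomial system vanishing exactly on the blocks of Z, with *)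
(* these zero coordinates replaced by those of c.                              *)
Definition pattern_matrix (Z : {set 'I_s}) : 'M[int]_n :=
  keep_rows [set i | lev i \notin Z] (system_matrix r beta).

Definition zclosed (Z : {set 'I_s}) : bool :=
  [forall a, forall b, (a \in Z) && G a b ==> (b \in Z)].

Definition zsources (Z : {set 'I_s}) : {set 'I_s} :=
  [set b in Z | ~~ [exists a, (a \in Z) && G a b]].

Lemma zclosedP (Z : {set 'I_s}) :
  reflect (forall i j, beta i j != 0%N -> lev j \in Z -> lev i \in Z) (zclosed Z).
Proof.
apply: (iffP forallP) => [H i j bij jZ|H a].
  have [<- //|ne] := eqVneq (lev j) (lev i).
  have /forallP/(_ (lev i))/implyP := H (lev j); apply; rewrite jZ.
  by apply/arrowP; split; [rewrite ltn_neqAle ne lev_le|exists i, j].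
apply/forallP => b; apply/implyP => /andP[aZ /arrowP[_ [i [j [ib ja bij]]]]].
by rewrite -ib; apply: H bij _; rewrite ja.
Qed.

(** A full subgraph contains every arrow that starts in it, so its vertices determine it. *)
Lemma sum_full_subgraphs (F : {set 'I_s} -> {set 'I_s} -> nat) :
  (\sum_(H in full_subgraphs G) F H.1 (sources H) =
   \sum_(Z : {set 'I_s} | zclosed Z) F Z (zsources Z))%N.
Proof.
pose h (Z : {set 'I_s}) : {set 'I_s} * {set 'I_s * 'I_s} :=
  (Z, [set ab | G ab.1 ab.2 & ab.1 \in Z]).
have fullP H : H \in full_subgraphs G -> zclosed H.1 /\ h H.1 = H.
  case: H => Z E; rewrite inE => /andP[/forallP sub /forallP full] /=.
  have full1 a b : a \in Z -> G a b -> (b \in Z) && ((a, b) \in E).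
    move=> aZ ab; have /implyP/(_ aZ)/andP[/forallP H1 /forallP H2] := full a.
    rewrite (implyP (H1 b)) ?connect1 //=.
    by have /forallP/(_ b)/implyP := H2 a; apply; rewrite connect0.
  split.
    by apply/forallP => a; apply/forallP => b; apply/implyP => /andP[/full1 H /H/andP[]].
  congr (_, _); apply/setP => -[a b]; rewrite inE /=; apply/andP/idP => [[ab aZ]|abE].
    by have /andP[] := full1 _ _ aZ ab.
  by have /implyP/(_ abE)/and3P[] := sub (a, b).
rewrite (reindex_onto h fst) /=; last by move=> H /fullP[].
apply: eq_big => [Z|Z _].
  rewrite eqxx andbT; apply/idP/idP => [/fullP[]//|cZ].
  have cZ1 a b : a \in Z -> G a b -> b \in Z.
    by move=> aZ ab; have /forallP/(_ a)/forallP/(_ b)/implyP := cZ; apply; rewrite aZ.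
  have cZ2 a b : a \in Z -> connect G a b -> b \in Z.
    move=> aZ /connectP[p]; elim: p a aZ => [|c p IH] a aZ /=; first by move=> _ ->.
    by move=> /andP[/(cZ1 _ _ aZ) cZc]; apply: IH.
  rewrite inE; apply/andP; split.
    apply/forallP => -[a b]; apply/implyP; rewrite inE /= => /andP[ab aZ].
    by rewrite ab aZ (cZ1 a).
  apply/forallP => a; apply/implyP => /= aZ; apply/andP; split.
    by apply/forallP => b; apply/implyP; apply: cZ2.
  apply/forallP => l; apply/forallP => m; apply/implyP => /andP[al lm].
  by rewrite inE lm (cZ2 a).
congr (F _ _); apply/setP => b; rewrite !inE /=; congr (_ && ~~ _).
by apply: eq_existsb => a; rewrite inE /= andbC.
Qed.

Section Solutions.
Variables (K : closedFieldType) (c : {ffun 'I_n -> K}).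
Hypothesis K_char0 : [pchar K] =i pred0.
Hypothesis c_neq0 : forall i, c i != 0.
Let p := binomial_system r beta c.
Implicit Types (x z : {ffun 'I_n -> K}).
Variable Z : {set 'I_s}.
Notation A := (pattern_matrix Z).

Definition pattern (x : {ffun 'I_n -> K}) := forall i, (x i == 0) = (lev i \in Z).

Definition cut (z : {ffun 'I_n -> K}) : {ffun 'I_n -> K} :=
  [ffun i => if lev i \in Z then 0 else z i].

Definition fill (x : {ffun 'I_n -> K}) : {ffun 'I_n -> K} :=
  [ffun i => if lev i \in Z then c i else x i].

Lemma solutionP x : is_solution p x <-> forall i, x i ^+ r i = c i * 'X_[beta i].@[x].
Proof.
split=> H i; first exact: solution_monomial.
by rewrite /p /binomial_system mevalB mevalZ meval_lead H subrr.
Qed.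

Hypothesis Z_closed : zclosed Z.

Lemma mpow_row z i : torus z -> lev i \notin Z ->
  mpow z A i = cut z i ^+ r i / 'X_[beta i].@[cut z].
Proof.
move=> tz iZ; rewrite ffunE -meval_lead !mevalX -prodfV -big_split /=.
apply: eq_bigr => j _; rewrite !mxE inE iZ.
have [jZ|jZ] := boolP (lev j \in Z).
  have -> : lead_exp r i j = 0%N.
    by rewrite mulmnE mnm1E; have [E|//] := i =P j; rewrite E jZ in iZ.
  have -> : beta i j = 0%N.
    by apply/eqP; apply: contraNT iZ => bij; have /zclosedP := Z_closed; apply; eassumption.
  by rewrite subrr expr0z !expr0 invr1 mulr1.
rewrite ffunE (negbTE jZ) expfzDr // -invr_expz.
by [].
Qed.

Lemma mpow_row_zero z i : lev i \in Z -> mpow z A i = z i.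
Proof.
move=> iZ; rewrite ffunE (bigD1 i) //= !mxE inE iZ eqxx expr1z big1 ?mulr1 // => j.
by rewrite !mxE inE iZ eq_sym => /negbTE ->; rewrite expr0z.
Qed.

Lemma meval_cut_neq0 z i : torus z -> lev i \notin Z -> 'X_[beta i].@[cut z] != 0.
Proof.
move=> tz iZ; rewrite mevalX; apply/prodf_neq0 => j _.
have [-> //|bij] := eqVneq (beta i j) 0%N; first by rewrite expr0 oner_eq0.
rewrite expf_neq0 // ffunE; case: ifP => // jZ.
by have /zclosedP/(_ i j bij jZ) := Z_closed; rewrite (negbTE iZ).
Qed.

Lemma cut_solution z : torus z -> mpow z A = c -> is_solution p (cut z) /\ pattern (cut z).
Proof.
move=> tz Ec; split; last first.
  by move=> i; rewrite ffunE; case: ifP; rewrite ?eqxx // => _; apply/negbTE.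
apply/solutionP => i; have [iZ|iZ] := boolP (lev i \in Z).
  rewrite [in LHS]ffunE iZ expr0n gtn_eqF //=; have [j Ej bij] := lev_self i.
  by rewrite mevalX (bigD1 j) //= ffunE Ej iZ expr0n (negbTE bij) mul0r mulr0.
by rewrite -Ec mpow_row // divfK // meval_cut_neq0.
Qed.

Lemma fill_cut z : mpow z A = c -> fill (cut z) = z.
Proof.
move=> Ec; apply/ffunP => i; rewrite !ffunE; have [iZ|//] := boolP (lev i \in Z).
by rewrite -(mpow_row_zero z iZ) Ec.
Qed.

Lemma cut_fill x : pattern x -> cut (fill x) = x.
Proof.
move=> px; apply/ffunP => i; rewrite !ffunE -px; case: eqP => // iZ.
Qed.

Lemma fill_torus x : is_solution p x -> pattern x -> torus (fill x) /\ mpow (fill x) A = c.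
Proof.
move=> /solutionP sol px.
have tz : torus (fill x) by move=> i; rewrite ffunE; case: ifP => // iZ; rewrite px iZ.
split=> //; apply/ffunP => i; have [iZ|iZ] := boolP (lev i \in Z).
  by rewrite mpow_row_zero // ffunE iZ.
have := meval_cut_neq0 tz iZ; rewrite mpow_row // cut_fill // sol => H.
by rewrite mulfK.
Qed.

Lemma absz_det_pattern : `|\det A|%N = (\prod_(a : 'I_s | a \notin Z) delta r beta nu a)%N.
Proof.
rewrite /pattern_matrix (@det_block_triangular _ _ _ lev) => [|i j lt_ij].
  rewrite (big_morph absz abszM absz1).
  by apply: eq_bigr => a _; rewrite delta_keep_rows blockE.
rewrite mxE mulmnE mnm1E; have [E|_] := i =P j; first by rewrite E ltnn in lt_ij.
apply/eqP; rewrite mul0n sub0r oppr_eq0.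
apply: contraLR lt_ij => bij; rewrite -leqNgt; apply: lev_le; exact: bij.
Qed.

(** [cut] and [fill] are inverse to each other between the torus solutions for [A] and the solutions
    with zero blocks [Z]. For determinant zero both sides of the count are 0, by the hypothesis. *)
Lemma pattern_solutions : (\det A = 0 -> forall z, torus z -> mpow z A <> c) ->
  exists t : seq {ffun 'I_n -> K},
    [/\ uniq t, size t = (\prod_(a : 'I_s | a \notin Z) delta r beta nu a)%N &
      forall x, x \in t <-> is_solution p x /\ pattern x].
Proof.
rewrite -absz_det_pattern => no_sol; have [A0|A0] := eqVneq (\det A) 0.
  exists [::]; split=> // [|x]; first by rewrite A0.
  split=> // -[sol px]; have [tz E] := fill_torus sol px.
  by have := no_sol A0 _ tz.
have [t [ut st Ht]] := torus_count K_char0 A0 c_neq0.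
exists [seq cut z | z <- t]; split=> [||x]; last first.
- split=> [/mapP[z /Ht[tz E] ->]|[sol px]]; first exact: cut_solution.
  apply/mapP; exists (fill x); last by rewrite cut_fill.
  by apply/Ht; apply: fill_torus.
- by rewrite size_map.
rewrite map_inj_in_uniq // => z z' /Ht[tz E] /Ht[tz' E'] Ecut.
by rewrite -(fill_cut E) Ecut fill_cut.
Qed.

End Solutions.

End Levels.

(** * Zero patterns and the local ring at the origin *)

Section LocalMultiplicity.
Variables (n s : nat) (r : 'I_n -> nat) (beta : 'I_n -> 'X_{1..n}) (nu : nat -> nat).
Variable lev : 'I_n -> 'I_s.
Hypothesis r_gt0 : forall i, (0 < r i)%N.
Hypothesis blockE : forall a : 'I_s, block n nu a = [set i | lev i == a].
Hypothesis lev_le : forall i j, beta i j != 0%N -> (lev j <= lev i)%N.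
Hypothesis lev_irr : forall (a : 'I_s) (I : {set 'I_n}) i0, i0 \in I ->
  (forall i, i \in I -> lev i = a) ->
  (forall i j, i \in I -> lev j = a -> beta i j != 0%N -> j \in I) ->
  forall i, lev i = a -> i \in I.

Section Pattern.
Variables (K : closedFieldType) (c : {ffun 'I_n -> K}).

(** The variables of a block that are nonzero at [x] form a set closed under dependence, so by
    irreducibility there are none or all of them. *)
Lemma solution_pattern x : is_solution (binomial_system r beta c) x ->
  exists2 Z, zclosed r beta nu Z & pattern lev Z x.
Proof.
move=> /solutionP sol; pose Z := [set lev i | i in [set i | x i == 0]].
have dep i j : beta i j != 0%N -> x j = 0 -> x i = 0.
  move=> bij xj; have := sol i; rewrite mevalX (bigD1 j) //= xj expr0n (negbTE bij).
  by rewrite mul0r mulr0 => /eqP; rewrite expf_eq0 => /andP[_ /eqP].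
have px : pattern lev Z x.
  move=> i; apply/idP/imsetP => [xi|[j]]; first by exists i; rewrite ?inE.
  rewrite inE => /eqP xj Eij; apply/negPn/negP => xi.
  have : j \in [set l | (lev l == lev i) && (x l != 0)].
    apply: (lev_irr (a := lev i) (i0 := i)) => [|l|l m|]; rewrite ?inE ?eqxx //.
      by move=> /andP[/eqP].
    move=> /andP[_ xl] /eqP -> blm; rewrite /=; apply: contraNneq xl => xm.
    by apply/eqP; apply: dep blm xm.
  by rewrite inE xj eqxx andbF.
exists Z => //; apply/(zclosedP _ blockE lev_le) => i j bij.
by rewrite -!px => /eqP xj; apply/eqP; apply: dep bij xj.
Qed.

End Pattern.

Section Origin.
Variables (K : fieldType) (Z : {set 'I_s}) (c' : 'I_n -> K) (mu : 'I_s -> nat).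
Hypothesis Z_closed : zclosed r beta nu Z.
Let V := [set i | lev i \notin Z].
Let src := zsources r beta nu Z.
Let gam i := part (~: V) (beta i).
Let N := [set i | lev i \in Z :\: src].
Let p i : {mpoly K[n]} := if i \in V then 'X_i else binomial_system r gam c' i.

Let subsystem (a : 'I_s) :=
  binomial_system (@sub_r n (block n nu a) r) (@sub_beta n (block n nu a) beta)
    (fun j => c' (enum_val j)).

Hypothesis mu_codim : forall e, e \in src -> has_codim (in_loc (@subsystem e) [ffun=> 0]) (mu e).

Lemma in_N i : (i \in N) = (lev i \notin src) && (lev i \in Z).
Proof. by rewrite in_set in_setD. Qed.

Lemma in_V i : (i \in V) = (lev i \notin Z).
Proof. by rewrite in_set. Qed.

Lemma notin_N i : i \notin N -> i \notin V -> lev i \in src.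
Proof. by rewrite in_N in_V negbK => + iZ; rewrite iZ andbT negbK. Qed.

Lemma gam_neq0 i j : (gam i j != 0%N) = (lev j \in Z) && (beta i j != 0%N).
Proof. by rewrite /gam mnmE !inE negbK; case: (lev j \in Z). Qed.

Lemma src_sub e : e \in src -> e \in Z.
Proof. by rewrite inE => /andP[]. Qed.

(** A variable from another block of [Z] would mean an arrow of [Z] into a source. *)
Lemma gam_src i j : lev i \in src -> gam i j != 0%N -> lev j = lev i.
Proof.
rewrite gam_neq0 inE => /andP[_ nex] /andP[jZ bij].
apply/eqP; apply: contraNT nex => ne; apply/existsP; exists (lev j); rewrite jZ /=.
by apply/(arrowP _ _ blockE _ _); split; [rewrite ltn_neqAle ne lev_le|exists i, j].
Qed.

(** Otherwise the complement of [Y] is closed under dependence. By irreducibility it contains the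
    whole block of each of its indices, and since this block is not a source, an arrow into it leads
    to an index outside [Y] of lower level; induction on the level excludes this. *)
Lemma nonsource_reach (Y : {set 'I_n}) : ~: N \subset Y -> Y != setT ->
  exists i j, [/\ i \notin Y, j \in Y & gam i j != 0%N].
Proof.
move=> NY YT.
suff /existsP[i /existsP[j /and3P[]]] :
    [exists i, exists j, [&& i \notin Y, j \in Y & gam i j != 0%N]] by exists i, j.
apply: contraNT YT; rewrite negb_exists => /forallP nex; rewrite -subTset; apply/subsetP.
have {}nex i j : i \notin Y -> gam i j != 0%N -> j \notin Y.
  move=> iY gij; apply/negP => jY; have := nex i; rewrite negb_exists => /forallP/(_ j).
  by rewrite iY jY gij.
move=> i _; have [m] := ubnP (lev i); elim: m i => // m IH i lt_m; apply/negPn/negP => iY.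
have : i \in N by apply: contraNT iY => iN; apply: (subsetP NY); rewrite inE.
rewrite !inE => /andP[isrc iZ]; move: isrc; rewrite iZ /= negbK.
case/existsP => a /andP[aZ /(arrowP _ _ blockE _ _)[lt_a [i1 [j1 [Ei1 Ej1 b11]]]]].
have i1Y : i1 \in [set l | (lev l == lev i) && (l \notin Y)].
  apply: (lev_irr (a := lev i) (i0 := i)) => [|l|l l'|] //; rewrite ?inE ?eqxx //.
    by move=> /andP[/eqP].
  move=> /andP[/eqP El lY] El' bll'; rewrite El' eqxx /=; apply: nex lY _.
  by rewrite gam_neq0 El' iZ.
have j1Y : j1 \in Y.
  apply: IH; rewrite Ej1; have := lt_a; rewrite ltnS in lt_m.
  by move=> lt_a'; apply: leq_trans lt_a' lt_m.
have : j1 \notin Y.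
  apply: nex (i1) _ _ _; first by move: i1Y; rewrite inE => /andP[].
  by rewrite gam_neq0 Ej1 aZ.
by rewrite j1Y.
Qed.

Lemma embed_subsystem (e : 'I_s) (j : 'I_#|block n nu e|) : e \in src ->
  p (enum_val j) = embed (@subsystem e j).
Proof.
move=> esrc; have jB := enum_valP j; move: (jB); rewrite {2}blockE inE => /eqP lj.
rewrite /p inE lj (src_sub esrc) /= /subsystem /binomial_system /embed.
rewrite comp_mpolyB comp_mpolyZ -!/(embed _) !embedX; congr ('X_[_] - _ *: 'X_[_]).
  apply/mnmP => i; have [iB|iB] := boolP (i \in block n nu e).
    rewrite -(enum_rankK_in iB iB) emb_monE !mulmnE !mnm1E /sub_r.
    by rewrite (inj_eq enum_val_inj).
  rewrite emb_mon_out // mulmnE mnm1E; have [E|//] := enum_val j =P i.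
  by rewrite -E jB in iB.
rewrite -[sub_beta _ _]/(sub_mon _ (beta (enum_val j))) emb_sub_mon /gam.
apply/mnmP => i; rewrite !mnmE.
have -> : (i \in block n nu e) = (lev i == e) by rewrite blockE inE.
rewrite !inE negbK.
have [iZ|iZ] := boolP (lev i \in Z); case: eqP => // ie.
  apply/eqP; apply/negPn/negP => bji; case: ie; rewrite -lj; apply: gam_src.
    by rewrite lj.
  by rewrite gam_neq0 iZ.
by rewrite ie (src_sub esrc) in iZ.
Qed.

(** Interpolates between pure powers, for [T] empty, and the system with leading powers in the
    blocks of [Z] that are not sources, for [T = src]. *)
Definition stage (T : {set 'I_s}) i : {mpoly K[n]} :=
  if lev i \in T then p i else 'X_i ^+ (if i \in N then r i else 1%N).

Lemma kill_supported (B : {set 'I_n}) (m : 'X_{1..n}) :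
  (forall j, j \in B -> m j = 0%N) -> kill B ('X_[m] : {mpoly K[n]}) = 'X_[m].
Proof.
move=> mB; rewrite killX; case: eqP => // -[]; apply/mnmP => j.
by rewrite mnmE mnm0E mB // enum_valP.
Qed.

Lemma kill_stage (T : {set 'I_s}) (e : 'I_s) i : T \subset src -> e \notin T ->
  i \notin block n nu e -> kill (block n nu e) (stage T i) = stage T i.
Proof.
move=> Tsrc eT iB; have leadB d j : j \in block n nu e -> (U_(i) *+ d)%MM j = 0%N.
  by move=> jB; rewrite mulmnE mnm1E; have [E|//] := i =P j; rewrite E jB in iB.
rewrite /stage; case: ifP => iT; last by rewrite mpolyXn kill_supported // => j; apply: leadB.
have isrc := subsetP Tsrc _ iT.
rewrite /p inE (src_sub isrc) /= /binomial_system /kill comp_mpolyB comp_mpolyZ -!/(kill _ _).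
rewrite !kill_supported // => j; last exact: leadB.
rewrite blockE inE => /eqP je; apply/eqP/negPn/negP => /(gam_src isrc) E.
by move: eT; rewrite -je E iT.
Qed.

(** The equations of a source involve only its own variables, so the blocks of [T] split off one by
    one as factors. *)
Lemma has_codim_stage (T : {set 'I_s}) : T \subset src ->
  has_codim (in_loc (stage T) [ffun=> 0])
    ((\prod_(b in Z :\: src) rho r nu b) * \prod_(e in T) mu e)%N.
Proof.
move: {2}#|T| (erefl #|T|) => m; elim: m T => [|m IH] T.
  move/eqP; rewrite cards_eq0 => /eqP -> _; rewrite big_set0 muln1.
  have -> : (\prod_(b in Z :\: src) rho r nu b =
      \prod_i (if i \in N then r i else 1))%N.
    rewrite -big_mkcond (partition_big lev (mem (Z :\: src))) /=.
      apply: eq_bigr => b bZ; rewrite /rho; apply: eq_bigl => i.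
      rewrite blockE inE; apply/eqP/andP => [E|[_ /eqP //]].
      by rewrite /N inE E bZ eqxx.
    by move=> i; rewrite inE.
  apply: has_codim_ext (has_codim_monomial K (fun i => if i \in N then r i else 1%N)) => f.
  by apply: in_loc_ext => i; rewrite /stage in_set0.
move=> card_T Tsrc; have [e eT] : exists e, e \in T.
  by apply/set0Pn; rewrite -cards_eq0 card_T.
have esrc := subsetP Tsrc _ eT.
have T'src : T :\ e \subset src by apply: subset_trans (subsetDl _ _) Tsrc.
have card_T' : #|T :\ e| = m by have := cardsD1 e T; rewrite eT card_T => -[].
have H := has_codim_product _ _ _ _ (mu_codim esrc) (IH _ card_T' T'src).
rewrite (big_setD1 e eT) /= mulnCA; apply: H => [j|i iB|i iB|i iB].
- have := enum_valP j; rewrite {2}blockE inE => /eqP lj.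
  by rewrite /stage lj eT; apply: embed_subsystem.
- move: iB; rewrite blockE inE => ne; by rewrite /stage in_setD1 ne.
- move: iB; rewrite blockE inE => /eqP li.
  by rewrite /stage in_setD1 li eqxx in_N li esrc expr1.
by apply: kill_stage => //; rewrite in_setD1 eqxx.
Qed.

(** Stated for any [q] agreeing with [p] outside [N], because it serves both for [p] and for its
    deformation. *)
Lemma source_nilp (q : 'I_n -> {mpoly K[n]}) : (forall i, i \notin N -> q i = p i) ->
  forall i, i \notin N -> loc_nilp [ffun=> 0] q 'X_i.
Proof.
move=> qp i iN; have [iV|iV] := boolP (i \in V).
  exists 1%N; rewrite expr1; have := in_loc_gen q [ffun=> 0] i.
  by rewrite qp // /p iV.
have isrc := notin_N iN iV.
have iB : i \in block n nu (lev i) by rewrite blockE inE.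
exists (mu (lev i)); have /codim_nilpotent/(_ (enum_rank_in iB i)) := mu_codim isrc.
case=> h h0 [a Ea]; apply: (@in_loc_cancel _ _ _ _ (embed h)).
  by rewrite meval_embed0.
have -> : 'X_i ^+ mu (lev i) =
    embed ('X_(enum_rank_in iB i) ^+ mu (lev i)) :> {mpoly K[n]}.
  rewrite /embed rmorphXn /= comp_mpolyXU -tnth_nth tnth_mktuple.
  by rewrite enum_rankK_in.
rewrite /embed -rmorphM /= Ea rmorph_sum; apply: in_loc_sum => j _ /=.
rewrite rmorphM /= -[comp_mpoly _ (subsystem j)]/(embed _) -embed_subsystem //.
apply: in_locM; rewrite -qp; first exact: in_loc_gen.
have := enum_valP j; rewrite {2}blockE inE => /eqP lj.
by rewrite in_N lj isrc.
Qed.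

(** All variables are nilpotent in the local rings of [p] and of [stage src], so heavy monomials
    vanish in both and the deformation applies. *)
Lemma has_codim_origin : has_codim (in_loc p [ffun=> 0])
  ((\prod_(b in Z :\: src) rho r nu b) * \prod_(e in src) mu e)%N.
Proof.
have p_bin i : i \in N -> p i = binomial_system r gam c' i.
  by rewrite /p in_N in_V => /andP[_ ->].
have [w [w0 Hw]] := heavy_weights nonsource_reach r.
pose q i : {mpoly K[n]} := if i \in N then 'X_i ^+ r i else p i.
have [a Ha] : exists a, forall i, in_loc p [ffun=> 0] ('X_i ^+ a).
  by apply: loc_nilp_all; apply: (loc_nilp_reach nonsource_reach p_bin); apply: source_nilp.
have [b Hb] : exists b, forall i, in_loc q [ffun=> 0] ('X_i ^+ b).
  apply: loc_nilp_all => i; have [iN|iN] := boolP (i \in N).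
    by exists (r i); have := in_loc_gen q [ffun=> 0] i; rewrite /q iN.
  by apply: source_nilp iN => l /negbTE lN; rewrite /q lN.
pose W := ((a + b) * (\sum_i w i)).+1.
apply: (has_codim_deformation w0 r_gt0 p_bin _ Hw (W := W)) => [i m j iN mp jN|m|m|].
- move: jN; rewrite in_N => /andP[jsrc jZ].
  move: mp; rewrite /p; have [iV|iV] := boolP (i \in V).
    rewrite msuppX inE => /eqP ->; rewrite mnm1E; have [E|//] := i =P j.
    by move: iV; rewrite E in_V jZ.
  have isrc := notin_N iN iV.
  rewrite /binomial_system => /msuppB_le; rewrite mem_cat => /orP[|/msuppZ_le];
    rewrite msuppX inE => /eqP ->.
    rewrite mulmnE mnm1E; have [E|//] := i =P j; by rewrite -E isrc in jsrc.
  apply/eqP/negPn/negP => /(gam_src isrc) E; by rewrite E isrc in jsrc.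
- by apply: (nilp_wt_ge (w := w) Ha); rewrite ltnS leq_mul2r leq_addr orbT.
- by apply: (nilp_wt_ge (w := w) Hb); rewrite ltnS leq_mul2r leq_addl orbT.
apply: has_codim_ext (has_codim_stage (subxx src)) => f; apply: in_loc_ext => i.
rewrite /stage /q in_N; have [//|isrc] := boolP (lev i \in src).
by rewrite /p in_V; case: (lev i \in Z); rewrite ?expr1.
Qed.

End Origin.
End LocalMultiplicity.

Lemma intr_neq0 (K : fieldType) (m : int) : [pchar K] =i pred0 -> m != 0 -> m%:~R != 0 :> K.
Proof.
move=> /pcharf0P nat0; case: m => m m0; first by rewrite -pmulrn nat0.
by rewrite NegzE mulrNz oppr_eq0 -pmulrn nat0.
Qed.

Lemma flatten_classes (T : eqType) (I : finType) (P : pred I) (t : I -> seq T) (key : T -> I)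
    (wf : I -> nat) :
  (forall i, P i -> uniq (t i)) -> (forall i x, P i -> x \in t i -> key x = i) ->
  let sol := flatten [seq t i | i <- enum P] in
  [/\ uniq sol, forall x, x \in sol <-> exists2 i, P i & x \in t i,
      size sol = (\sum_(i | P i) size (t i))%N
    & (\sum_(x <- sol) wf (key x) = \sum_(i | P i) size (t i) * wf i)%N].
Proof.
move=> ut kt sol.
suff H (e : seq I) : uniq e -> all P e -> let so := flatten [seq t i | i <- e] in
    [/\ uniq so, forall x, x \in so <-> exists2 i, i \in e & x \in t i,
      size so = (\sum_(i <- e) size (t i))%N
    & (\sum_(x <- so) wf (key x) = \sum_(i <- e) size (t i) * wf i)%N].
  have [|u m sz w] := H _ (enum_uniq P); first by apply/allP => i; rewrite mem_enum.
  split=> // [x||]; [|by rewrite /sol sz big_enum|by rewrite /sol w big_enum].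
  by rewrite m; split=> -[i Pi xi]; exists i; rewrite // mem_enum in Pi *.
elim: e => [|i e IH] /=; first by split; rewrite ?big_nil // => x; split=> // -[].
move=> /andP[ie ue] /andP[Pi Pe]; have [u m sz w] := IH ue Pe; split.
- rewrite cat_uniq ut // u andbT; apply/hasPn => x /m[j je xj]; apply/negP => xi.
  by case/negP: ie; rewrite -(kt i x Pi xi) (kt j x _ xj) // (allP Pe).
- move=> x; rewrite mem_cat; split=> [/orP[xi|/m[j je xj]]|[j]].
  + by exists i; rewrite ?inE ?eqxx.
  + by exists j; rewrite ?inE ?je ?orbT.
  rewrite inE => /orP[/eqP -> -> //|je xj]; apply/orP; right; apply/m; by exists j.
- by rewrite size_cat big_cons sz.
rewrite big_cat big_cons /= w; congr (_ + _)%N.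
rewrite big_seq (eq_bigr (fun=> wf i)) => [|x xi]; last by rewrite (kt i x Pi xi).
by rewrite -big_seq big_const_seq count_predT iter_addn_0 mulnC.
Qed.

(** * Generic coefficients and the final count *)

Section Main.
Variables (K : closedFieldType) (K_char0 : [pchar K] =i pred0).
Variables (n s : nat) (r : 'I_n -> nat) (beta : 'I_n -> 'X_{1..n}) (nu : nat -> nat).
Variable lev : 'I_n -> 'I_s.
Hypothesis blockE : forall a : 'I_s, block n nu a = [set i | lev i == a].
Implicit Types (Z : {set 'I_s}) (x z : {ffun 'I_n -> K}).
Let V (Z : {set 'I_s}) := [set i | lev i \notin Z].
Notation A := (pattern_matrix r beta lev).

Lemma lev_enum_val (a : 'I_s) (j : 'I_#|block n nu a|) : lev (enum_val j) = a.
Proof. by have := enum_valP j; rewrite {2}blockE inE => /eqP. Qed.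

(** The coefficients of the system of a block [a] of [Z] at a solution, in terms of the filled torus
    point [z], whose coordinates in that block are those of [c]. *)
Definition block_coef Z (z : {ffun 'I_n -> K}) (a : 'I_s) (j : 'I_#|block n nu a|) : K :=
  z (enum_val j) * 'X_[part (V Z) (beta (enum_val j))].@[z].

Section Generic.
Variables (k : fieldType) (iota : {rmorphism k -> K}).
Let ic (c : {ffun 'I_n -> k}) : {ffun 'I_n -> K} := [ffun i => iota (c i)].

Lemma generic_no_torus_solution Z :
  genericK iota (fun c => \det (A Z) = 0 -> forall z, torus z -> mpow z (A Z) <> ic c).
Proof.
case: (classic (\det (A Z) = 0)) => [A0|A0]; last by apply: genericK_true.
have [F F0 HF] := mpow_dependent K A0; exists F => // c _ Fc _ z tz E.
case/eqP: Fc; rewrite -(HF z tz) E; apply: meval_eq => i.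
by rewrite ffunE.
Qed.

Variable D : forall a : 'I_s, {mpoly K[#|block n nu a|]}.

(** Pulled back along [block_coef], [D a] is a nonzero polynomial in the torus point, which
    [mpow_push] turns into a condition on [c]. *)
Lemma generic_block_coef Z (a : 'I_s) : D a != 0 ->
  genericK iota (fun c => a \in Z -> \det (A Z) != 0 ->
    forall z, torus z -> mpow z (A Z) = ic c -> (D a).@[block_coef Z z (a := a)] != 0).
Proof.
move=> Da_neq0; have [aZ|] := boolP (a \in Z); last by move=> aZ; apply: genericK_true.
have [A0|A0] := eqVneq (\det (A Z)) 0; first by apply: genericK_true.
pose F : {mpoly K[n]} := D a \mPo
  [tuple 'X_(enum_val j) * 'X_[part (V Z) (beta (enum_val j))] | j < #|block n nu a|].
have FE (z : 'I_n -> K) : F.@[z] = (D a).@[fun j =>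
    z (enum_val j) * 'X_[part (V Z) (beta (enum_val j))].@[z]].
  rewrite comp_mpoly_meval; apply: meval_eq => j.
  by rewrite tnth_mktuple mevalM mevalXU.
have F0 : F != 0.
  have [y Dy] := mpoly_neq0_eval K_char0 Da_neq0.
  (* With the value 1 outside the block, the monomials in the torus coordinates are 1 and [F] takes
     the value of [D a] at [y]. *)
  pose z (i : 'I_n) : K := if [pick j | enum_val j == i] is Some j then y j else 1.
  have zE j : z (enum_val j) = y j.
    rewrite /z; case: pickP => [j' /eqP/enum_val_inj -> //|/(_ j)].
    by rewrite eqxx.
  have zV i : i \in V Z -> z i = 1.
    rewrite inE => iZ; rewrite /z; case: pickP => // j /eqP Ej.
    by rewrite -Ej lev_enum_val aZ in iZ.
  apply: contraNneq Dy => F0; rewrite -(meval0 z) -F0 FE; apply/eqP/meval_eq => j.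
  rewrite zE mevalX big1 ?mulr1 // => i _; rewrite mnmE.
  by case: ifP => [/zV ->|_]; rewrite ?expr1n.
have [G G0 HG] := mpow_push K_char0 A0 F0.
exists G => // c _ Gc _ _ z tz E; have := HG z tz.
rewrite FE; apply; rewrite E (meval_eq (v2 := fun i => iota (c i))) //.
by move=> i; rewrite ffunE.
Qed.

End Generic.

Hypothesis r_gt0 : forall i, (0 < r i)%N.
Variable mu : 'I_s -> nat.
Variable D : forall a : 'I_s, {mpoly K[#|block n nu a|]}.
Hypothesis D_mult : forall (a : 'I_s) (c : 'I_#|block n nu a| -> K), (D a).@[c] != 0 ->
  has_codim (in_loc (binomial_system (@sub_r n (block n nu a) r)
    (@sub_beta n (block n nu a) beta) c) [ffun=> 0]) (mu a).
Hypothesis lev_surj : forall a, exists i, lev i = a.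
Hypothesis lev_le : forall i j, beta i j != 0%N -> (lev j <= lev i)%N.
Hypothesis lev_self : forall i, exists2 j, lev j = lev i & beta i j != 0%N.
Hypothesis lev_irr : forall (a : 'I_s) (I : {set 'I_n}) i0, i0 \in I ->
  (forall i, i \in I -> lev i = a) ->
  (forall i j, i \in I -> lev j = a -> beta i j != 0%N -> j \in I) ->
  forall i, lev i = a -> i \in I.

Variable c : {ffun 'I_n -> K}.
Hypothesis c_neq0 : forall i, c i != 0.
Hypothesis c_no_torus : forall Z,
  \det (A Z) = 0 -> forall z, torus z -> mpow z (A Z) <> c.
Hypothesis c_block : forall Z a, a \in Z -> \det (A Z) != 0 ->
  forall z, torus z -> mpow z (A Z) = c -> (D a).@[block_coef Z z (a := a)] != 0.
Let p := binomial_system r beta c.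
Notation src := (zsources r beta nu).

Lemma multiplicity_at_solution Z x : zclosed r beta nu Z ->
  is_solution p x -> pattern lev Z x ->
  is_multiplicity p x
    ((\prod_(b in Z :\: src Z) rho r nu b) * \prod_(e in src Z) mu e)%N.
Proof.
move=> cZ sol px.
have [tz Ez] := fill_torus blockE lev_le c_neq0 cZ sol px.
(* For the given [c] a zero determinant would exclude the solution [x]. *)
have A0 : \det (A Z) != 0 by apply/eqP => A0; apply: c_no_torus A0 _ tz Ez.
have xV i : (i \in V Z) = (x i != 0) by rewrite inE px.
apply/is_multiplicityP; apply: (@has_codim_fibre _ _ _ _ _ _ (V Z)) => //.
- move=> i j; rewrite !inE => iZ bij; apply: contraNN iZ.
  exact: (elimT (zclosedP r blockE lev_le Z) cZ).
- exact: intr_neq0.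
apply: (has_codim_origin r_gt0 blockE lev_le lev_irr) => e esrc.
have eZ : e \in Z by move: esrc; rewrite inE => /andP[].
have := c_block eZ A0 tz Ez.
rewrite (meval_eq (v2 := fun j => fibre_coef x beta c (V Z) (enum_val j))).
  exact: D_mult.
move=> j; rewrite /block_coef /fibre_coef ffunE.
rewrite lev_enum_val eZ; congr (_ * _).
rewrite !mevalX; apply: eq_bigr => i _; rewrite mnmE; case: ifP => [|_]; last by rewrite !expr0.
by rewrite inE => /negbTE iZ; rewrite ffunE iZ.
Qed.

(** The lists for the different closed [Z] are disjoint because the zero coordinates of a solution
    determine [Z]; this uses that no block is empty. *)
Lemma count_solutions :
  number_of_solutions p
    (\sum_(H in full_subgraphs (arrow r beta (s := s) nu))
       \prod_(a : 'I_s | a \notin H.1) delta r beta nu a)%N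
  /\
  number_of_solutions_with_multiplicity p
    (\sum_(H in full_subgraphs (arrow r beta (s := s) nu))
       (\prod_(a : 'I_s | a \notin H.1) delta r beta nu a) *
       (\prod_(b in H.1 :\: sources H) rho r nu b) *
       (\prod_(e in sources H) mu e))%N.
Proof.
have /fin_all_exists[t Ht] : forall Z : {set 'I_s}, exists t : seq {ffun 'I_n -> K},
    zclosed r beta nu Z -> [/\ uniq t,
      size t = (\prod_(a : 'I_s | a \notin Z) delta r beta nu a)%N &
      forall x, x \in t <-> is_solution p x /\ pattern lev Z x].
  move=> Z; have [cZ|_] := boolP (zclosed r beta nu Z); last by exists [::].

  have [t Ht] := pattern_solutions r_gt0 blockE lev_le lev_self K_char0 c_neq0 cZ
    (c_no_torus (Z := Z)).
  by exists t.
pose key (x : {ffun 'I_n -> K}) := [set lev i | i in [set i | x i == 0]].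
have keyE Z x : pattern lev Z x -> key x = Z.
  move=> px; apply/setP => a; apply/imsetP/idP => [[i]|aZ].
    by rewrite inE px => iZ ->.
  by have [i Ei] := lev_surj a; exists i; rewrite // inE px Ei.
pose wf Z := ((\prod_(b in Z :\: src Z) rho r nu b) * \prod_(e in src Z) mu e)%N.
have [|Z x cZ xt|usol msol ssol wsol] :=
  @flatten_classes _ _ (zclosed r beta nu) t key wf; first by move=> Z /Ht[].
  by have [_ _ /(_ x)[/(_ xt)[_ /keyE]]] := Ht Z cZ.
set sol := flatten _ in usol msol ssol wsol.
have esol : enumerates_solutions p sol.
  split=> // x; rewrite msol; split=> [[Z cZ]|solx].
    by have [_ _ ->] := Ht Z cZ => -[].
  have [Z cZ px] := solution_pattern blockE lev_le lev_irr solx.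
  by exists Z => //; have [_ _ ->] := Ht Z cZ.
split.
  exists sol => //; rewrite ssol.
  rewrite (sum_full_subgraphs r beta nu (fun Z _ => \prod_(a | a \notin Z) delta r beta nu a)%N).
  by apply: eq_bigr => Z /Ht[].
exists sol, (fun x => wf (key x)); split=> // [x /msol[Z cZ xt]|].
  have [_ _ /(_ x)[/(_ xt)[solx px] _]] := Ht Z cZ.
  by rewrite (keyE _ _ px); apply: multiplicity_at_solution.
rewrite wsol; pose F Z S := ((\prod_(a | a \notin Z) delta r beta nu a) *
    (\prod_(b in Z :\: S) rho r nu b) * (\prod_(e in S) mu e))%N.
rewrite (sum_full_subgraphs r beta nu F); apply: eq_bigr => Z /Ht[_ -> _].
by rewrite /F /wf mulnA.
Qed.

End Main.

Theorem theorem3p14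
  (k : fieldType) (k_char0 : [pchar k] =i pred0)
  (K : closedFieldType) (iota : {rmorphism k -> K})
  (K_algebraic : forall z : K, algebraicOver iota z)
  (n s : nat) (r : 'I_n -> nat) (beta : 'I_n -> 'X_{1..n}) (nu : nat -> nat)
  (p_normal : normal_form r beta)
  (p_triangular : triangular_form r beta s nu)
  (mu : 'I_s -> nat)
  (mu_generic : forall a : 'I_s,
     is_generic_origin_multiplicity iota
       (@sub_r n (block n nu a) r) (@sub_beta n (block n nu a) beta) (mu a)) :
  generic (fun c : {ffun 'I_n -> k} =>
    let p := binomial_system r beta (fun i => iota (c i)) in
    let G := arrow r beta (s := s) nu in
    number_of_solutions p
      (\sum_(H in full_subgraphs G)
         \prod_(a : 'I_s | a \notin H.1) delta r beta nu a)%N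
    /\
    number_of_solutions_with_multiplicity p
      (\sum_(H in full_subgraphs G)
         (\prod_(a : 'I_s | a \notin H.1) delta r beta nu a) *
         (\prod_(b in H.1 :\: sources H) rho r nu b) *
         (\prod_(e in sources H) mu e))%N).
Proof.
have [lev [blockE lev_surj lev_le lev_self lev_irr]] := triangular_levels p_triangular.
have /fin_all_exists2[D D_neq0 D_mult] :=
  fun a => generic_multiplicity_extend k_char0 (mu_generic a).
have K_char0 : [pchar K] =i pred0 by move=> m; rewrite (fmorph_pchar iota) k_char0.
apply: (genericK_generic (iota := iota) k_char0).
have H1 := genericK_all (generic_no_torus_solution r beta lev iota).
have H2 := genericK_all (fun Za : {set 'I_s} * 'I_s =>
  generic_block_coef K_char0 r beta blockE iota Za.1 (D_neq0 Za.2)).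
apply: genericK_sub (genericK_and H1 H2) => c c_neq0 [no_torus blocks] /=.
pose ic : {ffun 'I_n -> K} := [ffun i => iota (c i)].
have -> : (fun i => iota (c i)) = ic.
  by apply: functional_extensionality => i; rewrite ffunE.
apply: (count_solutions K_char0 blockE _ D_mult) => // [i|i|Z a].
- by case: (p_normal i).
- by rewrite ffunE fmorph_eq0.
exact: (blocks (Z, a)).
Qed.
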